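(* Let $M$ be a model of DOAG (non-trivial divisible ordered Abelian groups), and let $A\le B$, $A\le C$ be $\mathbb{Q}$-vector subspaces of $M$, where $M$ is sufficiently saturated and strongly homogeneous (at least $|B\cup C|^+$). Suppose every closed bounded interval with bounds in $B$ having a point in $C$ has a point in $A$. Let $c$ be a finite $\mathrm{val}^3_B$-separated family of elements of $C$, and let $(c_i)_i$ be its $\mathrm{val}^1_B$-blocks (so that $c$ is, up to reordering, the concatenation of the $c_i$). For each $i$, let $d_i$ be the subtuple of $c_i$ of points which are ramified over $B$. Let $F_i$ be the space of all global $\mathrm{Aut}(M/A)$-invariant extensions of $\mathrm{tp}(d_i/B)$; for $q\in F_i$ let $S_q$ be the space of global $\mathrm{Aut}(M/A)$-invariant extensions of $\mathrm{tp}(c_i/B)$ which extend $q$; and let $S_i$ be the space of all global $\mathrm{Aut}(M/A)$-invariant extensions of $\mathrm{tp}(c_i/B)$. Then: (1) each $F_i$ is finite; (2) each $S_q$ is homeomorphic to some closed set of parameter-free DOAG-types (a closed subspace of a Stone space of complete types over $\{0\}$ in DOAG); (3) $S_i=\bigcup_{q\in F_i}S_q$ is a finite disjoint union, naturally homeomorphic to the topological coproduct $\coprod_{q\in F_i}S_q$; (4) the space of global $\mathrm{Aut}(M/A)$-invariant extensions of $\mathrm{tp}(c/B)$ is naturally homeomorphic (via restriction of types to the variables of each block) to the product $\prod_i S_i$. In particular this space is homeomorphic to a space of the form $\prod_i\coprod_j F_{ij}$ (finite product of finite coproducts), where each $F_{ij}$ is a closed set of parameter-free DOAG-types.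
   Context: Spaces of types carry the Stone topology; a global type is a complete type over $M$. For $d\in M$, the cut $\mathrm{ct}(d/B)$ is the intersection of all intervals (of any kind) with bounds in $B\cup\{\pm\infty\}$ containing $d$. $\mathrm{Stab}(d/B)=\{b\in B:\mathrm{ct}(d+b/B)=\mathrm{ct}(d/B)\}$, a convex subgroup of $B$. If $d\notin B$, put $G(d/B)=\bigcap\{\,]-|b|,|b|[\;: b\in B\smallsetminus\mathrm{Stab}(d/B)\}$ (a convex subgroup of $M$; it is $M$ if the index set is empty); if $d\in B$, put $G(d/B)=\{0\}$. Put $\mathrm{val}^1_B(d)=G(d/B)$, ordered by inclusion. For $x\in M$, $\Delta(x)$ is its Archimedean class: $\Delta(x)\le\Delta(y)$ iff $|x|\le n|y|$ for some $n<\omega$. A point $d\notin B$ is ramified over $B$ if the coset $d+G(d/B)$ has a point in $B$; then $\Delta(d-b)$ does not depend on the choice of $b\in B\cap(d+G(d/B))$ and is denoted $\delta(d/B)$. A point which is not ramified over $B$ is called Archimedean over $B$. $\mathrm{val}^3_B$ is the quotient map of $M$ by the total preorder: $x\preceq y$ iff $\mathrm{val}^1_B(x)<\mathrm{val}^1_B(y)$, or $\mathrm{val}^1_B(x)=\mathrm{val}^1_B(y)$ and one of the following holds: $y$ is Archimedean over $B$; or both $x,y$ are ramified over $B$ and $\delta(x/B)\le\delta(y/B)$. The map $\mathrm{val}^3_B$ satisfies the ultrametric inequality $\mathrm{val}^3_B(x-y)\le\max(\mathrm{val}^3_B(x),\mathrm{val}^3_B(y))$, and its least value is attained exactly on $B$.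 A finite family $(v_i)_i$ is $\mathrm{val}^3_B$-separated if no $v_i$ lies in $B$ and, for all $\lambda_i\in\mathbb{Q}$, $\mathrm{val}^3_B(\sum_i\lambda_iv_i)=\max_i\mathrm{val}^3_B(\lambda_iv_i)$. The $\mathrm{val}^1_B$-blocks of a family are its maximal subtuples of elements of equal $\mathrm{val}^1_B$-value. *)

(* Defs.v *)
Set Warnings "-notation-overridden".
From HB Require Import structures.
From mathcomp Require Import all_boot all_order all_algebra.
From mathcomp Require Import all_classical all_reals all_analysis.
Set Implicit Arguments.
Unset Strict Implicit.
Unset Printing Implicit Defensive.
Import Order.TTheory GRing.Theory Num.Theory.
Local Open Scope classical_set_scope.
Local Open Scope ring_scope.

HB.mixin Record isDOAG M of Num.POrderedZmodule M := {
  doag_total : total (<=%R : rel M);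
  doag_lerD2r : forall x y z : M, x <= y -> x + z <= y + z;
  doag_divisible : forall (n : nat) (x : M), exists y : M, y *+ n.+1 = x;
  doag_nontrivial : exists x : M, x != 0 }.

#[short(type="doagType")]
HB.structure Definition DOAG := {M of Num.POrderedZmodule M & isDOAG M}.

HB.instance Definition _ (M : doagType) :=
  Order.POrder_isTotal.Build ring_display M doag_total.

Section RationalScaling.
Context {M : doagType}.
Implicit Types x y z : M.

Let ltrD2r x y z : x < y -> x + z < y + z.
Proof.
move=> xy; rewrite lt_neqAle doag_lerD2r ?ltW// andbT.
by apply: contraTneq xy => /addIr ->; rewrite ltxx.
Qed.

Let mulrSn_gt0 x n : 0 < x -> 0 < x *+ n.+1.
Proof.
move=> x0; elim: n => [|n IH]; first by rewrite mulr1n.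
by rewrite mulrS (lt_trans IH)// -[ltLHS]add0r ltrD2r.
Qed.

Let mulrSn_eq0 x n : x *+ n.+1 = 0 -> x = 0.
Proof.
move=> xn0; case: (ltgtP x 0) => // x0.
- have /(mulrSn_gt0 n) : 0 < - x by move: (ltrD2r (- x) x0); rewrite subrr add0r.
  by rewrite mulNrn xn0 oppr0 ltxx.
- by move: (mulrSn_gt0 n x0); rewrite xn0 ltxx.
Qed.

Let mulrz_inj (k : int) x y : k != 0 -> x *~ k = y *~ k -> x = y.
Proof.
move=> k0 /eqP; rewrite -subr_eq0 -mulrzBl => /eqP xyk; apply/subr0_eq.
case: k k0 xyk => [[//|n] _|n _]; first exact: mulrSn_eq0.
by move=> /eqP; rewrite NegzE mulrNz oppr_eq0 => /eqP; exact: mulrSn_eq0.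
Qed.

(** A divisible ordered group is torsion-free, hence it carries exactly one
    structure of rational vector space. *)
Definition qscale (r : rat) x : M :=
  xget 0 [set y | y *~ denq r = x *~ numq r].

Lemma qscaleP (r : rat) x : qscale r x *~ denq r = x *~ numq r.
Proof.
rewrite /qscale; case: xgetP => [//|] /=.
have := denq_gt0 r; case: (denq r) => [[//|n] _|//] nex.
have [y yE] := doag_divisible n (x *~ numq r).
by case: (nex y).
Qed.

Let qscale_eq (r : rat) x y (d n : int) :
  d != 0 -> r = n%:~R / d%:~R -> y *~ d = x *~ n -> y = qscale r x.
Proof.
move=> d0 rE yE; apply: (@mulrz_inj (d * denq r)); first by rewrite mulf_neq0.
rewrite mulrzA yE mulrC !mulrzA qscaleP -!mulrzA; congr (_ *~ _).
apply: (@intr_inj rat); rewrite !intrM.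
have -> : n%:~R = r * d%:~R by rewrite rE mulfVK// intr_eq0.
have -> : (numq r)%:~R = r * (denq r)%:~R.
  by rewrite -[X in X * _](divq_num_den r) mulfVK// intr_eq0.
by rewrite mulrAC.
Qed.

Fact qscaleA (a b : rat) x : qscale a (qscale b x) = qscale (a * b) x.
Proof.
apply: (@qscale_eq _ _ _ (denq a * denq b) (numq a * numq b)).
- by rewrite mulf_neq0.
- by rewrite !intrM -mulf_div !divq_num_den.
- by rewrite mulrzA qscaleP mulrzAC qscaleP mulrzAC -mulrzA mulrC.
Qed.

Fact qscale1 : left_id 1 qscale.
Proof. by move=> x; apply/esym; apply: (@qscale_eq _ _ _ 1 1). Qed.

Fact qscaleDr : right_distributive qscale +%R.
Proof.
move=> r x y; apply/esym; apply: (@qscale_eq _ _ _ (denq r) (numq r)) => //.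
  by rewrite divq_num_den.
by rewrite !mulrzDl !qscaleP.
Qed.

Fact qscaleDl x : {morph qscale^~ x : a b / a + b}.
Proof.
move=> a b; apply/esym.
apply: (@qscale_eq _ _ _ (denq a * denq b)
          (numq a * denq b + numq b * denq a)).
- by rewrite mulf_neq0.
- by rewrite intrD !intrM -addf_div ?intr_eq0// !divq_num_den.
- rewrite mulrzDl mulrzA qscaleP [denq a * _]mulrC mulrzA qscaleP.
  by rewrite -!mulrzA -mulrzDr.
Qed.

End RationalScaling.

HB.instance Definition _ (M : doagType) :=
  GRing.Zmodule_isLmodule.Build rat M qscaleA qscale1 qscaleDr qscaleDl.

Definition rat_subspace (M : doagType) (A : set M) : Prop :=
  A 0 /\ forall (r : rat) x y, A x -> A y -> A (r *: x + y).

(** Terms and formulas of the language [{0, +, -, <}], with constants in [C] and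
    free variables in [V].  A quantifier binds the extra variable [None] of
    [option V]. *)
Inductive term (C V : Type) : Type :=
| TVar of V
| TCst of C
| TZero
| TAdd of term C V & term C V
| TOpp of term C V.

Inductive formula (C V : Type) : Type :=
| FEq of term C V & term C V
| FLt of term C V & term C V
| FNot of formula C V
| FAnd of formula C V & formula C V
| FEx of formula C (option V).

Arguments TZero {C V}.

Fixpoint term_map (C D V W : Type) (g : C -> D) (f : V -> W) (t : term C V)
    : term D W :=
  match t with
  | TVar i => TVar D (f i)
  | TCst a => TCst W (g a)
  | TZero => TZero
  | TAdd t1 t2 => TAdd (term_map g f t1) (term_map g f t2)
  | TOpp t1 => TOpp (term_map g f t1)
  end.

Fixpoint formula_map (C D V W : Type) (g : C -> D) (f : V -> W) (phi : formula C V)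
    : formula D W :=
  match phi with
  | FEq t1 t2 => FEq (term_map g f t1) (term_map g f t2)
  | FLt t1 t2 => FLt (term_map g f t1) (term_map g f t2)
  | FNot phi1 => FNot (formula_map g f phi1)
  | FAnd phi1 phi2 => FAnd (formula_map g f phi1) (formula_map g f phi2)
  | FEx phi1 => FEx (formula_map g (omap f) phi1)
  end.

Fixpoint term_params (C V : Type) (t : term C V) : set C :=
  match t with
  | TVar _ | TZero => set0
  | TCst a => [set a]
  | TAdd t1 t2 => term_params t1 `|` term_params t2
  | TOpp t1 => term_params t1
  end.

Fixpoint params (C V : Type) (phi : formula C V) : set C :=
  match phi with
  | FEq t1 t2 | FLt t1 t2 => term_params t1 `|` term_params t2
  | FNot phi1 => params phi1
  | FAnd phi1 phi2 => params phi1 `|` params phi2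
  | FEx phi1 => params phi1
  end.

Fixpoint term_val (M : doagType) (V : Type) (v : V -> M) (t : term M V) : M :=
  match t with
  | TVar i => v i
  | TCst a => a
  | TZero => 0
  | TAdd t1 t2 => term_val v t1 + term_val v t2
  | TOpp t1 => - term_val v t1
  end.

Fixpoint holds (M : doagType) (V : Type) (v : V -> M) (phi : formula M V) : Prop :=
  match phi with
  | FEq t1 t2 => term_val v t1 = term_val v t2
  | FLt t1 t2 => term_val v t1 < term_val v t2
  | FNot phi1 => ~ holds v phi1
  | FAnd phi1 phi2 => holds v phi1 /\ holds v phi2
  | FEx phi1 => exists x : M, holds (fun o => if o is Some i then v i else x) phi1
  end.

(** A complete type over [B] in the variables [V], relative to the elementary
    diagram of [M]: finite satisfiability is required in [M]. *)
Definition complete_type (M : doagType) (B : set M) (V : Type) (p : set (formula M V))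
    : Prop :=
  [/\ forall phi, p phi -> params phi `<=` B,
      forall s, finite_set s -> s `<=` p ->
        exists v : V -> M, forall phi, s phi -> holds v phi
    & forall phi, params phi `<=` B -> p phi \/ p (FNot phi)].

Definition typespace (M : doagType) (B : set M) (V : Type) : Type :=
  {p : set (formula M V) | complete_type B p}.

Definition tp (M : doagType) (B : set M) (V : Type) (v : V -> M) : set (formula M V) :=
  [set phi | params phi `<=` B /\ holds v phi].

Section StoneTopology.
Context {M : doagType} {B : set M} {V : Type}.
Local Notation T := (typespace B V).

HB.instance Definition _ := gen_eqMixin T.
HB.instance Definition _ := gen_choiceMixin T.

Definition stone_open (U : set T) : Prop :=
  forall p, U p -> exists2 phi, sval p phi & forall q : T, sval q phi -> U q.

Fact stone_openT : stone_open setT.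
Proof.
move=> p _; have [_ _ cp] := svalP p.
have [||pt] := cp (FEq TZero TZero); last by exists (FNot (FEq TZero TZero)).
- by rewrite /= setU0; exact: sub0set.
- by exists (FEq TZero TZero).
Qed.

Fact stone_openI (U1 U2 : set T) :
  stone_open U1 -> stone_open U2 -> stone_open (U1 `&` U2).
Proof.
move=> o1 o2 p [/o1 [f1 pf1 f1U] /o2 [f2 pf2 f2U]].
have andP (q : T) : sval q (FAnd f1 f2) <-> sval q f1 /\ sval q f2.
  have [pq sq cq] := svalP q.
  have contra (s : set (formula M V)) : finite_set s -> s `<=` sval q ->
      (forall v : V -> M, ~ (forall phi, s phi -> holds v phi)) -> False.
    by move=> fs sq' sF; have [v /sF] := sq _ fs sq'.
  split=> [qf|[qf1 qf2]].
    have /= qB := pq _ qf; split.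
      have [|//|qn] := cq f1; first by move=> x x1; apply: qB; left.
      exfalso; apply: (contra [set FAnd f1 f2; FNot f1]).
      - by rewrite finite_setU; split; exact: finite_set1.
      - by move=> phi /= [->|->].
      - by move=> v vs; case: (vs _ (or_introl erefl)) (vs _ (or_intror erefl)).
    have [|//|qn] := cq f2; first by move=> x x1; apply: qB; right.
    exfalso; apply: (contra [set FAnd f1 f2; FNot f2]).
    - by rewrite finite_setU; split; exact: finite_set1.
    - by move=> phi /= [->|->].
    - by move=> v vs; case: (vs _ (or_introl erefl)) (vs _ (or_intror erefl)).
  have [|//|qn] := cq (FAnd f1 f2).
    by move=> x /= [|]; [exact: (pq _ qf1)|exact: (pq _ qf2)].
  exfalso; apply: (contra [set f1; f2; FNot (FAnd f1 f2)]).
  - by rewrite !finite_setU; do !split; exact: finite_set1.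
  - by move=> phi /= [[->|->]|->].
  - move=> v vs; have /= := vs _ (or_intror erefl); apply; split.
      exact: (vs _ (or_introl (or_introl erefl))).
    exact: (vs _ (or_introl (or_intror erefl))).
exists (FAnd f1 f2); first exact/andP.
by move=> q /andP [qf1 qf2]; split; [exact: f1U|exact: f2U].
Qed.

Fact stone_open_bigU (J : Type) (U : J -> set T) :
  (forall i, stone_open (U i)) -> stone_open (\bigcup_i U i).
Proof.
move=> oU p [i _ /oU [phi pphi phiU]]; exists phi => // q qphi.
by exists i => //; exact: phiU.
Qed.

HB.instance Definition _ :=
  isOpenTopological.Build T stone_openT stone_openI stone_open_bigU.

End StoneTopology.

Lemma term_val_map (M : doagType) (V W : Type) (f : W -> V) (v : V -> M) (t : term M W) :
  term_val v (term_map id f t) = term_val (v \o f) t.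
Proof. by elim: t => //= [t1 -> t2 ->|t1 ->]. Qed.

Lemma holds_map (M : doagType) (V W : Type) (f : W -> V) (v : V -> M)
    (phi : formula M W) :
  holds v (formula_map id f phi) <-> holds (v \o f) phi.
Proof.
elim: phi V f v => {W} /=.
- by move=> W t1 t2 V f v; rewrite !term_val_map.
- by move=> W t1 t2 V f v; rewrite !term_val_map.
- by move=> W phi IH V f v; rewrite IH.
- by move=> W phi1 IH1 phi2 IH2 V f v; rewrite IH1 IH2.
- move=> W phi IH V f v.
  have E x : (fun o => if o is Some i then v i else x) \o omap f =
             (fun o => if o is Some i then (v \o f) i else x).
    by apply/funext; case.
  by split=> -[x xP]; exists x; move: xP; rewrite IH E.
Qed.

Lemma term_params_map (C V W : Type) (f : W -> V) (t : term C W) :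
  term_params (term_map id f t) = term_params t.
Proof. by elim: t => //= t1 -> t2 ->. Qed.

Lemma params_map (C V W : Type) (f : W -> V) (phi : formula C W) :
  params (formula_map id f phi) = params phi.
Proof.
elim: phi V f => {W} //=.
- by move=> W t1 t2 V f; rewrite !term_params_map.
- by move=> W t1 t2 V f; rewrite !term_params_map.
- by move=> W phi1 IH1 phi2 IH2 V f; rewrite IH1 IH2.
Qed.

Fact tp_restrict_subproof (M : doagType) (B : set M) (V W : Type) (f : W -> V)
    (p : typespace B V) :
  complete_type B [set phi | sval p (formula_map id f phi)].
Proof.
have [pp sp cp] := svalP p; split=> /=.
- by move=> phi /pp; rewrite params_map.
- move=> s fs sP; have [||v vP] := sp (formula_map id f @` s).
  + exact: finite_image.
  + by move=> _ [phi sphi <-]; exact: sP.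
  + exists (v \o f) => phi sphi; rewrite -holds_map; apply: vP.
    by exists phi.
- by move=> phi phiB; apply: (cp (formula_map id f phi)); rewrite params_map.
Qed.

Definition tp_restrict (M : doagType) (B : set M) (V W : Type) (f : W -> V)
    (p : typespace B V) : typespace B W :=
  exist _ _ (tp_restrict_subproof f p).

Definition doag_aut (M : doagType) (s : M -> M) : Prop :=
  [/\ bijective s, {morph s : x y / x + y} & {mono s : x y / x <= y}].

(** [D #<= X] says that [D] has cardinality less than [|X|^+]. *)
Definition succ_saturated (M : doagType) (X : set M) : Prop :=
  forall D : set M, (D #<= X)%card -> forall p : typespace D unit,
    exists v : unit -> M, sval p = tp D v.

Definition elementary_on (M : doagType) (D : set M) (f : M -> M) : Prop :=
  forall phi : formula M void, params phi `<=` D ->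
    holds (of_void M) phi <-> holds (of_void M) (formula_map f id phi).

Definition succ_strongly_homogeneous (M : doagType) (X : set M) : Prop :=
  forall D : set M, (D #<= X)%card -> forall f : M -> M, elementary_on D f ->
    exists2 s : M -> M, doag_aut s & forall x, D x -> s x = f x.

Definition globaltype (M : doagType) (V : Type) : Type :=
  typespace [set: M] V.

HB.instance Definition _ (M : doagType) (V : Type) :=
  Topological.copy (globaltype M V) (typespace [set: M] V).

Definition aut_invariant (M : doagType) (A : set M) (V : Type)
    (p : globaltype M V) : Prop :=
  forall s : M -> M, doag_aut s -> (forall a, A a -> s a = a) ->
    forall phi, sval p phi <-> sval p (formula_map s id phi).

Definition inv_ext (M : doagType) (A B : set M) (V : Type) (v : V -> M)
    : set (globaltype M V) :=
  [set p | aut_invariant A p /\ tp B v `<=` sval p].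

Section Valuations.
Context {M : doagType}.
Implicit Types (B : set M) (d x y : M).

Definition doag_abs x : M := Num.max x (- x).

Definition bound_in B (e : itv_bound M) : Prop :=
  if e is BSide _ x then B x else True.

Definition ct B d : set M :=
  \bigcap_(i in [set i : interval M |
    [/\ bound_in B i.1, bound_in B i.2 & d \in i]]) [set` i].

Definition Stab B d : set M := [set b | B b /\ ct B (d + b) = ct B d].

Definition cutG B d : set M :=
  [set x | if `[< B d >] then x = 0
           else (\bigcap_(b in B `\` Stab B d)
                   `]- doag_abs b, doag_abs b[%classic) x].

Definition val1 B d : set M := cutG B d.

Definition arch_le x y : Prop := exists n : nat, doag_abs x <= doag_abs y *+ n.

Definition coset_pts B d : set M := [set b | B b /\ cutG B d (b - d)].

Definition ramified B d : Prop := ~ B d /\ coset_pts B d !=set0.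

(** Points of [B] count as Archimedean, so that [val3_le] is reflexive. *)
Definition archimedean B d : Prop := ~ ramified B d.

(** [delta x <= delta y] for [x], [y] ramified over [B]: the Archimedean class
    of [d - b] is the same for all [b] in [coset_pts B d]. *)
Definition delta_le B x y : Prop :=
  exists b b' : M,
    [/\ coset_pts B x b, coset_pts B y b' & arch_le (x - b) (y - b')].

(** The total preorder whose quotient map is the valuation [val3]. *)
Definition val3_le B x y : Prop :=
  val1 B x `<` val1 B y \/
  (val1 B x = val1 B y /\
   (archimedean B y \/
    [/\ ramified B x, ramified B y & delta_le B x y])).

(** The value of the sum is the maximum of the values of the terms.  Since the
    value of [0] is the least one, the disjunct [val3_le B s 0] only serves to
    give the empty maximum its value. *)
Definition val3_separated B (I : finType) (v : I -> M) : Prop :=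
  (forall i, ~ B (v i)) /\
  forall l : I -> rat, let s := \sum_i l i *: v i in
    (forall i, val3_le B (l i *: v i) s) /\
    (val3_le B s 0 \/ exists i, val3_le B s (l i *: v i)).

End Valuations.

Definition subtuple (X V : Type) (v : V -> X) (J : set V) : J -> X :=
  fun j => v (val j).

(** The blocks of a family are indexed by the values of [val1] on the family. *)
Definition blocks (M : doagType) (B : set M) (V : Type) (v : V -> M) : set (set M) :=
  range (fun i => val1 B (v i)).

Definition block (M : doagType) (B : set M) (V : Type) (v : V -> M) (g : set M)
    : set V :=
  [set i | val1 B (v i) = g].

Definition block_tuple (M : doagType) (B : set M) (V : Type) (v : V -> M) (g : set M)
    : block B v g -> M :=
  subtuple v (J := block B v g).

Arguments block_tuple {M} B {V} v g _.

Definition ram (M : doagType) (B : set M) (V : Type) (v : V -> M) : set V :=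
  [set i | ramified B (v i)].

Definition ram_tuple (M : doagType) (B : set M) (V : Type) (v : V -> M) : ram B v -> M :=
  subtuple v (J := ram B v).

Arguments ram_tuple {M} B {V} v _.

Definition ram_ext (M : doagType) (A B : set M) (V : Type) (v : V -> M)
    : set (globaltype M (ram B v)) :=
  inv_ext A B (ram_tuple B v).

Arguments ram_ext {M} A B {V} v _.

Definition inv_ext_over (M : doagType) (A B : set M) (V : Type) (v : V -> M)
    (q : globaltype M (ram B v)) : set (globaltype M V) :=
  [set p | inv_ext A B v p /\ tp_restrict val p = q].

Arguments inv_ext_over {M} A B {V} v q _.

Definition homeomorphism (T U : topologicalType) (f : T -> U) : Prop :=
  continuous f /\ exists g : U -> T, [/\ continuous g, cancel f g & cancel g f].

Definition homeomorphic (T U : topologicalType) : Prop :=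
  exists f : T -> U, homeomorphism f.

(* Main.v *)
(** By quantifier elimination a global type in finitely many variables amounts to a
    total cone of affine forms, so an extension is given by the signs of the forms
    [l x + m].  Let [s] be the value of [l] at the given tuple.  By homogeneity,
    an [Aut(M/A)]-invariant extension puts [l x] at one of the two ends of the
    cut of [s] over [B].

    In a block of value [G], translation by [B] moves the forms with a ramified value
    into [G].  Those that an invariant extension keeps within [G] of their original
    value form a convex subspace, which determines the extension on the ramified
    part and, as the Archimedean classes are separated, is spanned by coordinate
    vectors: there are finitely many choices.  If the value [s] of a form is
    Archimedean, its cut is the coset [s + G], and [A] approaches both of its ends as
    soon as it approaches one.  So every order on the forms, considered modulo [G],
    that is compatible with the ramified part yields an invariant extension, as a
    lexicographic combination.

    A form involving several blocks is decided by its top block: the rest of it is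
    at a distance bounded in [B `&` G] from a point of [A], and the cuts of the top
    block are stable under such translations. *)
Require Import Defs.
From HB Require Import structures.
From Stdlib Require Import Rdefinitions.
From Stdlib Require Lra.
From mathcomp Require Import all_boot all_order all_algebra.
From mathcomp Require Import all_classical all_reals all_analysis.
From mathcomp Require Import Rstruct.
Set Implicit Arguments.
Unset Strict Implicit.
Unset Printing Implicit Defensive.
Import Order.TTheory GRing.Theory Num.Theory.
Local Open Scope classical_set_scope.
Local Open Scope ring_scope.

(** * Total preorders on rational vector spaces *)

(** No elementary extension of [M] is ever built. A global type is produced from a total cone of
    forms by checking finite satisfiability in [M], where Fourier-Motzkin elimination finds the
    witnesses; the same elimination step yields quantifier elimination and reduces linear arithmetic
    in [M] to that of the reals. Cones are mere preorders: once [G] is collapsed to [0], a form and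
    its opposite can both be nonnegative. Saturation enters through a point just above a given one.
    The cut of a point of [C] outside [B] therefore has several points, and since these are
    conjugate over [A], no invariant extension makes a form equal to one of them. The main obstacle
    is that [G] does not act on cuts. A shift by [G] can carry a ramified point across a point of
    [B], whereas a shift bounded by an element of [B] in [G] preserves the cut. For an Archimedean
    value, the cut and the coset of [G] coincide: this is why the Archimedean part is free and the
    ramified part rigid. *)

Definition total_cone (E : lmodType rat) (P : E -> Prop) : Prop :=
  (forall x, P x \/ P (- x)) /\ (forall x y, P x -> P y -> P (x + y)).

Section Cone.
Variables (E : lmodType rat) (P : E -> Prop).
Hypothesis coneP : total_cone P.

Lemma cone0 : P 0.
Proof. by case: (coneP.1 0); rewrite ?oppr0. Qed.

Lemma cone_mulrn x n : P x -> P (x *+ n).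
Proof.
move=> Px; elim: n => [|n IH]; first by rewrite mulr0n; exact: cone0.
by rewrite mulrS; exact: coneP.2.
Qed.

(** If [P (- x)] held instead, adding [n] copies of [- x] to [x *+ n.+1] would leave [x]. *)
Lemma cone_mulrn_inv x n : P (x *+ n.+1) -> P x.
Proof.
move=> Pxn; case: (coneP.1 x) => // PNx.
have := coneP.2 _ _ Pxn (cone_mulrn n PNx).
by rewrite mulNrn mulrSr addrAC subrr add0r.
Qed.

Lemma cone_scale (r : rat) x : 0 <= r -> P x -> P (r *: x).
Proof.
move=> r0 Px; have d0 := denq_gt0 r.
apply: (@cone_mulrn_inv _ `|denq r|.-1); rewrite prednK ?absz_gt0 ?gt_eqF//.
rewrite -scaler_nat scalerA.
have -> : (`|denq r|%:R * r) = (`|numq r|%N)%:R :> rat.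
  rewrite -{2}(divq_num_den r) -[`|denq r|%:R]/(`|denq r|%:Z%:~R) gtz0_abs//.
  rewrite mulrC mulfVK ?intr_eq0 ?gt_eqF//.
  by rewrite -[in RHS]/(`|numq r|%:Z%:~R) gez0_abs ?numq_ge0.
by rewrite scaler_nat; exact: cone_mulrn.
Qed.

Lemma cone_scaleE (r : rat) x : 0 < r -> P (r *: x) <-> P x.
Proof.
move=> r0; split; last by apply: cone_scale; exact: ltW.
move=> /(@cone_scale r^-1 _); rewrite invr_ge0 scalerA mulVf ?gt_eqF// scale1r.
by apply; exact: ltW.
Qed.

Lemma coneB_trans y x z : P (y - x) -> P (z - y) -> P (z - x).
Proof. by move=> h1 /(coneP.2 _ _ h1); rewrite addrC addrA subrK. Qed.

Lemma cone_total x y : P (y - x) \/ P (x - y).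
Proof. by have := coneP.1 (y - x); rewrite opprB. Qed.

Lemma coneBxx x : P (x - x).
Proof. by rewrite subrr; exact: cone0. Qed.

(** Minima are obtained by applying this to the opposite cone. [List.In] is used because [J] is an
    arbitrary type, without decidable equality. *)
Lemma cone_max (J : Type) (t : J -> E) (Q : J -> Prop) (s : seq J) :
  (forall j, List.In j s -> ~ Q j) \/
  exists j, [/\ List.In j s, Q j &
    forall k, List.In k s -> Q k -> P (t j - t k)].
Proof.
elim: s => [|a s [IH|[j [js Qj jm]]]]; first by left.
  have [Qa|nQa] := pselect (Q a).
    right; exists a; split => //; first by left.
    by move=> k [->|/IH]// _; exact: coneBxx.
  by left => j [<-|/IH].
right; have [[Qa aj]|naj] := pselect (Q a /\ P (t a - t j)).
  exists a; split => //; first by left.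
  move=> k [->|ks Qk]; first by move=> _; exact: coneBxx.
  by apply: coneB_trans aj; exact: jm.
exists j; split => //; first by right.
move=> k [<-|]; last exact: jm.
move=> Qa; case: (cone_total (t j) (t a)) => // aj.
by case: naj; split.
Qed.

End Cone.

Lemma total_cone_opp (E : lmodType rat) (P : E -> Prop) :
  total_cone P -> total_cone (fun x => P (- x)).
Proof.
move=> [h1 h2]; split=> [x|x y Px Py]; first by apply: h1.
by rewrite opprD; exact: h2.
Qed.

Section Extend.
Variables (E N : lmodType rat) (P : E -> Prop) (P' : N -> Prop).
Hypotheses (coneP : total_cone P) (coneP' : total_cone P').
Hypothesis nontrivial : exists u, P' u /\ ~ P' (- u).

(** The back-and-forth step: [N] is dense and has no endpoints, being divisible and nontrivial, so
    the position of [x] among the [t j] can be reproduced among the [t' j]. *)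
Lemma cone_fill (J : Type) (s : seq J) (t : J -> E) (t' : J -> N) (x : E) :
  (forall j k, List.In j s -> List.In k s ->
     P (t k - t j) <-> P' (t' k - t' j)) ->
  exists x', forall j, List.In j s ->
    (P (x - t j) <-> P' (x' - t' j)) /\ (P (t j - x) <-> P' (t' j - x')).
Proof.
move=> tt'; have [u [Pu nPu]] := nontrivial.
have strict (y z : N) : P' (z - y) -> ~ P' (y - z) ->
    forall w, P' (w - z) -> P' (w - y) /\ ~ P' (y - w).
  move=> yz zy w zw; split; first exact: (coneB_trans coneP' yz zw).
  by move=> wy; apply: zy; exact: (coneB_trans coneP' zw wy).
have [[j [js xj jx]]|neq] :=
    pselect (exists j, [/\ List.In j s, P (x - t j) & P (t j - x)]).
  exists (t' j) => k ks; rewrite -!tt'//; split; split=> h.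
  - exact: (coneB_trans coneP h jx).
  - exact: (coneB_trans coneP h xj).
  - exact: (coneB_trans coneP xj h).
  - exact: (coneB_trans coneP jx h).
have dich j : List.In j s ->
    (P (x - t j) /\ ~ P (t j - x)) \/ (~ P (x - t j) /\ P (t j - x)).
  move=> js; have [xj|xj] := pselect (P (x - t j)).
    by left; split=> // jx; case: neq; exists j.
  by right; split => //; case: (cone_total coneP x (t j)).
suff [x' x'P] : exists x', forall j, List.In j s ->
    (P (x - t j) -> P' (x' - t' j) /\ ~ P' (t' j - x')) /\
    (P (t j - x) -> P' (t' j - x') /\ ~ P' (x' - t' j)).
  exists x' => j js; have [h1 h2] := x'P _ js.
  case: (dich _ js) => [[a b]|[a b]].
    by have [c d] := h1 a; split; split.
  by have [c d] := h2 b; split; split.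
have step (y z : N) : y + (z - y) = z by rewrite addrC subrK.
have Pdu : ~ P' (- u) by [].
have uadd (y : N) : P' (y + u - y) /\ ~ P' (y - (y + u)).
  by rewrite addrC addKr opprD addrA subrr add0r.
have usub (y : N) : P' (y - (y - u)) /\ ~ P' (y - u - y).
  by rewrite opprB addrC subrK addrC addrA addNr add0r.
(* Four cases, according to whether some [t j] lies below [x] and some above: the witness is [0], a
   shift by [u] of the image of the nearest point, or the midpoint of the images of the two nearest
   points. *)
have [lo|[a [as' xa amax]]] :=
    cone_max coneP' t' (fun j => P (x - t j)) s;
have [hi|[b [bs xb bmin]]] :=
    cone_max (total_cone_opp coneP') t' (fun j => P (t j - x)) s.
- by exists 0 => j js; split=> [/lo|/hi].
- exists (t' b - u) => j js; split=> [/(lo _ js)//|xj].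
  have := bmin _ js xj; rewrite opprB => bj.
  by have [] := usub (t' b) => h1 h2; exact: (strict _ _ h1 h2 _ bj).
- exists (t' a + u) => j js; split=> [xj|/(hi _ js)//].
  have aj := amax _ js xj.
  by have [] := uadd (t' a) => h1 h2; split; [exact: (coneB_trans coneP' aj h1)|move=> h; apply: h2; exact: (coneB_trans coneP' h aj)].
pose mid := 2^-1 *: (t' a + t' b).
have ab : P' (t' b - t' a) /\ ~ P' (t' a - t' b).
  have [ba|nba] := pselect (P (t a - t b)).
    by case: neq; exists a; split => //; exact: (coneB_trans coneP xb ba).
  by rewrite -!tt'//; split=> //; exact: (coneB_trans coneP xa xb).
have half (y : N) : 2^-1 *: y + 2^-1 *: y = y.
  by rewrite -scalerDl -[RHS]scale1r; congr (_ *: _).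
have ma : mid - t' a = 2^-1 *: (t' b - t' a).
  by rewrite -[X in _ - X](half (t' a)) /mid scalerDr opprD addrACA subrr add0r -scalerBr.
have mb : t' b - mid = 2^-1 *: (t' b - t' a).
  rewrite -[X in X - _](half (t' b)) /mid scalerDr opprD [- _ - _]addrC addrACA.
  by rewrite subrr add0r -scalerBr.
have h0 : (0 : rat) < 2^-1 by [].
have am : P' (mid - t' a) /\ ~ P' (t' a - mid).
  rewrite -(opprB mid) ma -scalerN opprB.
  by split; [apply/(cone_scaleE coneP') => //; case: ab|
    move=> /(cone_scaleE coneP' _ h0); case: ab].
have bm : P' (t' b - mid) /\ ~ P' (mid - t' b).
  rewrite -(opprB (t' b)) mb -scalerN opprB.
  by split; [apply/(cone_scaleE coneP') => //; case: ab|
    move=> /(cone_scaleE coneP' _ h0); case: ab].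
exists mid => j js; split=> xj.
  have aj := amax _ js xj; case: am => h1 h2.
  by split; [exact: (coneB_trans coneP' aj h1)|move=> h; apply: h2; exact: (coneB_trans coneP' h aj)].
have := bmin _ js xj; rewrite opprB => bj.
by case: bm => h1 h2; exact: (strict _ _ h1 h2 _ bj).
Qed.

End Extend.

(* An element of [Z] may occur several times. *)
Definition lcomb (Z : Type) : Type := seq (rat * Z).

Definition lcomb_val (E : lmodType rat) (Z : Type) (f : Z -> E) (e : lcomb Z) : E :=
  \sum_(z <- e) z.1 *: f z.2.

Definition lcomb_scale (Z : Type) (r : rat) (e : lcomb Z) : lcomb Z :=
  [seq (r * z.1, z.2) | z <- e].

Definition lcomb_coef (Z : Type) (e : lcomb (option Z)) : rat :=
  \sum_(z <- e) if z.2 is None then z.1 else 0.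

Definition lcomb_rest (Z : Type) (e : lcomb (option Z)) : lcomb Z :=
  pmap (fun z => omap (pair z.1) z.2) e.

(** The root of the form in the eliminated variable. When the coefficient is zero its value is [0],
    and the sign of the form is read from [lcomb_rest] alone. *)
Definition lcomb_pivot (Z : Type) (e : lcomb (option Z)) : lcomb Z :=
  lcomb_scale (- (lcomb_coef e)^-1) (lcomb_rest e).

(** The signs of these forms give the signs of the forms in which the variable does not occur, and
    the order of the roots of the others. *)
Definition elim_var (Z : Type) (L : seq (lcomb (option Z))) : seq (lcomb Z) :=
  List.app (List.map (@lcomb_rest Z) L)
    (List.map (fun ee => lcomb_pivot ee.2 ++ lcomb_scale (- 1) (lcomb_pivot ee.1))
      (List.list_prod L L)).

Definition env_cons (E Z : Type) (x : E) (f : Z -> E) (o : option Z) : E :=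
  if o is Some i then f i else x.

Section FormVal.
Variables (E : lmodType rat) (Z : Type).
Implicit Types (f : Z -> E) (e : lcomb Z).

Lemma lcomb_val_cat f e1 e2 : lcomb_val f (e1 ++ e2) = lcomb_val f e1 + lcomb_val f e2.
Proof. by rewrite /lcomb_val big_cat. Qed.

Lemma lcomb_val_scale f r e : lcomb_val f (lcomb_scale r e) = r *: lcomb_val f e.
Proof.
rewrite /lcomb_val /lcomb_scale big_map scaler_sumr.
by apply: eq_bigr => z _; rewrite scalerA.
Qed.

Lemma lcomb_val_cons (x : E) f (e : lcomb (option Z)) :
  lcomb_val (env_cons x f) e = lcomb_coef e *: x + lcomb_val f (lcomb_rest e).
Proof.
rewrite /lcomb_val /lcomb_coef /lcomb_rest.
elim: e => [|[r [z|]] e IH]; rewrite /= ?big_nil ?big_cons /=.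
- by rewrite scale0r addr0.
- by rewrite add0r IH addrCA.
- by rewrite IH scalerDl addrA.
Qed.

End FormVal.

Definition agree (E N : lmodType rat) (P : E -> Prop) (P' : N -> Prop) (Z : Type)
    (L : seq (lcomb Z)) (f : Z -> E) (f' : Z -> N) : Prop :=
  forall e, List.In e L -> P (lcomb_val f e) <-> P' (lcomb_val f' e).

Lemma agree_app (E N : lmodType rat) (P : E -> Prop) (P' : N -> Prop) (Z : Type)
    (L1 L2 : seq (lcomb Z)) (f : Z -> E) (f' : Z -> N) :
  agree P P' (L1 ++ L2) f f' <-> agree P P' L1 f f' /\ agree P P' L2 f f'.
Proof.
split=> [h|[h1 h2] e /(@List.in_app_or _ _ _ _)[]]; [|exact: h1|exact: h2].
by split=> e eL; apply: h; apply: List.in_or_app; [left|right].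
Qed.

Section ExtendStep.
Variables (E N : lmodType rat) (P : E -> Prop) (P' : N -> Prop).
Hypotheses (coneP : total_cone P) (coneP' : total_cone P').
Hypothesis nontrivial : exists u, P' u /\ ~ P' (- u).

(* One elimination step in the style of Fourier and Motzkin. *)
Lemma agree_extend (Z : Type) (L : seq (lcomb (option Z))) (f : Z -> E) (f' : Z -> N)
    (x : E) : agree P P' (elim_var L) f f' ->
  exists x', agree P P' L (env_cons x f) (env_cons x' f').
Proof.
move=> ag.
have rest e : List.In e L ->
    P (lcomb_val f (lcomb_rest e)) <-> P' (lcomb_val f' (lcomb_rest e)).
  by move=> eL; apply: ag; apply: List.in_or_app; left; exact: List.in_map.
have [|x' x'P] := cone_fill coneP coneP' nontrivial (s := L)
   (t := fun e => lcomb_val f (lcomb_pivot e))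
   (t' := fun e => lcomb_val f' (lcomb_pivot e)) x.
  move=> j k jL kL.
  have /ag : List.In (lcomb_pivot k ++ lcomb_scale (- 1) (lcomb_pivot j)) (elim_var L).
    apply: List.in_or_app; right.
    apply: (List.in_map (fun ee => lcomb_pivot ee.2 ++ lcomb_scale (- 1) (lcomb_pivot ee.1))
      _ (j, k)).
    exact: List.in_prod.
  by rewrite !lcomb_val_cat !lcomb_val_scale !scaleN1r.
exists x' => e eL; rewrite !lcomb_val_cons.
have [c0|c0] := eqVneq (lcomb_coef e) 0.
  by rewrite c0 !scale0r !add0r; exact: rest.
have pivotE (E' : lmodType rat) (g : Z -> E') y :
    lcomb_coef e *: y + lcomb_val g (lcomb_rest e) =
    lcomb_coef e *: (y - lcomb_val g (lcomb_pivot e)).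
  by rewrite lcomb_val_scale scaleNr opprK scalerDr scalerA mulfV// scale1r.
rewrite !pivotE; have [h1 h2] := x'P _ eL.
have [cn|cp] : lcomb_coef e < 0 \/ 0 < lcomb_coef e.
  by case: ltgtP c0 => //; [left|right].
  have cN : 0 < - lcomb_coef e by rewrite oppr_gt0.
  by rewrite -[lcomb_coef e]opprK !(scaleNr (- _)) -!scalerN !opprB !cone_scaleE.
by rewrite !cone_scaleE.
Qed.

End ExtendStep.

Lemma rat_cone : total_cone (fun x : rat^o => 0 <= x).
Proof.
split=> [x|x y]; last exact: addr_ge0.
by rewrite oppr_ge0; exact/orP/le_total.
Qed.

Lemma rat_cone_nontrivial : exists u : rat^o, 0 <= u /\ ~ (0 <= - u).
Proof. by exists 1; split. Qed.

Lemma doag_cone (M : doagType) : total_cone (fun x : M => 0 <= x).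
Proof.
split=> [x|x y x0 y0].
  have /orP[|x0] := doag_total 0 x; first by left.
  by right; have := doag_lerD2r _ _ (- x) x0; rewrite add0r subrr.
by have := doag_lerD2r _ _ y x0; rewrite add0r; exact: le_trans.
Qed.

Lemma doag_subr_ge0 (M : doagType) (x y : M) : (0 <= y - x) = (x <= y).
Proof.
apply/idP/idP => h.
  by have := doag_lerD2r _ _ x h; rewrite add0r subrK.
by have := doag_lerD2r _ _ (- x) h; rewrite subrr.
Qed.

Lemma doag_cone_nontrivial (M : doagType) : exists u : M, 0 <= u /\ ~ (0 <= - u).
Proof.
have [x x0] := doag_nontrivial (s := M).
have key (y : M) : 0 <= y -> y != 0 -> exists u : M, 0 <= u /\ ~ (0 <= - u).
  move=> y0 yn0; exists y; split=> // ny; have : y <= 0.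
    by rewrite -doag_subr_ge0 sub0r.
  by move=> yle; move: yn0; rewrite eq_le y0 yle.
have [|] := (doag_cone M).1 x => h; first exact: (key x).
by apply: (key (- x)); rewrite ?oppr_eq0.
Qed.

(** * Linear arithmetic in a divisible ordered group *)

Inductive lexpr : Type :=
| LVar of nat
| LZero
| LAdd of lexpr & lexpr
| LOpp of lexpr
| LHalf of lexpr.

Fixpoint lval (E : lmodType rat) (f : nat -> E) (e : lexpr) : E :=
  match e with
  | LVar i => f i
  | LZero => 0
  | LAdd a b => lval f a + lval f b
  | LOpp a => - lval f a
  | LHalf a => 2^-1 *: lval f a
  end.

Fixpoint lvalQ (f : nat -> rat) (e : lexpr) : rat :=
  match e with
  | LVar i => f i
  | LZero => 0
  | LAdd a b => lvalQ f a + lvalQ f b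
  | LOpp a => - lvalQ f a
  | LHalf a => 2^-1 * lvalQ f a
  end.

Lemma lvalQE (f : nat -> rat) e : lvalQ f e = lval (f : nat -> rat^o) e.
Proof. by elim: e => //= [a -> b ->|a ->|a ->]. Qed.

Fixpoint lbound (e : lexpr) : nat :=
  match e with
  | LVar i => i.+1
  | LZero => 0
  | LAdd a b => maxn (lbound a) (lbound b)
  | LOpp a | LHalf a => lbound a
  end.

(* In the environment [lenv f0 f] on [option^n Z], the outermost [None] stands
   for the variable [n.-1]. *)
Fixpoint lvar (Z : Type) (n i : nat) : lcomb (iter n option Z) :=
  if n is m.+1 then
    if m == i then [:: (1, None)] else [seq (z.1, Some z.2) | z <- lvar Z m i]
  else [::].

Fixpoint lcst (Z : Type) (n : nat) (z : Z) : iter n option Z :=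
  if n is m.+1 then Some (lcst m z) else z.

Fixpoint lenv (E Z : Type) (f0 : Z -> E) (f : nat -> E) (n : nat) :
    iter n option Z -> E :=
  if n is m.+1 then env_cons (f m) (lenv f0 f (n := m)) else f0.

Lemma lcomb_val_lvar (E : lmodType rat) (Z : Type) (f0 : Z -> E) (f : nat -> E) n i :
  (i < n)%N -> lcomb_val (lenv f0 f (n := n)) (lvar Z n i) = f i.
Proof.
elim: n => //= n IH; rewrite ltnS leq_eqVlt => /orP[/eqP->|i_n].
  by rewrite eqxx /lcomb_val big_seq1 /= scale1r.
by rewrite gtn_eqF// -[RHS]IH// /lcomb_val big_map/=; apply: eq_bigr.
Qed.

Lemma lenv_lcst (E Z : Type) (f0 : Z -> E) (f : nat -> E) n z :
  lenv f0 f (lcst n z) = f0 z.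
Proof. by elim: n => //= n ->. Qed.

(** The constants must agree on every list of forms, because each step of the induction replaces [L]
    by [elim_var L]. *)
Lemma agree_extend_iter (E N : lmodType rat) (P : E -> Prop) (P' : N -> Prop)
    (coneP : total_cone P) (coneP' : total_cone P')
    (nontrivial : exists u, P' u /\ ~ P' (- u))
    (Z : Type) (f0 : Z -> E) (f0' : Z -> N) (f : nat -> E) (n : nat) :
  (forall L, agree P P' L f0 f0') ->
  forall L : seq (lcomb (iter n option Z)),
  exists y : nat -> N, agree P P' L (lenv f0 f (n := n)) (lenv f0' y (n := n)).
Proof.
move=> ag0; elim: n => [|k IH] L; first by exists (fun=> 0); exact: ag0.
have [y /(agree_extend coneP coneP' nontrivial (f k))[x' yx']] := IH (elim_var L).
exists (fun i => if i == k then x' else y i).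
rewrite [lenv (n := k.+1) f0' _](_ : _ = env_cons x' (lenv f0' y (n := k))) //.
apply/funext => -[z|] /=; last by rewrite eqxx.
have : forall j (z : iter j option Z), (j <= k)%N ->
    lenv f0' (fun i => if i == k then x' else y i) z = lenv f0' y z.
  elim=> // j IHj [z'|] jk /=; first by rewrite IHj// ltnW.
  by rewrite ltn_eqF.
exact.
Qed.

Fixpoint lexpr_lcomb (n : nat) (e : lexpr) : lcomb (iter n option void) :=
  match e with
  | LVar i => lvar void n i
  | LZero => [::]
  | LAdd a b => lexpr_lcomb n a ++ lexpr_lcomb n b
  | LOpp a => lcomb_scale (- 1) (lexpr_lcomb n a)
  | LHalf a => lcomb_scale 2^-1 (lexpr_lcomb n a)
  end.

Lemma lcomb_val_lexpr (E : lmodType rat) (f0 : void -> E) (f : nat -> E) n e :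
  (lbound e <= n)%N ->
  lcomb_val (lenv f0 f (n := n)) (lexpr_lcomb n e) = lval f e.
Proof.
elim: e => /= [i|_|a IHa b IHb|a IH h|a IH h].
- exact: lcomb_val_lvar.
- by rewrite /lcomb_val big_nil.
- by rewrite geq_max => /andP[ha hb]; rewrite lcomb_val_cat IHa// IHb.
- by rewrite lcomb_val_scale scaleN1r IH.
- by rewrite lcomb_val_scale IH.
Qed.

(** The variables are matched one by one, starting from the empty environment, where all forms
    vanish on both sides. *)
Lemma transfer_rat (M : doagType) (f : nat -> M) (L : seq lexpr) :
  exists y : nat -> rat, forall e, List.In e L -> (0 <= lval f e) = (0 <= lvalQ y e).
Proof.
pose n := foldr (fun e => maxn (lbound e)) 0%N L.
have bL e : List.In e L -> (lbound e <= n)%N.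
  rewrite /n; elim: L {n} => //= a L IH [->|/IH h]; first exact: leq_maxl.
  by rewrite leq_max h orbT.
have [|y yP] := agree_extend_iter (doag_cone M) rat_cone rat_cone_nontrivial
    (f0 := of_void M) (f0' := of_void rat^o) f _ [seq lexpr_lcomb n e | e <- L].
  move=> L' e _; have -> : e = [::] by case: e => // -[? []].
  by rewrite /lcomb_val !big_nil !lexx.
exists y => e eL; rewrite lvalQE -(lcomb_val_lexpr (of_void M) f (bL _ eL)).
rewrite -(lcomb_val_lexpr (of_void rat^o) (y : nat -> rat^o) (bL _ eL)).
have h : List.In (lexpr_lcomb n e) [seq lexpr_lcomb n e | e <- L].
  exact: (List.in_map _ _ _ eL).
by apply/idP/idP => /(yP _ h).
Qed.

Lemma doag_leP (M : doagType) (x y : M) : x <= y <-> 0 <= y - x.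
Proof. by rewrite doag_subr_ge0. Qed.

Lemma doag_ltP (M : doagType) (x y : M) : x < y <-> ~ (0 <= x - y).
Proof. by rewrite doag_subr_ge0 ltNge; split => /negP. Qed.

(* [(strict, a, b)] stands for [a < b] or [a <= b]. *)
Fixpoint lrefutes (M : doagType) (f : nat -> M) (L : seq (bool * lexpr * lexpr)) : Prop :=
  if L is (k, a, b) :: L' then
    (if k then lval f a < lval f b else lval f a <= lval f b) -> lrefutes f L'
  else False.

Fixpoint lvalR (f : nat -> R) (e : lexpr) : R :=
  match e with
  | LVar i => f i
  | LZero => 0%coqR
  | LAdd a b => (lvalR f a + lvalR f b)%coqR
  | LOpp a => (- lvalR f a)%coqR
  | LHalf a => (/ 2 * lvalR f a)%coqR
  end.

Fixpoint lrefutesR (f : nat -> R) (L : seq (bool * lexpr * lexpr)) : Prop :=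
  if L is (k, a, b) :: L' then
    (if k then lvalR f a < lvalR f b else lvalR f a <= lvalR f b)%coqR -> lrefutesR f L'
  else False.

Lemma lvalR_rat (y : nat -> rat) e : lvalR (ratr \o y) e = ratr (lvalQ y e).
Proof.
elim: e => //= [|a -> b ->|a ->|a ->].
- by rewrite rmorph0.
- by rewrite rmorphD.
- by rewrite rmorphN.
- by rewrite rmorphM fmorphV rmorph_nat; congr (_ * _).
Qed.

(** The refutation is applied to the rational environment of [transfer_rat], viewed in [R] because
    the tactic [lra] works there. *)
Lemma lrefutes_real (M : doagType) (f : nat -> M) (L : seq (bool * lexpr * lexpr)) :
  (forall y, lrefutesR y L) -> lrefutes f L.
Proof.
have [y yP] := transfer_rat f (List.app
  [seq LAdd h.2 (LOpp h.1.2) | h <- L] [seq LAdd h.1.2 (LOpp h.2) | h <- L]).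
move=> /(_ (ratr \o y)).
have : forall h, List.In h L ->
    (0 <= lval f h.2 - lval f h.1.2) = (0 <= lvalQ y h.2 - lvalQ y h.1.2) /\
    (0 <= lval f h.1.2 - lval f h.2) = (0 <= lvalQ y h.1.2 - lvalQ y h.2).
  move=> h hL; split.
    apply: (yP (LAdd h.2 (LOpp h.1.2))); apply: List.in_or_app; left.
    exact: (List.in_map (fun h => LAdd h.2 (LOpp h.1.2)) _ _ hL).
  apply: (yP (LAdd h.1.2 (LOpp h.2))); apply: List.in_or_app; right.
  exact: (List.in_map (fun h => LAdd h.1.2 (LOpp h.2)) _ _ hL).
elim: L {yP} => //= -[[k a] b] L IH hL H Hk; apply: IH.
  by move=> h hIn; apply: hL; right.
apply: H; move: (hL _ (or_introl erefl)) => /= [h1 h2]; rewrite !lvalR_rat.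
case: k Hk {hL} => /=; rewrite !subr_ge0 in h1 h2.
  by move=> /doag_ltP Hk; apply/RltP; rewrite ltr_rat ltNge -h2; apply/negP.
by move=> /doag_leP Hk; apply/RleP; rewrite ler_rat -h1.
Qed.

(** The nested [match] runs the tactic [unify] while the function as a whole still returns a term,
    so that atoms are compared up to unification. *)
Ltac ola_mem x vs :=
  lazymatch vs with
  | nil => false
  | ?y :: ?vs' =>
    match constr:(O) with
    | _ => let _ := match constr:(O) with _ => unify x y end in true
    | _ => ola_mem x vs'
    end
  end.

Ltac ola_idx x vs :=
  lazymatch vs with
  | ?y :: ?vs' =>
    match constr:(O) with
    | _ => let _ := match constr:(O) with _ => unify x y end in constr:(O)
    | _ => let i := ola_idx x vs' in constr:(S i)
    end
  end.

Ltac ola_atoms t vs :=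
  lazymatch t with
  | @Algebra.add _ ?a ?b => let vs1 := ola_atoms a vs in ola_atoms b vs1
  | @Algebra.opp _ ?a => ola_atoms a vs
  | @Algebra.zero _ => vs
  | @GRing.scale _ _ (@GRing.inv _ (@Algebra.natmul _ (GRing.one _) (S (S O)))) ?a =>
    ola_atoms a vs
  | _ => lazymatch ola_mem t vs with true => vs | false => constr:(t :: vs) end
  end.

Ltac ola_reify t vs :=
  lazymatch t with
  | @Algebra.add _ ?a ?b =>
    let ea := ola_reify a vs in let eb := ola_reify b vs in constr:(LAdd ea eb)
  | @Algebra.opp _ ?a => let ea := ola_reify a vs in constr:(LOpp ea)
  | @Algebra.zero _ => constr:(LZero)
  | @GRing.scale _ _ (@GRing.inv _ (@Algebra.natmul _ (GRing.one _) (S (S O)))) ?a =>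
    let ea := ola_reify a vs in constr:(LHalf ea)
  | _ => let i := ola_idx t vs in constr:(LVar i)
  end.

Ltac ola_goal_atoms g vs :=
  lazymatch g with
  | is_true (Order.le ?a ?b) -> ?g' =>
    let vs1 := ola_atoms a vs in let vs2 := ola_atoms b vs1 in ola_goal_atoms g' vs2
  | is_true (Order.lt ?a ?b) -> ?g' =>
    let vs1 := ola_atoms a vs in let vs2 := ola_atoms b vs1 in ola_goal_atoms g' vs2
  | _ => vs
  end.

Ltac ola_goal_reify g vs :=
  lazymatch g with
  | is_true (Order.le ?a ?b) -> ?g' =>
    let ea := ola_reify a vs in let eb := ola_reify b vs in
    let L := ola_goal_reify g' vs in constr:((false, ea, eb) :: L)
  | is_true (Order.lt ?a ?b) -> ?g' =>
    let ea := ola_reify a vs in let eb := ola_reify b vs in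
    let L := ola_goal_reify g' vs in constr:((true, ea, eb) :: L)
  | _ => constr:(@nil (bool * lexpr * lexpr))
  end.

(** If the type of [x] is not displayed as the sort of a structure, its head normal form is an
    unfolded projection, from which the structure is read off. *)
Ltac ola_model x :=
  let T := type of x in
  lazymatch T with
  | DOAG.sort ?M => M
  | _ => let T' := eval hnf in T in lazymatch T' with let (s, _) := ?M in s => M end
  end.

Ltac ola_type M x := let N := ola_model x in constr_eq M N.

Lemma doag_eq_le (M : doagType) (x y : M) : x = y -> x <= y /\ y <= x.
Proof. by move=> ->. Qed.

Lemma doag_nle (M : doagType) (x y : M) : ~ (x <= y) -> y < x.
Proof. by move=> /negP; rewrite -ltNge. Qed.

Lemma doag_nlt (M : doagType) (x y : M) : ~ (x < y) -> y <= x.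
Proof. by move=> /negP; rewrite -leNgt. Qed.

Lemma doag_nleb (M : doagType) (x y : M) : ~~ (x <= y) -> y < x.
Proof. by rewrite -ltNge. Qed.

Lemma doag_nltb (M : doagType) (x y : M) : ~~ (x < y) -> y <= x.
Proof. by rewrite -leNgt. Qed.

Lemma doag_le_anti (M : doagType) (x y : M) : x <= y -> y <= x -> x = y.
Proof. by move=> h1 h2; apply/le_anti; rewrite h1. Qed.

Lemma doag_le_contra (M : doagType) (x y : M) : (y < x -> False) -> x <= y.
Proof. by move=> h; apply: doag_nlt => /h. Qed.

Lemma doag_lt_contra (M : doagType) (x y : M) : (y <= x -> False) -> x < y.
Proof. by move=> h; apply: doag_nle => /h. Qed.

Ltac ola_core M :=
  repeat match goal with
  | H : ?a = ?b |- _ => ola_type M a; apply (@doag_eq_le M) in H;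
      let H1 := fresh "H" in let H2 := fresh "H" in destruct H as [H1 H2]
  | H : ~ is_true (Order.le ?a ?b) |- _ => ola_type M a; apply (@doag_nle M) in H
  | H : ~ is_true (Order.lt ?a ?b) |- _ => ola_type M a; apply (@doag_nlt M) in H
  | H : is_true (~~ (Order.le ?a ?b)) |- _ => ola_type M a; apply (@doag_nleb M) in H
  | H : is_true (~~ (Order.lt ?a ?b)) |- _ => ola_type M a; apply (@doag_nltb M) in H
  end;
  repeat match goal with
  | H : is_true (Order.le ?a ?b) |- _ => ola_type M a; revert H
  | H : is_true (Order.lt ?a ?b) |- _ => ola_type M a; revert H
  end;
  lazymatch goal with
  | |- ?g =>
    let vs := ola_goal_atoms g (@nil (DOAG.sort M)) in
    let L := ola_goal_reify g vs in
    refine (@lrefutes_real M (nth 0 vs) L _);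
    let y := fresh "y" in
    intro y; cbn [lrefutesR lvalR]; clear -y; intros; Lra.lra
  end.

(* [ola] decides linear arithmetic over a divisible ordered group: it refutes the
   hypotheses and the negated goal over the reals, which is enough by
   [transfer_rat].  Only the scalar [2^-1] is interpreted. *)
Ltac ola :=
  intros;
  match goal with
  | |- is_true (@Order.le _ _ ?a ?b) =>
    let M := ola_model a in apply (@doag_le_contra M); intro; ola_core M
  | |- is_true (@Order.lt _ _ ?a ?b) =>
    let M := ola_model a in apply (@doag_lt_contra M); intro; ola_core M
  | |- ?a = ?b =>
    let M := ola_model a in apply (@doag_le_anti M);
    apply (@doag_le_contra M); intro; ola_core M
  | H : is_true (@Order.le _ _ ?a ?b) |- False =>
    let M := ola_model a in ola_core M
  | H : is_true (@Order.lt _ _ ?a ?b) |- False =>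
    let M := ola_model a in ola_core M
  end.

(** * Quantifier elimination *)

Definition sum_env (M C V : Type) (v : V -> M) (g : C -> M) (z : V + C) : M :=
  match z with inl i => v i | inr a => g a end.

Fixpoint term_lcomb (C V : Type) (t : term C V) : lcomb (V + C) :=
  match t with
  | TVar i => [:: (1, inl i)]
  | TCst a => [:: (1, inr a)]
  | TZero => [::]
  | TAdd a b => term_lcomb a ++ term_lcomb b
  | TOpp a => lcomb_scale (- 1) (term_lcomb a)
  end.

Lemma term_lcomb_val (M : doagType) (C V : Type) (v : V -> M) (g : C -> M)
    (t : term C V) :
  lcomb_val (sum_env v g) (term_lcomb t) = term_val v (term_map g id t).
Proof.
elim: t => /= [i|a||a IHa b IHb|a IH].
- by rewrite /lcomb_val big_seq1 scale1r.
- by rewrite /lcomb_val big_seq1 scale1r.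
- by rewrite /lcomb_val big_nil.
- by rewrite lcomb_val_cat IHa IHb.
- by rewrite lcomb_val_scale scaleN1r IH.
Qed.

(** Brings the bound variable outermost, where [elim_var] can eliminate it. *)
Definition option_assoc (V C : Type) (z : option V + C) : option (V + C) :=
  match z with
  | inl (Some i) => Some (inl i)
  | inl None => None
  | inr a => Some (inr a)
  end.

Definition lcomb_map (Z Z' : Type) (h : Z -> Z') (e : lcomb Z) : lcomb Z' :=
  [seq (z.1, h z.2) | z <- e].

Lemma lcomb_val_map (E : lmodType rat) (Z Z' : Type) (h : Z -> Z') (f : Z' -> E)
    (e : lcomb Z) : lcomb_val f (lcomb_map h e) = lcomb_val (f \o h) e.
Proof. by rewrite /lcomb_val big_map. Qed.

Local Notation nonneg M := (fun x : DOAG.sort M => 0 <= x).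

(* Quantifier elimination in semantic form: the truth value only depends on the
   signs of finitely many linear forms in the variables and the constants. *)
Lemma qe_agree (M : doagType) (C V : Type) (phi : formula C V) :
  exists L : seq (lcomb (V + C)), forall (v v' : V -> M) (g g' : C -> M),
    agree (nonneg M) (nonneg M) L (sum_env v g) (sum_env v' g') ->
    holds v (formula_map g id phi) <-> holds v' (formula_map g' id phi).
Proof.
elim: phi => {V} [V t1 t2|V t1 t2|V phi [L LP]|V phi [L LP] psi [L' LP']|V phi [L LP]].
- exists [:: term_lcomb (TAdd t1 (TOpp t2)); term_lcomb (TAdd t2 (TOpp t1))].
  move=> v v' g g' ag /=.
  have := ag _ (or_introl erefl); have := ag _ (or_intror (or_introl erefl)).
  rewrite !term_lcomb_val /= => h1 h2; split=> h.
    have := h1.1; have := h2.1; rewrite h subrr lexx => h3 h4.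
    by have := h3 isT; have := h4 isT; ola.
  have := h1.2; have := h2.2; rewrite h subrr lexx => h3 h4.
  by have := h3 isT; have := h4 isT; ola.
- exists [:: term_lcomb (TAdd t1 (TOpp t2))] => v v' g g' ag /=.
  have := ag _ (or_introl erefl).
  rewrite !term_lcomb_val /= => h; split=> h1; apply: doag_nle => h2.
    have : 0 <= term_val v (term_map g id t1) - term_val v (term_map g id t2).
      by apply: h.2; ola.
    by ola.
  have : 0 <= term_val v' (term_map g' id t1) - term_val v' (term_map g' id t2).
    by apply: h.1; ola.
  by ola.
- by exists L => v v' g g' /LP /= ->.
- exists (L ++ L') => v v' g g' /agree_app[/LP h1 /LP' h2] /=.
  by rewrite h1 h2.
- exists (elim_var (List.map (lcomb_map (@option_assoc V C)) L)) => v v' g g' ag /=.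
  have idE : omap id = id :> (option V -> option V) by apply/funext => -[].
  have key (w w' : V -> M) (k k' : C -> M) x :
      agree (nonneg M) (nonneg M)
        (elim_var (List.map (lcomb_map (@option_assoc V C)) L))
        (sum_env w k) (sum_env w' k') ->
      holds (env_cons x w) (formula_map k (omap id) phi) ->
      exists x', holds (env_cons x' w') (formula_map k' (omap id) phi).
    move=> /(agree_extend (doag_cone M) (doag_cone M) (doag_cone_nontrivial M) x).
    rewrite idE => -[x' ag'] h; exists x'; move: h.
    apply: (LP (env_cons x w) (env_cons x' w') k k' _).1 => e eL.
    have envE y u i : sum_env (@env_cons M V y u) i =1
        env_cons y (sum_env u i) \o (@option_assoc V C) by move=> [[]|].
    have := ag' (lcomb_map (@option_assoc V C) e) (List.in_map _ _ _ eL).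
    rewrite !lcomb_val_map !(funext (envE _ _ _)).
    by move=> ->.
  split=> -[x]; first exact: key.
  by apply: key => e eL; symmetry; exact: ag.
Qed.

Lemma formula_map_ext (C D V W : Type) (g g' : C -> D) (f : V -> W) (phi : formula C V) :
  (forall a, params phi a -> g a = g' a) -> formula_map g f phi = formula_map g' f phi.
Proof.
have termE (U U' : Type) (h : U -> U') (t : term C U) :
    (forall a, term_params t a -> g a = g' a) -> term_map g h t = term_map g' h t.
  elim: t => //= [a ha|a IHa b IHb ha|a IH ha]; first by rewrite ha.
  - by rewrite IHa ?IHb// => x xa; apply: ha; [right|left].
  - by rewrite IH.
elim: phi W f => {V} [V t1 t2|V t1 t2|V phi IH|V phi IH psi IH'|V phi IH] W f /= h.
- by rewrite !termE// => a ha; apply: h; [right|left].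
- by rewrite !termE// => a ha; apply: h; [right|left].
- by rewrite IH.
- by rewrite IH ?IH'// => a ha; apply: h; [right|left].
- by rewrite IH.
Qed.

Lemma formula_map_id (C V : Type) (phi : formula C V) : formula_map id id phi = phi.
Proof.
have termE (U : Type) (t : term C U) : term_map id id t = t.
  by elim: t => //= [a -> b ->|a ->].
elim: phi => {V} [V t1 t2|V t1 t2|V phi IH|V phi IH psi IH'|V phi IH] /=.
- by rewrite !termE.
- by rewrite !termE.
- by rewrite IH.
- by rewrite IH IH'.
- by rewrite (_ : omap id = id) ?IH//; apply/funext => -[].
Qed.

(** * Linear forms with constants in a subspace *)

Section Lin.
Context {M : doagType}.

Definition lin (V : finType) (l : V -> rat) (v : V -> M) : M := \sum_i l i *: v i.

Lemma linD (V : finType) (l l' : V -> rat) v : lin (l + l') v = lin l v + lin l' v.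
Proof. by rewrite /lin -big_split; apply: eq_bigr => i _; rewrite /= -scalerDl. Qed.

Lemma linN (V : finType) (l : V -> rat) v : lin (- l) v = - lin l v.
Proof. by rewrite /lin -sumrN; apply: eq_bigr => i _; rewrite /= -scaleNr. Qed.

Lemma lin0 (V : finType) (v : V -> M) : lin 0 v = 0.
Proof. by rewrite /lin big1// => i _; rewrite scale0r. Qed.

(** The adjoint of [v |-> v \o f]; for the inclusion of a subset it is extension by zero. *)
Definition lpush (V W : finType) (f : W -> V) (l : W -> rat) (i : V) : rat :=
  \sum_(j | f j == i) l j.

Lemma lin_push (V W : finType) (f : W -> V) (l : W -> rat) (v : V -> M) :
  lin (lpush f l) v = lin l (v \o f).
Proof.
rewrite /lin /lpush (partition_big f xpredT)//=; apply: eq_bigr => i _.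
by rewrite scaler_suml; apply: eq_bigr => j /eqP ->.
Qed.

End Lin.

Section Subspace.
Context {M : doagType} (D : set M).
Hypothesis hD : rat_subspace D.

Lemma subsp0 : D 0. Proof. by case: hD. Qed.

Lemma subspZ r x : D x -> D (r *: x).
Proof. by move=> Dx; rewrite -[_ *: _]addr0; apply: hD.2 => //; exact: subsp0. Qed.

Lemma subspD x y : D x -> D y -> D (x + y).
Proof. by move=> Dx Dy; rewrite -[x]scale1r; apply: hD.2. Qed.

Lemma subspN x : D x -> D (- x).
Proof. by rewrite -scaleN1r; exact: subspZ. Qed.

Lemma subspB x y : D x -> D y -> D (x - y).
Proof. by move=> Dx Dy; apply/subspD/subspN. Qed.

Lemma subsp_lin (V : finType) (l : V -> rat) v : (forall i, D (v i)) -> D (lin l v).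
Proof.
by move=> Dv; rewrite /lin; apply: big_ind => [|x y|i _];
  [exact: subsp0|exact: subspD|exact: subspZ].
Qed.

Lemma formula_affine (V : finType) (phi : formula M V) : params phi `<=` D ->
  exists L : seq ((V -> rat) * M), (forall e, List.In e L -> D e.2) /\
    forall v v' : V -> M,
      (forall e, List.In e L -> 0 <= lin e.1 v + e.2 <-> 0 <= lin e.1 v' + e.2) ->
      holds v phi <-> holds v' phi.
Proof.
(* The forms given by [qe_agree] may mention constants outside [D]. Sending these to [0] does not
   affect [phi] and keeps all constant terms in [D]. *)
move=> phiD; pose g x : M := if `[< D x >] then x else 0.
have gD x : D (g x) by rewrite /g; case: asboolP => // _; exact: subsp0.
have phiE : formula_map g id phi = phi.
  rewrite -[RHS]formula_map_id; apply: formula_map_ext => a /phiD Da.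
  by rewrite /g; case: asboolP.
have [L LP] := qe_agree M phi.
pose aff (e : lcomb (V + M)) : (V -> rat) * M :=
  (fun i => \sum_(z <- e) (if z.2 is inl j then (if j == i then z.1 else 0) else 0),
   \sum_(z <- e) if z.2 is inr a then z.1 *: g a else 0).
have affE v e : lcomb_val (sum_env v g) e = lin (aff e).1 v + (aff e).2.
  rewrite /lcomb_val /aff /lin /=; elim: e => [|[r [j|a]] e IH] /=.
  - by rewrite !big_nil addr0 big1// => i _; rewrite big_nil scale0r.
  - rewrite !big_cons/= IH add0r addrA; congr (_ + _).
    under [RHS]eq_bigr do rewrite big_cons/= scalerDl.
    rewrite big_split/=; congr (_ + _).
    rewrite (bigD1 j)//= eqxx big1 ?addr0// => i /negPf.
    by rewrite eq_sym => ->; rewrite scale0r.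
  - rewrite !big_cons/= IH addrCA; congr (_ + _).
    by under [RHS]eq_bigr do rewrite big_cons/= add0r.
exists [seq aff e | e <- L]; split.
  move=> e /List.in_map_iff[e' [<- _]] /=.
  apply: big_ind => [|x y|z _]; [exact: subsp0|exact: subspD|].
  by case: z.2 => a; [exact: subsp0|exact: subspZ].
move=> v v' ag; rewrite -phiE; apply: LP => e eL; rewrite !affE.
by apply: ag; exact: (List.in_map aff).
Qed.

End Subspace.

(** * Types as cones of affine forms *)

Fixpoint term_muln (C V : Type) (n : nat) (t : term C V) : term C V :=
  if n is m.+1 then TAdd t (term_muln m t) else TZero.

Lemma term_val_muln (M : doagType) (V : Type) (v : V -> M) n (t : term M V) :
  term_val v (term_muln n t) = term_val v t *+ n.
Proof. by elim: n => //= n ->; rewrite mulrS. Qed.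

Lemma term_params_muln (C V : Type) n (t : term C V) :
  term_params (term_muln n t) `<=` term_params t.
Proof. by elim: n => [|n IH] x //= -[//|/IH]. Qed.

(** The language has no rational scalars, so denominators are cleared; the witness [N] is their
    product. *)
Lemma lin_term (M : doagType) (V : finType) (l : V -> rat) :
  exists (N : nat) (t : term M V), [/\ (0 < N)%N, term_params t `<=` set0 &
    forall v : V -> M, term_val v t = N%:R *: lin l v].
Proof.
suff h (s : seq V) : exists (N : nat) (t : term M V),
    [/\ (0 < N)%N, term_params t `<=` set0 &
    forall v : V -> M, term_val v t = N%:R *: \sum_(i <- s) l i *: v i].
  by have [N [t [N0 tp tv]]] := h (index_enum V); exists N, t.
elim: s => [|a s [N [t [N0 tp tv]]]].
  by exists 1%N, TZero; split => // v; rewrite /= big_nil scaler0.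
pose d := denq (l a); pose k := numq (l a).
pose ta : term M V := if (0 <= k)%R then TVar M a else TOpp (TVar M a).
exists (`|d| * N)%N, (TAdd (term_muln (`|k| * N) ta) (term_muln `|d| t)); split.
- by rewrite muln_gt0 N0 absz_gt0 denq_neq0.
- move=> x /= [h|h]; last by case: (tp _ (term_params_muln h)).
  by have := term_params_muln h; rewrite /ta; case: ifP.
- move=> v /=; rewrite !term_val_muln tv big_cons scalerDr -scaler_nat scalerA.
  rewrite -[_ *+ `|d|]scaler_nat scalerA -natrM; congr (_ + _).
  have -> : term_val v ta = (if (0 <= k)%R then 1 else -1 : rat) *: v a.
    by rewrite /ta; case: ifP => _ /=; rewrite ?scale1r ?scaleN1r.
  rewrite scalerA; congr (_ *: _).
  rewrite !natrM mulrAC [RHS]mulrAC; congr (_ * _).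
  have -> : l a = k%:~R / d%:~R by rewrite divq_num_den.
  have dE : (`|d|%N)%:R = d%:~R :> rat.
    by rewrite -[LHS]/(`|d|%:Z%:~R) gtz0_abs ?denq_gt0.
  rewrite dE mulrCA mulfV ?intr_eq0 ?denq_neq0// mulr1.
  rewrite -[(`|k|%N)%:R]/(`|k|%:Z%:~R); case: (ger0P k) => k0.
    by rewrite gez0_abs// mulr1.
  by rewrite ltz0_abs// mulrN1 intrN opprK.
Qed.

Lemma affine_formula_ex (M : doagType) (V : finType) (l : V -> rat) (m : M) :
  exists phi : formula M V, (exists r : rat, params phi `<=` [set r *: m]) /\
    forall v : V -> M, holds v phi <-> 0 <= lin l v + m.
Proof.
have [N [t [N0 tp tv]]] := lin_term M l.
exists (FNot (FLt (TAdd t (TCst V (N%:R *: m))) TZero)); split.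
  by exists N%:R => x /= [[h|//]|//]; case: (tp _ h).
move=> v /=; rewrite tv -scalerDr.
have Np : 0 < N%:R :> rat by rewrite ltr0n.
have := cone_scaleE (doag_cone M) (lin l v + m) Np => /= <-.
by split=> [/doag_nlt|h1 h2] //; ola.
Qed.

Definition affine_formula (M : doagType) (V : finType) (l : V -> rat) (m : M) :
  formula M V := sval (cid (affine_formula_ex l m)).

Lemma holds_affine (M : doagType) (V : finType) (l : V -> rat) (m : M) (v : V -> M) :
  holds v (affine_formula l m) <-> 0 <= lin l v + m.
Proof. by rewrite /affine_formula; case: cid => phi [/= _ ->]. Qed.

Lemma params_affine (M : doagType) (D : set M) (V : finType) (l : V -> rat) (m : M) :
  rat_subspace D -> D m -> params (affine_formula l m) `<=` D.
Proof.
rewrite /affine_formula => hD Dm; case: cid => phi [/= [r h] _] x /h ->.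
exact: subspZ.
Qed.

Definition pos (M : doagType) (V : finType) (p : set (formula M V))
  (l : V -> rat) (m : M) : Prop := p (affine_formula l m).

(* [P l m] stands for [0 <= lin l x + m]. *)
Definition affine_cone (M : doagType) (D : set M) (V : finType)
    (P : (V -> rat) -> M -> Prop) : Prop :=
  [/\ forall l m, D m -> P l m \/ P (- l) (- m),
      forall l m l' m', D m -> D m' -> P l m -> P l' m' -> P (l + l') (m + m')
    & forall m, D m -> P 0 m <-> 0 <= m].

Lemma finite_set_In (T : Type) (s : seq T) : finite_set [set x | List.In x s].
Proof.
elim: s => [|a s IH]; first by rewrite (_ : [set _ | _] = set0)//; exact/seteqP.
rewrite (_ : [set _ | _] = [set a] `|` [set x | List.In x s]).
  by rewrite finite_setU; split=> //; exact: finite_set1.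
by apply/seteqP; split=> x /= [->|]; [left|right|left|right].
Qed.

Lemma finite_set_list (T : Type) (A : set T) :
  finite_set A -> exists s : seq T, forall x, A x -> List.In x s.
Proof.
move=> /(@finite_seqP {classic T})[s As]; exists s => x; rewrite As /=.
elim: s {As} => //= a s IH; rewrite in_cons => /orP[/eqP->|/IH]; [by left|by right].
Qed.

Lemma tp_complete (M : doagType) (D : set M) (V : Type) (v : V -> M) :
  complete_type D (tp D v).
Proof.
split=> [phi []//|s _ sp|phi phiD]; first by exists v => phi /sp[].
by have [h|h] := pselect (holds v phi); [left|right].
Qed.

Section TypeCone.
Context {M : doagType}.

(** Each formula of [s] or its negation lies in [p], and a tuple of [M] satisfies these finitely
    many choices. Statements about [p] involving finitely many formulas can thus be checked in
    [M]. *)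
Lemma type_approx (D : set M) (V : Type) (p : set (formula M V)) (s : seq (formula M V)) :
  complete_type D p -> (forall phi, List.In phi s -> params phi `<=` D) ->
  exists v : V -> M, forall phi, List.In phi s -> p phi <-> holds v phi.
Proof.
move=> [_ sat compl] sD.
pose sg phi := if `[< p phi >] then phi else FNot phi.
have [||v vP] := sat (sg @` [set phi | List.In phi s]).
- exact/finite_image/finite_set_In.
- move=> _ [phi /= phis <-]; rewrite /sg; case: asboolP => // npphi.
  by have [|//|] := compl phi; first exact: sD.
exists v => phi phis; have := vP _ (imageP sg phis).
by rewrite /sg; case: asboolP.
Qed.

(** Both types are approximated by tuples of [M], to which [formula_affine] applies. The parameter
    sets may differ, so that a type over [B] can be compared with a global one. *)
Lemma type_affine (D : set M) (V : finType) (phi : formula M V) :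
  rat_subspace D -> params phi `<=` D ->
  exists L : seq ((V -> rat) * M), (forall e, List.In e L -> D e.2) /\
    forall D1 D2 (p q : set (formula M V)), D `<=` D1 -> D `<=` D2 ->
      complete_type D1 p -> complete_type D2 q ->
      (forall e, List.In e L -> pos p e.1 e.2 <-> pos q e.1 e.2) -> p phi <-> q phi.
Proof.
move=> hD phiD; have [L [LD LP]] := formula_affine hD phiD.
exists L; split=> // D1 D2 p q DD1 DD2 pc qc pq.
pose s := phi :: [seq affine_formula e.1 e.2 | e <- L].
have sD psi : List.In psi s -> params psi `<=` D.
  by move=> [<-//|/List.in_map_iff[e [<- eL]]]; apply: params_affine => //; exact: LD.
have [v vP] := type_approx pc (fun phi h => subset_trans (sD phi h) DD1).
have [w wP] := type_approx qc (fun phi h => subset_trans (sD phi h) DD2).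
rewrite vP ?wP; [|by left|by left]; apply: LP => e eL.
have es : List.In (affine_formula e.1 e.2) s.
  by right; exact: (List.in_map (fun e => affine_formula e.1 e.2)).
by rewrite -!holds_affine -(vP _ es) -(wP _ es); exact: pq.
Qed.

Lemma pos_tp (D : set M) (V : finType) (v : V -> M) l m : rat_subspace D -> D m ->
  pos (tp D v) l m <-> 0 <= lin l v + m.
Proof.
move=> hD Dm; rewrite /pos /tp /= holds_affine; split=> [[]//|h].
by split=> //; exact: params_affine.
Qed.

Lemma type_ext (D : set M) (V : finType) (p q : typespace D V) : rat_subspace D ->
  (forall l m, D m -> pos (sval p) l m <-> pos (sval q) l m) -> p = q.
Proof.
move=> hD pq; apply: eq_sig_hprop => [x|]; first exact: Prop_irrelevance.
apply/seteqP.
have key (p' q' : typespace D V) :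
    (forall l m, D m -> pos (sval p') l m <-> pos (sval q') l m) ->
    sval p' `<=` sval q'.
  move=> pq' phi pphi; have [phiD _ _] := svalP p'.
  have [L [LD LP]] := type_affine hD (phiD _ pphi).
  apply/(LP D D (sval p') (sval q')) => //; [exact: svalP|exact: svalP|].
  by move=> e /LD; exact: pq'.
by split; apply: key => l m Dm; rewrite pq.
Qed.

Lemma tp_sub (B D : set M) (V : finType) (v : V -> M) (p : typespace D V) :
  rat_subspace B -> B `<=` D ->
  tp B v `<=` sval p <-> forall l b, B b -> pos (sval p) l b <-> 0 <= lin l v + b.
Proof.
move=> hB BD; split=> [h l b Bb|h phi [phiB vphi]].
  have [_ sat _] := svalP p; rewrite -(pos_tp v l hB Bb); split; last exact: h.
  move=> plb; rewrite pos_tp//; apply: doag_nlt => lt0.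
  have : tp B v (FNot (affine_formula l b)).
    by split=> /=; [exact: params_affine|rewrite holds_affine; move=> ?; ola].
  move=> /h pn.
  have [||w wP] := sat [set affine_formula l b; FNot (affine_formula l b)].
  - by rewrite finite_setU; split; exact: finite_set1.
  - by move=> phi /= [->|->].
  by apply: (wP _ (or_intror erefl)); exact: (wP _ (or_introl erefl)).
have [L [LB LP]] := type_affine hB phiB.
apply/(LP D B _ (tp B v)) => //; [exact: svalP|exact: tp_complete|].
by move=> e /LB Be; rewrite pos_tp//; exact: h.
Qed.

Lemma affine_cone_pos (D : set M) (V : finType) (p : typespace D V) :
  rat_subspace D -> affine_cone D (pos (sval p)).
Proof.
move=> hD; split.
- move=> l m Dm.
  have [|v vP] := type_approx (svalP p)
      (s := [:: affine_formula l m; affine_formula (- l) (- m)]).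
    by move=> phi [<-|[<-|//]]; apply: params_affine => //; exact: subspN.
  rewrite /pos !vP ?holds_affine; [|by right; left|by left].
  by rewrite linN -opprD; exact: (doag_cone M).1.
- move=> l m l' m' Dm Dm'.
  have [|v vP] := type_approx (svalP p) (s := [:: affine_formula l m;
      affine_formula l' m'; affine_formula (l + l') (m + m')]).
    by move=> phi [<-|[<-|[<-|//]]]; apply: params_affine => //; exact: subspD.
  rewrite /pos !vP ?holds_affine; [|by right; right; left|by right; left|by left].
  by rewrite linD addrACA; exact: (doag_cone M).2.
- move=> m Dm.
  have [|v vP] := type_approx (svalP p) (s := [:: affine_formula 0 m]).
    by move=> phi [<-|//]; exact: params_affine.
  by rewrite /pos !vP ?holds_affine ?lin0 ?add0r//; left.
Qed.

(* The linear projection [g] onto [D] extends a cone of forms over [D] to a cone of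
   forms over [M]. *)
Section ConeSat.
Variables (D : set M) (g : M -> M).
Hypotheses (hD : rat_subspace D) (gD : forall x, D (g x)).
Hypotheses (gid : forall x, D x -> g x = x).
Hypotheses (glin : forall (r : rat) x y, g (r *: x + y) = r *: g x + g y).

(** The space [E] of forms, preordered by [P], contains a generic tuple, namely the coordinate
    forms. Elimination moves this tuple into [M] while preserving finitely many signs. *)
Lemma cone_sat (V : finType) (P : (V -> rat) -> M -> Prop) (L : seq ((V -> rat) * M)) :
  affine_cone D P -> exists v : V -> M,
    forall e, List.In e L -> D e.2 -> P e.1 e.2 <-> 0 <= lin e.1 v + e.2.
Proof.
move=> [Ptot Padd P0].
have gDD x y : g (x + y) = g x + g y by have := glin 1 x y; rewrite !scale1r.
have g0 : g 0 = 0 by apply: gid; exact: subsp0.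
have gZ r x : g (r *: x) = r *: g x by have := glin r x 0; rewrite g0 !addr0.
have gN x : g (- x) = - g x by rewrite -!scaleN1r gZ.
pose E : lmodType rat := ((V -> rat^o) * M)%type.
pose PE (x : E) : Prop := P x.1 (g x.2).
have coneE : total_cone PE.
  split=> [[l m]|[l m] [l' m']]; rewrite /PE /=.
    by rewrite gN; exact: Ptot.
  by rewrite gDD; exact: Padd.
pose f0 (m : M) : E := (0, g m).
pose f (k : nat) : E := (fun i => (k == enum_rank i)%:R, 0).
pose n := #|V|.
pose aff (e : (V -> rat) * M) : lcomb (iter n option M) :=
  (1, lcst n e.2) ::
    flatten [seq lcomb_scale (e.1 i) (lvar M n (enum_rank i)) | i <- index_enum V].
have affE (E' : lmodType rat) (h0 : M -> E') (h : nat -> E') e :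
    lcomb_val (lenv h0 h (n := n)) (aff e) =
    h0 e.2 + \sum_i e.1 i *: h (enum_rank i).
  rewrite /aff /lcomb_val big_cons/= lenv_lcst scale1r; congr (_ + _).
  rewrite big_flatten/= big_map; apply: eq_bigr => i _.
  by rewrite -/(lcomb_val _ _) lcomb_val_scale lcomb_val_lvar.
have base L' : agree PE (fun x : M => 0 <= x) L' f0 g.
  move=> e _; have -> : lcomb_val f0 e = (0, lcomb_val g e) :> E.
    rewrite /lcomb_val; elim: e => [|z e IH]; first by rewrite !big_nil.
    by rewrite !big_cons IH /f0; congr (_, _); rewrite /= scaler0 addr0.
  have Dg : D (lcomb_val g e).
    rewrite /lcomb_val; apply: big_ind => [|x y|z _]; [exact: subsp0|exact: subspD|].
    exact: subspZ.
  by rewrite /PE /= gid//; exact: P0.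
have [y yP] := agree_extend_iter coneE (doag_cone M) (doag_cone_nontrivial M) f
   base [seq aff e | e <- L].
exists (fun i => y (enum_rank i)) => e eL De.
have := yP _ (List.in_map aff _ _ eL); rewrite !affE gid// addrC.
have -> : \sum_i e.1 i *: f (enum_rank i) + f0 e.2 = (e.1, e.2) :> E.
  have -> : \sum_i e.1 i *: f (enum_rank i) = (e.1, 0) :> E.
    have fst_sum (I : Type) (s : seq I) (F : I -> E) :
        \sum_(i <- s) F i = (\sum_(i <- s) (F i).1, \sum_(i <- s) (F i).2).
      elim: s => [|a s IH]; first by rewrite !big_nil.
      by rewrite !big_cons IH.
    rewrite fst_sum; congr (_, _); last first.
      by rewrite big1// => i _ /=; rewrite scaler0.
    apply/funext => j; rewrite fct_sumE (bigD1 j)//= big1 ?addr0.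
      by rewrite /f /= /GRing.scale/= eqxx; exact: mulr1.
    move=> i ij; rewrite [LHS](_ : _ = e.1 i * (enum_rank i == enum_rank j)%:R)//.
    rewrite (_ : _ == _ = false) ?mulr0//.
    by apply/negbTE; apply: contra ij => /eqP/enum_rank_inj->.
  by congr (_, _); rewrite /f0 /= ?addr0 ?add0r ?gid.
by rewrite /PE /= gid// [_ + e.2]addrC.
Qed.

Lemma cone_type (V : finType) (P : (V -> rat) -> M -> Prop) : affine_cone D P ->
  exists p : typespace D V, forall l m, D m -> pos (sval p) l m <-> P l m.
Proof.
move=> Pc; have [Ptot Padd P0] := Pc.
(* A formula is put in the type when finitely many of the signs prescribed by [P] imply it. *)
pose p : set (formula M V) := [set phi | params phi `<=` D /\
  exists L : seq ((V -> rat) * M), (forall e, List.In e L -> D e.2) /\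
   forall v, (forall e, List.In e L -> P e.1 e.2 <-> 0 <= lin e.1 v + e.2) ->
     holds v phi].
have pc : complete_type D p.
  split=> [phi []//|s fs sp|phi phiD].
    suff [L [LD LP]] : exists L : seq ((V -> rat) * M),
        (forall e, List.In e L -> D e.2) /\
        forall v, (forall e, List.In e L -> P e.1 e.2 <-> 0 <= lin e.1 v + e.2) ->
        forall phi, s phi -> holds v phi.
      by have [v vP] := cone_sat L Pc; exists v; apply: LP => e eL; apply: vP => //; exact: LD.
    have [t tP] := finite_set_list fs.
    suff [L [LD LP]] : exists L : seq ((V -> rat) * M),
        (forall e, List.In e L -> D e.2) /\
        forall v, (forall e, List.In e L -> P e.1 e.2 <-> 0 <= lin e.1 v + e.2) ->
        forall phi, List.In phi t -> s phi -> holds v phi.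
      by exists L; split=> // v vP phi sphi; apply: LP => //; exact: tP.
    elim: t {tP} => [|a t [L [LD LP]]]; first by exists [::].
    have [/sp[_ [L' [LD' LP']]]|nsa] := pselect (s a); last first.
      by exists L; split=> // v vP phi [<-//|]; exact: LP.
    exists (L' ++ L); split=> [e /(@List.in_app_or _ _ _ _)[/LD'//|/LD//]|].
    move=> v vP phi [<- _|].
      by apply: LP' => e eL; apply: vP; apply: List.in_or_app; left.
    by apply: LP => e eL; apply: vP; apply: List.in_or_app; right.
  have [L [LD LP]] := formula_affine hD phiD.
  have [w wP] := cone_sat L Pc.
  have [hw|hw] := pselect (holds w phi); [left|right]; split => //; exists L; split => // v vP.
    move: hw; apply: (LP w v _).1 => e eL.
    by rewrite -vP// -wP//; exact: LD.
  move=> hv; apply: hw; move: hv; apply: (LP v w _).1 => e eL.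
  by rewrite -vP// -wP//; exact: LD.
exists (exist _ p pc) => l m Dm; rewrite /pos /=; split.
  move=> [_ [L [LD LP]]]; have [v vP] := cone_sat ((l, m) :: L) Pc.
  apply/(vP (l, m)) => //; first by left.
  by apply/holds_affine/LP => e eL; apply: vP; [right|exact: LD].
move=> Plm; split; first exact: params_affine.
exists [:: (l, m)]; split; first by move=> e [<-|].
by move=> v /(_ (l, m) (or_introl erefl)) [h _]; apply/holds_affine/h.
Qed.

End ConeSat.
End TypeCone.

(** * Neighbourhoods and construction of types *)

Section Types.
Context {M : doagType}.

Lemma pos_restrict (D : set M) (V W : finType) (f : W -> V) (p : typespace D V) l m :
  rat_subspace D -> D m ->
  pos (sval (tp_restrict f p)) l m <-> pos (sval p) (lpush f l) m.
Proof.
move=> hD Dm.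
have [|v vP] := type_approx (svalP p)
    (s := [:: formula_map id f (affine_formula l m); affine_formula (lpush f l) m]).
  by move=> phi [<-|[<-|//]]; rewrite ?params_map; exact: params_affine.
rewrite /pos /= !vP; [|by right; left|by left].
by rewrite holds_map !holds_affine lin_push.
Qed.

Lemma type_notP (D : set M) (V : Type) (p : typespace D V) phi :
  sval p (FNot phi) -> ~ sval p phi.
Proof.
have [_ sat _] := svalP p => pn pp.
have [||w wP] := sat [set phi; FNot phi].
- by rewrite finite_setU; split; exact: finite_set1.
- by move=> psi /= [->|->].
by apply: (wP _ (or_intror erefl)); exact: (wP _ (or_introl erefl)).
Qed.

Lemma near_type (D : set M) (V : Type) (p : typespace D V) phi : sval p phi ->
  \forall q \near p, sval q phi.
Proof.
move=> pphi; apply: open_nbhs_nbhs; split=> //.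
by move=> q qphi; exists phi.
Qed.

Lemma near_pos (D : set M) (V : finType) (p : typespace D V) l m :
  rat_subspace D -> D m ->
  \forall q \near p, pos (sval q) l m <-> pos (sval p) l m.
Proof.
move=> hD Dm; have [_ _ compl] := svalP p.
have [|h|h] := compl (affine_formula l m); first exact: params_affine.
  by apply: filterS (near_type h) => q qh; split.
by apply: filterS (near_type h) => q /type_notP qh; split=> // /(type_notP h).
Qed.

Lemma near_In (T : topologicalType) (x : T) (S : Type) (L : seq S) (Q : S -> T -> Prop) :
  (forall e, List.In e L -> \forall y \near x, Q e y) ->
  \forall y \near x, forall e, List.In e L -> Q e y.
Proof.
elim: L => [|a L IH] h; first by near=> y.
have h1 := h _ (or_introl erefl).
have h2 := IH (fun e eL => h _ (or_intror eL)).
by near=> y => e [<-|]; [near: y|move: e; near: y].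
Unshelve. all: by end_near. Qed.

(** A basic open set is given by one formula, and [type_affine] makes it depend on finitely many
    signs. *)
Lemma type_continuous (T : topologicalType) (D : set M) (V : finType)
    (f : T -> typespace D V) : rat_subspace D ->
  (forall l m x, D m ->
     \forall y \near x, pos (sval (f y)) l m <-> pos (sval (f x)) l m) ->
  continuous f.
Proof.
move=> hD fpos x U; rewrite nbhsE => -[W [oW Wfx] WU].
have [phi fphi phiW] := oW _ Wfx.
have [phiD _ _] := svalP (f x).
have [L [LD LP]] := type_affine hD (phiD _ fphi).
have := near_In (L := L) (fun e eL => fpos e.1 e.2 x (LD _ eL)).
apply: filterS => y yL; apply/WU/phiW.
by apply/(LP D D (sval (f y)) (sval (f x))) => //; exact: svalP.
Qed.

Lemma rat_subspaceT : rat_subspace [set: M].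
Proof. by []. Qed.

Lemma rat_subspace1 : rat_subspace [set (0 : M)].
Proof. by split=> // r x y /= -> ->; rewrite scaler0 addr0. Qed.

Lemma cone_globaltype (V : finType) (P : (V -> rat) -> M -> Prop) :
  affine_cone [set: M] P ->
  exists p : globaltype M V, forall l m, pos (sval p) l m <-> P l m.
Proof.
move=> /(cone_type rat_subspaceT (g := id))[]// p pP.
by exists p => l m; exact: pP.
Qed.

Lemma cone_type1 (V : finType) (P : (V -> rat) -> M -> Prop) :
  affine_cone [set 0] P ->
  exists p : typespace [set (0 : M)] V, forall l, pos (sval p) l 0 <-> P l 0.
Proof.
move=> /(cone_type rat_subspace1 (g := fun=> 0))[]//.
  by move=> r x y; rewrite scaler0 addr0.
by move=> p pP; exists p => l; exact: pP.
Qed.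

Lemma globaltype_ext (V : finType) (p q : globaltype M V) :
  (forall l m, pos (sval p) l m <-> pos (sval q) l m) -> p = q.
Proof. by move=> pq; apply: type_ext => // l m _; exact: pq. Qed.

End Types.

(** * Action of automorphisms on types *)

Section Automorphisms.
Context {M : doagType}.
Variable s : M -> M.
Hypothesis auts : doag_aut s.

Lemma autD x y : s (x + y) = s x + s y. Proof. by case: auts. Qed.

Lemma aut0 : s 0 = 0.
Proof. by apply: (addIr (s 0)); rewrite -autD !add0r. Qed.

Lemma autN x : s (- x) = - s x.
Proof. by apply: (addIr (s x)); rewrite -autD !addNr aut0. Qed.

Lemma autB x y : s (x - y) = s x - s y.
Proof. by rewrite autD autN. Qed.

Lemma aut_le x y : (s x <= s y) = (x <= y). Proof. by case: auts. Qed.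

Lemma aut_lt x y : (s x < s y) = (x < y).
Proof. by rewrite !ltNge aut_le. Qed.

Lemma aut_inj : injective s. Proof. by case: auts => /bij_inj. Qed.

Lemma aut_scale (r : rat) x : s (r *: x) = r *: s x.
Proof. exact: (rat_linear autB). Qed.

Lemma aut_lin (V : finType) (l : V -> rat) (v : V -> M) : s (lin l v) = lin l (s \o v).
Proof.
rewrite /lin; elim/big_ind2: _ => [|x1 x2 y1 y2 <- <-|i _]; first exact: aut0.
  by rewrite autD.
by rewrite aut_scale.
Qed.

Lemma aut_cancel : exists2 t : M -> M, cancel s t & cancel t s /\ doag_aut t.
Proof.
have [[t st ts] _ _] := auts; exists t => //; split=> //; split.
- by exists s.
- by move=> x y; apply: aut_inj; rewrite autD !ts.
- by move=> x y; rewrite -aut_le !ts.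
Qed.

Lemma holds_aut (V : Type) (v : V -> M) (phi : formula M V) :
  holds (s \o v) (formula_map s id phi) <-> holds v phi.
Proof.
have termE (U : Type) (u : U -> M) (t : term M U) :
    term_val (s \o u) (term_map s id t) = s (term_val u t).
  by elim: t => //= [|a -> b ->|a ->]; rewrite ?aut0 ?autD ?autN.
elim: phi v => {V} [V t1 t2|V t1 t2|V phi IH|V phi IH psi IH'|V phi IH] v /=.
- by rewrite !termE; split=> [/aut_inj|->].
- by rewrite !termE aut_lt.
- by rewrite IH.
- by rewrite IH IH'.
- rewrite (_ : omap id = id); last by apply/funext => -[].
  have E x : s \o env_cons x v = env_cons (s x) (s \o v).
    by apply/funext => -[].
  have [t st [ts _]] := aut_cancel.
  split=> -[x hx]; last first.
    by exists (s x); rewrite -/(env_cons _ _) -E; exact/IH.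
  by exists (t x); apply/IH; rewrite -/(env_cons _ _) E ts.
Qed.

Lemma pos_aut (V : finType) (p : globaltype M V) l m :
  sval p (formula_map s id (affine_formula l m)) <-> pos (sval p) l (s m).
Proof.
have [|v vP] := type_approx (svalP p)
  (s := [:: formula_map s id (affine_formula l m); affine_formula l (s m)]).
  by [].
rewrite /pos !vP; [|by right; left|by left].
have [t st [ts auT]] := aut_cancel.
have -> : v = s \o (t \o v) by apply/funext => i /=; rewrite ts.
by rewrite holds_aut !holds_affine -aut_lin -autD -{2}aut0 aut_le.
Qed.

Fact aut_type_complete (V : finType) (p : globaltype M V) :
  complete_type [set: M] [set phi | sval p (formula_map s id phi)].
Proof.
have [_ sat compl] := svalP p; have [t st [ts _]] := aut_cancel.
split=> // [S fS Sp|phi _]; last exact: (compl (formula_map s id phi)).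
have [||v vP] := sat (formula_map s id @` S); first exact: finite_image.
  by move=> _ [phi Sphi <-]; exact: Sp.
exists (t \o v) => phi Sphi; apply/holds_aut.
by rewrite (_ : s \o _ = v); [apply: vP; exists phi|apply/funext => i /=].
Qed.

End Automorphisms.

(** The pullback of [p] by an automorphism is again a type, so by [globaltype_ext] it can be
    compared with [p] on affine formulas. *)
Lemma aut_invariantP (M : doagType) (A : set M) (V : finType) (p : globaltype M V) :
  aut_invariant A p <-> forall s, doag_aut s -> (forall a, A a -> s a = a) ->
    forall l m, pos (sval p) l m <-> pos (sval p) l (s m).
Proof.
split=> h s auts sA.
  by move=> l m; rewrite -pos_aut//; exact: h.
pose q : globaltype M V := exist _ _ (aut_type_complete auts p).
have : p = q by apply: globaltype_ext => l m; rewrite {2}/pos /= pos_aut//; exact: h.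
by move=> pq phi; rewrite {1}pq.
Qed.

HB.instance Definition _ (T : finType) (A : set T) := [Finite of set_type A by <:].

Lemma absP (M : doagType) (x : M) :
  (0 <= x /\ doag_abs x = x) \/ (x <= 0 /\ doag_abs x = - x).
Proof.
have /orP[x0|x0] := doag_total 0 x; [left|right]; split; rewrite // /doag_abs.
  by apply/max_idPl; ola.
by apply/max_idPr; ola.
Qed.

Lemma abs_bounds (M : doagType) (x : M) : [/\ x <= doag_abs x, - x <= doag_abs x &
  doag_abs x = x \/ doag_abs x = - x].
Proof. by case: (absP x) => -[h ->]; split; try ola; [left|right]. Qed.

Lemma abs_le (M : doagType) (x y : M) : x <= y -> - x <= y -> doag_abs x <= y.
Proof. by case: (absP x) => -[_ ->]. Qed.

Lemma abs_lt (M : doagType) (x y : M) : x < y -> - x < y -> doag_abs x < y.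
Proof. by case: (absP x) => -[_ ->]. Qed.

Ltac abs_bounds_all :=
  repeat match goal with
  | |- context [doag_abs ?x] =>
    let a := fresh "a" in let E := fresh "E" in
    have E := abs_bounds x; set a := doag_abs x in E *; clearbody a; move: E => [? ? ?]
  | H : context [doag_abs ?x] |- _ =>
    let a := fresh "a" in let E := fresh "E" in
    have E := abs_bounds x; set a := doag_abs x in E H *; clearbody a; move: E => [? ? ?]
  end.

Ltac olabs_split :=
  first [ ola
        | match goal with
          | D : ?a = ?x \/ ?a = - ?x |- _ => case: D => ?; olabs_split
          end ].

(* An absolute value is only split into its two cases when its linear bounds do
   not suffice. *)
Ltac olabs :=
  intros; try apply: abs_le; try apply: abs_lt; abs_bounds_all; olabs_split.

(** * Saturation and homogeneity *)

Section Saturation.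
Context {M : doagType}.

(** The type of a point just above [x] consists of the formulas that hold on a large set, for an
    ultrafilter refining the right neighbourhoods of [x]; saturation realizes it. *)
Lemma saturated_above (X : set M) (x : M) : succ_saturated X -> X x ->
  exists2 y, x < y & forall b, X b -> x < b -> y < b.
Proof.
move=> hsat Xx.
pose F : set_system M := [set U | exists2 z, x < z & forall y, x < y -> y < z -> U y].
have [u [u0 nu]] := doag_cone_nontrivial M.
have FF : ProperFilter F.
  apply: Build_ProperFilter_ex.
    move=> U [z xz zU]; exists (2^-1 *: (x + z)); apply: zU; ola.
  split.
  - by exists (x + u) => //; ola.
  - move=> U U' [z xz zU] [z' xz' zU']; exists (Num.min z z') => [|y xy].
      by rewrite lt_min xz.
    by rewrite lt_min => /andP[yz yz']; split; [exact: zU|exact: zU'].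
  - by move=> U U' UU' [z xz zU]; exists z => // y xy yz; exact/UU'/zU.
have [G [UG FG]] := ultraFilterLemma FF.
pose p := [set phi : formula M unit | params phi `<=` X /\
  G [set y | holds (fun=> y) phi]].
have pc : complete_type X p.
  split=> [phi []//|s fs sp|phi phiX].
    have [t tP] := finite_set_list fs.
    have Gt : G [set y | forall phi, List.In phi t -> s phi -> holds (fun=> y) phi].
      elim: t {tP} => [|a t IH]; first by apply: filterS (@filterT _ G _) => y _ phi [].
      have [sa|nsa] := pselect (s a); last first.
        by apply: filterS IH => y yP phi [<-//|]; exact: yP.
      have [_ Ga] := sp _ sa.
      by apply: filterS2 Ga IH => y ya yP phi [<-//|]; exact: yP.
    have [y yP] := filter_ex Gt.
    by exists (fun=> y) => phi sphi; apply: yP => //; exact: tP.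
  have [h|h] := in_ultra_setVsetC [set y | holds (fun=> y) phi] UG; [left|right];
    by split.
have [w wp] := hsat X (card_lexx X) (exist _ p pc).
have pE phi : p phi -> holds w phi.
  by move=> pphi; have [] : tp X w phi by rewrite -wp.
exists (w tt).
  apply: (pE (FLt (TCst unit x) (TVar M tt))); split => /=.
    by move=> z /= [->|].
  by apply: FG; exists (x + u) => //; ola.
move=> b Xb xb.
apply: (pE (FLt (TVar M tt) (TCst unit b))); split => /=.
  by move=> z /= [|->].
by apply: FG; exists b.
Qed.

Definition same_cut (B : set M) (x y : M) : Prop :=
  forall b, B b -> (b <= x) = (b <= y) /\ (x <= b) = (y <= b).

(** By [qe_agree] only the signs of the forms [a + k *: x] matter, and for nonzero [k] such a sign
    compares [x] with the point [- k^-1 *: a] of [A]. *)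
Lemma elementary_same_cut (A : set M) (x y : M) : rat_subspace A -> ~ A x ->
  same_cut A x y ->
  elementary_on (A `|` [set x]) (fun z => if z == x then y else z).
Proof.
move=> hA nAx xy phi phiD; set D := A `|` [set x] in phiD *.
set f := fun z => _.
have [L LP] := qe_agree M phi.
pose g z := if `[< D z >] then z else 0.
have gE : formula_map g id phi = phi.
  rewrite -[RHS]formula_map_id; apply: formula_map_ext => z /phiD Dz.
  by rewrite /g asboolT.
have fgE : formula_map (f \o g) id phi = formula_map f id phi.
  by apply: formula_map_ext => z /phiD Dz; rewrite /= /g asboolT.
rewrite -fgE -[in X in X <-> _]gE; apply: LP => e _ {phi phiD L gE fgE}.
have [a [k [Aa -> ->]]] : exists a k, [/\ A a,
    lcomb_val (sum_env (of_void M) g) e = a + k *: x &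
    lcomb_val (sum_env (of_void M) (f \o g)) e = a + k *: y].
  rewrite /lcomb_val; elim: e => [|[r [[]|z]] e [a [k [Aa h1 h2]]]].
    by exists 0, 0; rewrite !big_nil !scale0r addr0; split=> //; exact: subsp0.
  rewrite !big_cons h1 h2 /= /g; case: asboolP => Dz; last first.
    exists a, k; rewrite scaler0 add0r; split => //.
    rewrite /f; case: eqP => [x0|]; last by rewrite scaler0 add0r.
    by case: nAx; rewrite -x0; exact: subsp0.
  have [->|zx] := eqVneq z x.
    exists a, (r + k); split=> //; first by rewrite addrCA scalerDl.
    by rewrite /f eqxx addrCA scalerDl.
  exists (r *: z + a), k; rewrite -!addrA /f (negbTE zx); split=> //.
  case: Dz => [Az|/= zx']; last by rewrite zx' eqxx in zx.
  by apply: subspD => //; exact: subspZ.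
have [->|k0] := eqVneq k 0; first by rewrite !scale0r.
pose b := (- k^-1) *: a.
have Ab : A b by exact: subspZ.
have E z : a + k *: z = k *: (z - b).
  by rewrite /b scaleNr opprK scalerDr scalerA mulfV// scale1r addrC.
clearbody b; rewrite !E; have [h1 h2] := xy _ Ab.
have [kn|kp] : k < 0 \/ 0 < k by case: ltgtP k0 => //; [left|right].
  have kN : 0 < - k by rewrite oppr_gt0.
  rewrite -[k]opprK !(scaleNr (- _)) -!scalerN !opprB.
  rewrite !(cone_scaleE (doag_cone M) _ kN) !doag_subr_ge0.
  by rewrite h2.
by rewrite !(cone_scaleE (doag_cone M) _ kp) !doag_subr_ge0 h1.
Qed.

(** The point [z] bounds the number of parameters: [x] may lie outside [X], but adding it to [A]
    gives no more elements than adding [z]. *)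
Lemma homogeneous_same_cut (A X : set M) (x y z : M) : rat_subspace A ->
  succ_strongly_homogeneous X -> A `<=` X -> X z -> ~ A z -> ~ A x ->
  same_cut A x y ->
  exists s, [/\ doag_aut s, forall a, A a -> s a = a & s x = y].
Proof.
move=> hA hX AX Xz nAz nAx xy.
have cardD : (A `|` [set x] #<= X)%card.
  have -> : A `|` [set x] = (fun t => if t == z then x else t) @` (A `|` [set z]).
    apply/seteqP; split=> t /=.
      move=> [At|->]; last by exists z; [right|rewrite eqxx].
      by exists t; [left|case: eqP => // tz; case: nAz; rewrite -tz].
    move=> [u [Au|->] <-]; last by rewrite eqxx; right.
    by case: eqP => [uz|_]; [case: nAz; rewrite -uz|left].
  apply: card_le_trans (card_image_le _ _) _; apply: subset_card_le.
  by move=> t [/AX//|->].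
have [s auts sE] := hX _ cardD _ (elementary_same_cut hA nAx xy).
exists s; split=> //; last by rewrite sE ?eqxx//; right.
move=> a Aa; rewrite sE; last by left.
by case: eqP => // ax; case: nAx; rewrite -ax.
Qed.

End Saturation.

(** * Cuts, stabilizers and convex groups *)

Definition convex_group (M : doagType) (G : set M) : Prop :=
  [/\ G 0, forall x y, G x -> G y -> G (x + y)
    & forall x y, G y -> doag_abs x <= doag_abs y -> G x].

Section ConvexGroup.
Context {M : doagType} (G : set M).
Hypothesis hG : convex_group G.

Lemma convexN x : G x -> G (- x).
Proof. by move=> Gx; case: hG => _ _ /(_ _ _ Gx); apply; olabs. Qed.

Lemma convexB x y : G x -> G y -> G (x - y).
Proof. by move=> Gx /convexN; case: hG => _ + _; exact. Qed.

Lemma convex_muln x n : G x -> G (x *+ n).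
Proof.
case: hG => G0 GD _ Gx; elim: n => [|n IH]; first by rewrite mulr0n.
by rewrite mulrS; exact: GD.
Qed.

End ConvexGroup.

Lemma convex_total (M : doagType) (G H : set M) :
  convex_group G -> convex_group H -> G `<=` H \/ H `<=` G.
Proof.
move=> [_ _ Gc] [_ _ Hc]; have [|/existsNP[x /not_implyP[Gx nHx]]] := pselect (G `<=` H).
  by left.
right=> y Hy; apply: Gc Gx _; have /orP[//|xy] := doag_total (doag_abs y) (doag_abs x).
by case: nHx; exact: Hc Hy xy.
Qed.

Section Valuation.
Context {M : doagType} (B : set M).
Hypothesis hB : rat_subspace B.

Lemma ctP d y : ct B d y <-> same_cut B d y.
Proof.
split=> [h b Bb|h [l u] [/= bl bu dI]].
  have test (i : interval M) : bound_in B i.1 -> bound_in B i.2 -> d \in i -> y \in i.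
    by move=> *; apply: h.
  have t1 := test (Interval (BLeft b) +oo%O) Bb I.
  have t2 := test (Interval -oo%O (BRight b)) I Bb.
  have t3 := test (Interval (BRight b) +oo%O) Bb I.
  have t4 := test (Interval -oo%O (BLeft b)) I Bb.
  rewrite !in_itv/= ?andbT in t1 t2 t3 t4.
  split; apply/idP/idP => h1; [exact: t1| |exact: t2|].
    by apply: doag_nlt => /t4; move: h1; ola.
  by apply: doag_nlt => /t3; move: h1; ola.
move: dI bl bu; rewrite !in_itv/= => /andP[dl du] bl bu.
apply/andP; split.
  case: l dl bl => [[] l|[]]//= dl bl; have [h1 h2] := h _ bl.
    by rewrite -h1.
  by rewrite ltNge -h2 -ltNge.
case: u du bu => [[] u|[]]//= du bu; have [h1 h2] := h _ bu.
  by rewrite ltNge -h1 -ltNge.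
by rewrite -h2.
Qed.

Lemma same_cut_sym x y : same_cut B x y -> same_cut B y x.
Proof. by move=> h b /h[-> ->]. Qed.

Lemma same_cut_trans x y z : same_cut B x y -> same_cut B y z -> same_cut B x z.
Proof. by move=> h h' b Bb; have [-> ->] := h b Bb; exact: h'. Qed.

Lemma ct_eq x y : ct B x = ct B y <-> same_cut B x y.
Proof.
split=> [xy|xy]; first by apply/ctP; rewrite xy; apply/ctP.
apply/seteqP; split=> z /ctP zP; apply/ctP.
  exact: same_cut_trans (same_cut_sym xy) zP.
exact: same_cut_trans xy zP.
Qed.

Lemma not_same_cut d y : ~ B d -> ~ same_cut B d y ->
  (exists b, [/\ B b, y <= b & b < d]) \/ (exists b, [/\ B b, d < b & b <= y]).
Proof.
move=> nBd /existsNP[b /not_implyP[Bb nb]].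
have db : d <> b by move=> db; apply: nBd; rewrite db.
have {}db : d < b \/ b < d by case: (ltgtP d b) db => //; [left|right].
case: db => db; [right|left]; exists b; split=> //; apply: contrapT => h; apply: nb.
  by split; apply/idP/idP; ola.
by split; apply/idP/idP; ola.
Qed.

(** If some [b'] in [B] is closer to [d] than [|b|], then a translate of [d] by [b] jumps over [b']
    or over [b' + b]. Conversely, a translation shorter than the distance to every point of [B]
    crosses none of them. *)
Lemma StabP d b : ~ B d ->
  Stab B d b <-> B b /\ forall b', B b' -> doag_abs b <= doag_abs (d - b').
Proof.
move=> nBd; split=> [[Bb /ct_eq db]|[Bb dist]]; split=> //.
  move=> b' Bb'; apply: doag_nlt => lt.
  have db' : d <> b' by move=> e; apply: nBd; rewrite e.
  have [h1 h2] := db _ Bb'; have [h3 h4] := db _ (subspD hB Bb' Bb).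
  move: lt; case: (absP (d - b')) => -[? ->]; case: (absP b) => -[? ->] lt.
  - have : b' + b <= d by rewrite -h3; ola.
    by ola.
  - by apply: db'; have : d <= b'; [rewrite -h2; ola|ola].
  - by apply: db'; have : b' <= d; [rewrite -h1; ola|ola].
  - have : d <= b' + b by rewrite -h4; ola.
    by ola.
apply/ct_eq/same_cut_sym => b' Bb'; have := dist _ Bb'.
have db' : d <> b' by move=> db; apply: nBd; rewrite db.
have {}db' : d < b' \/ b' < d by case: (ltgtP d b') db' => //; [left|right].
have ddb : d + b <> b'.
  by move=> e; apply: nBd; rewrite (_ : d = b' - b); [exact: subspB|ola].
have {}ddb : d + b < b' \/ b' < d + b by case: (ltgtP (d + b) b') ddb => //; [left|right].
move=> h; have [[p q]|[p q]] : (d < b' /\ d + b < b') \/ (b' < d /\ b' < d + b).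
- case: db' => p; case: ddb => q; [by left| | |by right];
    exfalso; move: h p q; olabs.
- by split; apply/idP/idP; ola.
- by split; apply/idP/idP; ola.
Qed.

(* The only possible failure would be a point of [B] at a distance from [d] between
   [|b|] and [2|b|]; translating it by [b] or [- b] brings it too close to [d]. *)
Lemma Stab_double d b : ~ B d -> Stab B d b -> Stab B d (b + b).
Proof.
move=> nBd /(StabP _ nBd)[Bb dist]; apply/(StabP _ nBd); split; first exact: subspD.
move=> b' Bb'; have h1 := dist _ (subspD hB Bb' Bb).
have h2 := dist _ (subspB hB Bb' Bb); have h3 := dist _ Bb'.
have db' : d <> b' by move=> e; apply: nBd; rewrite e.
have {}db' : d < b' \/ b' < d by case: (ltgtP d b') db' => //; [left|right].
by case: db' => db'; olabs.
Qed.

Lemma cutGP d x : ~ B d ->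
  cutG B d x <-> forall b, B b -> ~ Stab B d b -> doag_abs x < doag_abs b.
Proof.
move=> nBd; rewrite /cutG /= asboolF//; split=> [h b Bb nSb|h b [Bb nSb]].
  by have /= := h b (conj Bb nSb); rewrite in_itv/= => /andP[]; olabs.
by have := h _ Bb nSb; rewrite /= in_itv/= => lt; apply/andP; split; olabs.
Qed.

Lemma cutG_in d x : B d -> cutG B d x <-> x = 0.
Proof. by move=> Bd; rewrite /cutG /= asboolT. Qed.

Lemma cutG_convex d : convex_group (cutG B d).
Proof.
have [Bd|nBd] := pselect (B d).
  split; first by apply/cutG_in.
    by move=> x y /(cutG_in _ Bd) -> /(cutG_in _ Bd) ->; rewrite addr0; apply/cutG_in.
  by move=> x y /(cutG_in _ Bd) ->; rewrite (cutG_in _ Bd); olabs.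
have Snz b : ~ Stab B d b -> b <> 0.
  move=> nS b0; apply: nS; apply/(StabP _ nBd); rewrite b0; split=> [|b' _].
    exact: subsp0.
  by olabs.
split.
- apply/(cutGP _ nBd) => b Bb /Snz b0.
  have {}b0 : b < 0 \/ 0 < b by case: (ltgtP b 0) b0 => //; [left|right].
  by case: b0; olabs.
(* By [Stab_double], half of an element outside the stabilizer is again outside, so both summands
   are smaller than [|b|] halved. *)
- move=> x y /(cutGP _ nBd) hx /(cutGP _ nBd) hy; apply/(cutGP _ nBd) => b Bb nS.
  have Bh : B (2^-1 *: b) by exact: subspZ.
  have nSh : ~ Stab B d (2^-1 *: b).
    move=> /(Stab_double nBd); rewrite (_ : _ + _ = b)//.
    by ola.
  by have := hx _ Bh nSh; have := hy _ Bh nSh; olabs.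
- move=> x y /(cutGP _ nBd) hy xy; apply/(cutGP _ nBd) => b Bb /(hy _ Bb).
  exact: le_lt_trans.
Qed.

Lemma cutG_Stab d b : ~ B d -> B b -> cutG B d b <-> Stab B d b.
Proof.
move=> nBd Bb; split=> [/(cutGP _ nBd) h|Sb]; first by apply: contrapT => /(h _ Bb); ola.
apply/(cutGP _ nBd) => b' Bb' nS; apply: doag_nle => lt; apply: nS.
apply/(StabP _ nBd); split=> // b'' Bb''; apply: le_trans lt _.
by move/(StabP _ nBd) : Sb => [_]; exact.
Qed.

Lemma cutG_far d b : ~ B d -> B b -> ~ cutG B d b ->
  exists2 b', B b' & doag_abs (d - b') < doag_abs b.
Proof.
move=> nBd Bb nG; apply: contrapT => h; apply: nG; apply/(cutG_Stab nBd Bb).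
apply/(StabP _ nBd); split=> // b' Bb'; apply: doag_nlt => lt; apply: h.
by exists b'.
Qed.

(** Strictness comes from [d] being outside [B]: in case of equality, [d] would be [b'] plus or
    minus [|b|]. *)
Lemma cutG_near d b b' : ~ B d -> B b -> cutG B d b -> B b' ->
  doag_abs b < doag_abs (d - b').
Proof.
move=> nBd Bb /(cutG_Stab nBd Bb)/(StabP _ nBd)[_ h] Bb'.
have := h _ Bb'; rewrite le_eqVlt => /orP[/eqP e|//]; exfalso; apply: nBd.
have Ba x : B x -> B (doag_abs x).
  by move=> Bx; case: (absP x) => -[_ ->] //; exact: subspN.
have := Ba _ Bb; rewrite e; case: (absP (d - b')) => -[_ ->] Be.
  by rewrite -[d](subrK b'); exact: subspD.
by rewrite -[d](subrK b'); apply: subspD => //; rewrite -[_ - _]opprK; exact: subspN.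
Qed.

(** For [b] outside the stabilizer, [d] lies within half of [|b|] of some [b'] in [B]. The interval
    of this radius around [b'] has bounds in [B], so it contains [y] as well. *)
Lemma same_cut_G d y : ~ B d -> same_cut B d y -> cutG B d (y - d).
Proof.
move=> nBd dy; apply/(cutGP _ nBd) => b Bb nS.
have Bh : B (2^-1 *: b) by exact: subspZ.
have [|b' Bb' db'] := cutG_far nBd Bh.
  move=> /(cutG_Stab nBd Bh)/(Stab_double nBd); rewrite (_ : _ + _ = b)//.
  by ola.
have Ba x : B x -> B (doag_abs x).
  by move=> Bx; case: (absP x) => -[_ ->] //; exact: subspN.
have [h1 _] := dy _ (subspB hB Bb' (Ba _ Bh)).
have [_ h2] := dy _ (subspD hB Bb' (Ba _ Bh)).
have y1 : b' - doag_abs (2^-1 *: b) <= y by rewrite -h1; move: db' {h1 h2}; olabs.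
have y2 : y <= b' + doag_abs (2^-1 *: b) by rewrite -h2; move: db' {h1 h2 y1}; olabs.
move: db' y1 y2 {h1 h2}; set h := doag_abs (2^-1 *: b) => db' y1 y2.
have hE : h + h = doag_abs b by rewrite /h; olabs.
rewrite -hE; clearbody h; olabs.
Qed.

(** If a point [c] of [B] separated [d] from [y'], comparing [y] with a translate of [c] by [|b|]
    would place [d] within [|b|] of [c], against [cutG_near]. *)
Lemma same_cut_shift d y y' b : ~ B d -> same_cut B d y -> B b -> cutG B d b ->
  doag_abs (y' - y) <= doag_abs b -> same_cut B d y'.
Proof.
move=> nBd dy Bb Gb yy'; apply: contrapT => /(not_same_cut nBd)[] [c [Bc h1 h2]].
  have Bx : B (c + doag_abs b).
    by apply: subspD => //; case: (absP b) => -[_ ->] //; exact: subspN.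
  have [h3 h4] := dy _ Bc; have [h5 h6] := dy _ Bx.
  have : d <= c + doag_abs b by rewrite h6; move: {h3 h4 h5 h6} yy' h1; olabs.
  by have := cutG_near nBd Bb Gb Bc; move: {h3 h4 h5 h6 yy'} h2; olabs.
have Bx : B (c - doag_abs b).
  by apply: subspB => //; case: (absP b) => -[_ ->] //; exact: subspN.
have [h3 h4] := dy _ Bc; have [h5 h6] := dy _ Bx.
have : c - doag_abs b <= d by rewrite h5; move: {h3 h4 h5 h6} yy' h2; olabs.
by have := cutG_near nBd Bb Gb Bc; move: {h3 h4 h5 h6 yy'} h1; olabs.
Qed.

(** A point of [B] between [d] and [y] would lie in the coset [d + G] by convexity, and [d] would be
    ramified. *)
Lemma archimedean_same_cut d y : ~ B d -> archimedean B d -> cutG B d (y - d) ->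
  same_cut B d y.
Proof.
move=> nBd arch Gyd; apply: contrapT => /(not_same_cut nBd) h; apply: arch; split=> //.
have [_ _ Gc] := cutG_convex d.
case: h => -[b [Bb h1 h2]]; exists b; split=> //; apply: Gc Gyd _; olabs.
Qed.

(** The group [G] is determined by its trace on [B], which is the stabilizer by [cutG_Stab]. *)
Lemma cutG_sub d d' : ~ B d -> ~ B d' ->
  (forall b, B b -> cutG B d b -> cutG B d' b) -> cutG B d `<=` cutG B d'.
Proof.
move=> nBd nBd' h x /(cutGP _ nBd) hx; apply/(cutGP _ nBd') => b Bb nS; apply: hx => //.
by move=> /(cutG_Stab nBd Bb)/(h _ Bb)/(cutG_Stab nBd' Bb).
Qed.

Lemma abs_mulrn (x : M) n : doag_abs (x *+ n) = doag_abs x *+ n.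
Proof.
case: (absP x) => -[x0 ->].
  have : 0 <= x *+ n by exact: (cone_mulrn (doag_cone M)).
  by case: (absP (x *+ n)) => -[h ->]; ola.
have : 0 <= (- x) *+ n by apply: (cone_mulrn (doag_cone M)); ola.
by rewrite mulNrn; case: (absP (x *+ n)) => -[h ->]; ola.
Qed.

Lemma convex_scale (G : set M) (r : rat) x : convex_group G -> G x -> G (r *: x).
Proof.
move=> hG Gx; have [_ _ Gc] := hG.
have /Gc : G (doag_abs x *+ `|numq r|).
  by apply: convex_muln => //; apply: Gc Gx _; olabs.
apply; have d0 := denq_gt0 r.
have E : (r *: x) *+ `|denq r| = if 0 <= numq r then x *+ `|numq r| else - (x *+ `|numq r|).
  rewrite -scaler_nat scalerA -[(`|denq r|%N)%:R]/(`|denq r|%:Z%:~R) gtz0_abs//.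
  rewrite mulrC -{1}(divq_num_den r) mulfVK ?intr_eq0 ?gt_eqF//.
  rewrite -scaler_nat -[(`|numq r|%N)%:R]/(`|numq r|%:Z%:~R); case: (leP 0 (numq r)) => n0.
    by rewrite gez0_abs.
  by rewrite ltz0_abs// intrN scaleNr opprK.
have h1 : doag_abs ((r *: x) *+ `|denq r|) <= doag_abs x *+ `|numq r|.
  rewrite -abs_mulrn E; case: ifP => // _.
  by move: (x *+ _) => y; olabs.
have h2 : doag_abs (r *: x) <= doag_abs ((r *: x) *+ `|denq r|).
  move: d0; case: (denq r) => // -[//|k] _.
  rewrite (_ : absz k.+1 = k.+1)// abs_mulrn mulrS.
  have : 0 <= doag_abs (r *: x) *+ k.
    by apply: (cone_mulrn (doag_cone M)); olabs.
  by move: (_ *+ k) => z; ola.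
apply: le_trans h2 (le_trans h1 _); move: (_ *+ _) => z; olabs.
Qed.

Lemma abs_scale (r : rat) (x : M) :
  doag_abs (r *: x) = if 0 <= r then r *: doag_abs x else (- r) *: doag_abs x.
Proof.
case: (leP 0 r) => r0.
  case: (absP x) => -[x0 ->].
    by have := cone_scale (doag_cone M) r0 x0; case: (absP (r *: x)) => -[? ->]; ola.
  have : 0 <= - x by ola.
  move=> /(cone_scale (doag_cone M) r0); rewrite scalerN.
  by case: (absP (r *: x)) => -[? ->]; ola.
have {}r0 : 0 <= - r by rewrite oppr_ge0 ltW.
rewrite -{1}[r]opprK (scaleNr (- r)); case: (absP x) => -[x0 ->].
  have := cone_scale (doag_cone M) r0 x0; move: (- r *: x) => y.
  by case: (absP (- y)) => -[? ->]; ola.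
have : 0 <= - x by ola.
move=> /(cone_scale (doag_cone M) r0); rewrite scalerN; move: (- r *: x) => y.
by case: (absP (- y)) => -[? ->]; ola.
Qed.

Lemma abs_scale_le (r : rat) (x y : M) :
  doag_abs x <= doag_abs y -> doag_abs (r *: x) <= doag_abs (r *: y).
Proof.
rewrite !abs_scale => xy; have : 0 <= doag_abs y - doag_abs x by ola.
case: (leP 0 r) => r0.
  by move=> /(cone_scale (doag_cone M) r0); rewrite scalerBr doag_subr_ge0.
have {}r0 : 0 <= - r by rewrite oppr_ge0 ltW.
by move=> /(cone_scale (doag_cone M) r0); rewrite scalerBr doag_subr_ge0.
Qed.

Lemma scale_in (r : rat) d : r != 0 -> B (r *: d) <-> B d.
Proof.
move=> r0; split=> [Brd|]; last exact: subspZ.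
have -> : d = r^-1 *: (r *: d) by rewrite scalerA mulVf// scale1r.
exact: subspZ.
Qed.

Lemma cutG_scale_sub (r : rat) d : r != 0 -> ~ B d -> cutG B d `<=` cutG B (r *: d).
Proof.
move=> r0 nBd; have nBrd : ~ B (r *: d) by rewrite scale_in.
apply: cutG_sub => // b Bb Gb; apply/(cutG_Stab nBrd Bb)/(StabP _ nBrd); split=> // b' Bb'.
have Bc : B (r^-1 *: b) by exact: subspZ.
have : cutG B d (r^-1 *: b) by apply: convex_scale => //; exact: cutG_convex.
move=> /(cutG_Stab nBd Bc)/(StabP _ nBd)[_ /(_ _ (subspZ hB r^-1 Bb'))].
by move=> /(abs_scale_le r); rewrite scalerBr !scalerA mulfV// !scale1r.
Qed.

Lemma cutG_scale (r : rat) d : r != 0 -> cutG B (r *: d) = cutG B d.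
Proof.
move=> r0; have [Bd|nBd] := pselect (B d).
  have Brd : B (r *: d) by rewrite scale_in.
  by apply/seteqP; split=> x; rewrite !cutG_in.
apply/seteqP; split; last exact: cutG_scale_sub.
have {2}-> : d = r^-1 *: (r *: d) by rewrite scalerA mulVf// scale1r.
by apply: cutG_scale_sub; rewrite ?invr_eq0 ?scale_in.
Qed.

Lemma ramified_scale (r : rat) d : r != 0 -> ramified B (r *: d) <-> ramified B d.
Proof.
suff h (k : rat) x : k != 0 -> ramified B x -> ramified B (k *: x).
  move=> r0; split=> [/(h r^-1)|]; last exact: h.
  by rewrite invr_eq0 scalerA mulVf// scale1r; exact.
move=> k0 [nBx [b [Bb Gb]]]; split; first by rewrite scale_in.
exists (k *: b); split; first exact: subspZ.
rewrite cutG_scale// -scalerBr; apply: convex_scale => //; exact: cutG_convex.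
Qed.

End Valuation.

(** * Invariant extensions *)

Section GlobalPos.
Context {M : doagType} {V : finType} (p : globaltype M V).
Local Notation P := (pos (sval p)).

Lemma pos_total l m : P l m \/ P (- l) (- m).
Proof. by case: (affine_cone_pos p rat_subspaceT) => h _ _; exact: h. Qed.

Lemma posD l m l' m' : P l m -> P l' m' -> P (l + l') (m + m').
Proof. by case: (affine_cone_pos p rat_subspaceT) => _ h _; exact: h. Qed.

Lemma pos0 m : P 0 m <-> 0 <= m.
Proof. by case: (affine_cone_pos p rat_subspaceT) => _ _ h; exact: h. Qed.

Lemma pos_mono l m m' : m <= m' -> P l m -> P l m'.
Proof.
move=> mm' Plm; have : P 0 (m' - m) by apply/pos0; ola.
move=> /(posD Plm); rewrite addr0 (_ : m + _ = m')//.
by ola.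
Qed.

Lemma pos_pair l m m' : P l m -> P (- l) m' -> 0 <= m + m'.
Proof. by move=> h /(posD h); rewrite subrr pos0. Qed.

Lemma pos_not l m : ~ P l m -> P (- l) (- m).
Proof. by case: (pos_total l m). Qed.

End GlobalPos.

Lemma same_cut_opp (M : doagType) (B : set M) (x y : M) : rat_subspace B ->
  same_cut B x y -> same_cut B (- x) (- y).
Proof.
move=> hB xy b Bb; have [h1 h2] := xy _ (subspN hB Bb).
have E (z : M) : (b <= - z) = (z <= - b) by apply/idP/idP; ola.
have E' (z : M) : (- z <= b) = (- b <= z) by apply/idP/idP; ola.
by rewrite !E !E' h1 h2.
Qed.

(** A point of [B] separates the value of the form from [- m], so the type over [B] already decides
    the sign. *)
Lemma pos_off_cut (M : doagType) (B : set M) (V : finType) (v : V -> M)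
    (p : globaltype M V) (l : V -> rat) (m : M) :
  rat_subspace B -> tp B v `<=` sval p -> ~ B (lin l v) ->
  ~ same_cut B (lin l v) (- m) -> pos (sval p) l m <-> 0 <= lin l v + m.
Proof.
move=> hB /(tp_sub v p hB (@subsetT _ _)) pB; set s := lin l v in pB * => nBs.
move=> /(not_same_cut nBs) [] [b [Bb h1 h2]].
  split=> _; first by ola.
  apply: (@pos_mono _ _ _ _ (- b)); first by ola.
  by apply/pB; [exact: subspN|rewrite -/s; ola].
split=> h; last by exfalso; ola.
have : pos (sval p) l (- b) by apply: pos_mono h; ola.
by move=> /pB-/(_ (subspN hB Bb)); rewrite -/s; ola.
Qed.

Lemma pos_far (M : doagType) (B : set M) (V : finType) (v : V -> M) (p : globaltype M V)
    (l : V -> rat) (m : M) : rat_subspace B -> tp B v `<=` sval p ->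
  ~ B (lin l v) -> ~ cutG B (lin l v) (lin l v + m) ->
  pos (sval p) l m <-> 0 <= lin l v + m.
Proof.
move=> hB pB nBs nG; apply: (pos_off_cut hB pB) => //.
move=> /(same_cut_G hB nBs) /(convexN (cutG_convex hB _)).
by rewrite opprB opprK.
Qed.

Section Setting.
Context {M : doagType} (A B C : set M).
Hypotheses (hA : rat_subspace A) (hB : rat_subspace B) (hC : rat_subspace C).
Hypotheses (hAB : A `<=` B) (hAC : A `<=` C).
Hypothesis hsat : succ_saturated (B `|` C).
Hypothesis hhom : succ_strongly_homogeneous (B `|` C).
Hypothesis hitv : forall b1 b2 : M, B b1 -> B b2 ->
  (exists2 x, C x & x \in `[b1, b2]) -> exists2 a, A a & a \in `[b1, b2].

Lemma above_ex x : B x \/ C x -> exists2 y, x < y & forall b, B b -> x < b -> y < b.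
Proof.
move=> BCx; have [y xy yP] := saturated_above hsat BCx.
by exists y => // b Bb; apply: yP; left.
Qed.

(** Saturation gives a positive element below all the positive elements of [B], and it belongs to
    every such [G]. *)
Lemma cutG_nontrivial d : ~ B d -> exists2 x, 0 < x & cutG B d x.
Proof.
move=> nBd; have [|y y0 yP] := above_ex (x := 0); first by left; exact: subsp0.
exists y => //; apply/(cutGP _ nBd) => b Bb nS.
have Bab : B (doag_abs b) by case: (absP b) => -[_ ->] //; exact: subspN.
have b0 : b <> 0.
  move=> b0; apply: nS; apply/(cutG_Stab hB nBd Bb); rewrite b0.
  by case: (cutG_convex hB d).
have /(yP _ Bab) : 0 < doag_abs b.
  by case: (ltgtP b 0) b0 => // b0 _; olabs.
by olabs.
Qed.

Lemma same_cut_ex d : C d -> ~ B d -> exists2 y, d < y & same_cut B d y.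
Proof.
move=> Cd nBd; have [|y dy yP] := above_ex (x := d); first by right.
exists y => // b Bb; have db : d <> b by move=> e; apply: nBd; rewrite e.
split; apply/idP/idP => h.
- by ola.
- by apply: doag_nlt => /(yP _ Bb); ola.
- have : d < b by case: (ltgtP d b) db h.
  by move=> /(yP _ Bb); ola.
- by ola.
Qed.

Section Const.
Context {V : finType} (v : V -> M) (p : globaltype M V).
Hypothesis pinv : inv_ext A B v p.

Lemma pos_B l b : B b -> pos (sval p) l b <-> 0 <= lin l v + b.
Proof. by case: pinv => _ /(tp_sub v p hB (@subsetT _ _)); apply. Qed.

(* Two points of the same cut over [B] are conjugate under [Aut(M/A)]. *)
Lemma pos_same_cut l m m' : C (lin l v) -> ~ B (lin l v) ->
  same_cut B (lin l v) m -> same_cut B (lin l v) m' ->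
  pos (sval p) l (- m) <-> pos (sval p) l (- m').
Proof.
set s := lin l v => Cs nBs sm sm'.
have nAs : ~ A s by move/hAB.
have nAm : ~ A m.
  move=> /hAB Bm; apply: nBs; have [h1 h2] := sm _ Bm.
  by rewrite (_ : s = m)//; apply: doag_le_anti; rewrite ?h1 ?h2.
have mm' : same_cut A m m'.
  by move=> a /hAB Ba; have [<- <-] := sm _ Ba; exact: sm'.
have ABC : A `<=` B `|` C by move=> a /hAB; left.
have [f [autf fA fm]] := homogeneous_same_cut hA hhom ABC (or_intror Cs) nAs nAm mm'.
have [/aut_invariantP pA _] := pinv.
by rewrite (pA f autf fA) autN// fm.
Qed.

(** If [p] made the form equal to [m], conjugacy would make it at least [y] and at most [lin l v],
    where [y] is a point of the same cut above [lin l v]. *)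
Lemma pos_strict l m : C (lin l v) -> ~ B (lin l v) -> same_cut B (lin l v) m ->
  pos (sval p) l (- m) -> ~ pos (sval p) (- l) m.
Proof.
move=> Cs nBs sm; have [y sy syc] := same_cut_ex Cs nBs => h1 h2.
have h3 : pos (sval p) l (- y) by move: h1; apply: (pos_same_cut Cs nBs sm syc).1.
have h4 : pos (sval p) (- l) (lin l v).
  move: h2; rewrite -{1}[m]opprK -[X in _ -> pos _ _ X]opprK.
  have Cs' : C (lin (- l) v) by rewrite linN; exact: subspN.
  have nBs' : ~ B (lin (- l) v).
    by rewrite linN => /(subspN hB); rewrite opprK.
  apply: (pos_same_cut Cs' nBs' _ _).1; rewrite linN; apply: same_cut_opp => //.
have := pos_pair h3 h4; ola.
Qed.

End Const.

(** Some [b] in [B] lies in the group of [s] and outside that of [t], so [t] is within [|b|] of a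
    point of [B]. The closed interval of radius [|b|] around that point contains [t], hence a point
    of [A]. If [t] is in [B], the interval reduced to [t] shows that [t] is in [A]. *)
Lemma near_A t s : C t -> ~ B s -> cutG B t `<` cutG B s ->
  exists a b, [/\ A a, B b, cutG B s b & doag_abs (t - a) <= doag_abs b].
Proof.
move=> Ct nBs [ts nst]; have [Bt|nBt] := pselect (B t).
  have [|a Aa] := hitv Bt Bt; first by exists t => //; rewrite in_itv/= lexx.
  rewrite in_itv/= => /andP[h1 h2]; exists a, 0; split=> //; first exact: subsp0.
    by case: (cutG_convex hB s).
  by olabs.
have [b [Bb Gb nGb]] : exists b, [/\ B b, cutG B s b & ~ cutG B t b].
  apply: contrapT => h; apply: nst; apply: cutG_sub => // b Bb Gb.
  by apply: contrapT => nG; apply: h; exists b.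
have [b' Bb' tb'] := cutG_far hB nBt Bb nGb.
have Bab : B (doag_abs b) by case: (absP b) => -[_ ->] //; exact: subspN.
have [|a Aa] := hitv (subspB hB Bb' Bab) (subspD hB Bb' Bab).
  by exists t => //; rewrite in_itv/=; apply/andP; split; move: tb'; olabs.
rewrite in_itv/= => /andP[h1 h2]; exists a, (b + b); split=> //; first exact: subspD.
  by case: (cutG_convex hB s) => _ + _; apply.
by move: tb' h1 h2; olabs.
Qed.

(* If [a0] and [a1] are points of [A] close to [d], the second one much closer than
   the first, then [a1 +- |a1 - a0|] lie close to [d] on both sides. *)
Lemma arch_A d e : C d -> ~ B d -> archimedean B d -> B e -> ~ cutG B d e ->
  (exists a, [/\ A a, d - doag_abs e < a & a < d]) /\
  (exists a, [/\ A a, d < a & a < d + doag_abs e]).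
Proof.
move=> Cd nBd arch.
have half_notin x : ~ cutG B d x -> ~ cutG B d (2^-1 *: x).
  move=> nG Gx; apply: nG; rewrite (_ : x = 2^-1 *: x + 2^-1 *: x); last by ola.
  by case: (cutG_convex hB d) => _ + _; apply.
have Babs x : B x -> B (doag_abs x).
  by case: (absP x) => -[_ ->] //; exact: subspN.
have claim x : B x -> ~ cutG B d x -> exists2 a, A a & doag_abs (d - a) < doag_abs x.
  move=> Bx nG; have nG4 := half_notin _ (half_notin _ nG).
  have B4 : B (2^-1 *: (2^-1 *: x)) by do 2!apply: subspZ => //.
  have x0 : x <> 0 by move=> x0; apply: nG; rewrite x0; case: (cutG_convex hB d).
  have {}x0 : 0 < doag_abs x by case: (ltgtP x 0) x0 => // x0 _; olabs.
  have [b' Bb' db'] := cutG_far hB nBd B4 nG4.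
  have [|a Aa] := hitv (subspB hB Bb' (Babs _ B4)) (subspD hB Bb' (Babs _ B4)).
    by exists d => //; rewrite in_itv/=; apply/andP; split; move: db'; olabs.
  rewrite in_itv/= => /andP[h1 h2]; exists a => //.
  have E : doag_abs (2^-1 *: (2^-1 *: x)) = 2^-1 *: (2^-1 *: doag_abs x).
    by rewrite !abs_scale.
  by rewrite E in db' h1 h2; move: x0 db' h1 h2; set z := doag_abs x; clearbody z; olabs.
move=> Be nGe.
have B4 : B (2^-1 *: (2^-1 *: e)) by do 2!apply: subspZ => //.
have [a0 Aa0 da0] := claim _ B4 (half_notin _ (half_notin _ nGe)).
have nGa0 : ~ cutG B d (d - a0).
  move=> Ga; apply: arch; split=> //; exists a0; split; first exact: hAB.
  by rewrite -opprB; apply: convexN => //; exact: cutG_convex.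
have [e1 [Be1 nG1 le1]] : exists e1, [/\ B e1, ~ cutG B d e1 &
    doag_abs e1 <= doag_abs (d - a0)].
  apply: contrapT => h; apply: nGa0; apply/(cutGP _ nBd) => b Bb nS.
  apply: doag_nle => lt; apply: h; exists b; split=> //.
  by rewrite (cutG_Stab hB nBd Bb).
have B41 : B (2^-1 *: (2^-1 *: e1)) by do 2!apply: subspZ => //.
have [a1 Aa1 da1] := claim _ B41 (half_notin _ (half_notin _ nG1)).
have E (x : M) : doag_abs (2^-1 *: (2^-1 *: x)) = 2^-1 *: (2^-1 *: doag_abs x).
  by rewrite !abs_scale.
rewrite E in da0; rewrite E in da1; clear E.
have Aal : A (doag_abs (a1 - a0)).
  by have := subspB hA Aa1 Aa0; case: (absP (a1 - a0)) => -[_ ->] //; exact: subspN.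
move: da0 da1 le1; set z := doag_abs e; set z1 := doag_abs e1; set w := doag_abs (d - a0).
move=> da0 da1 le1.
have [h1 h2] : w - doag_abs (d - a1) <= doag_abs (a1 - a0) /\
    doag_abs (a1 - a0) <= w + doag_abs (d - a1).
  by rewrite /w; split; olabs.
have [h3 h4] : d - a1 <= doag_abs (d - a1) /\ a1 - d <= doag_abs (d - a1).
  by split; olabs.
have w0 : 0 <= doag_abs (d - a1) by olabs.
move: h1 h2 h3 h4 w0 da0 da1 le1.
split.
  by exists (a1 - doag_abs (a1 - a0)); split; [exact: subspB| |]; ola.
by exists (a1 + doag_abs (a1 - a0)); split; [exact: subspD| |]; ola.
Qed.

(** When [- m] is outside the coset [s + G], [arch_A] gives a point of [A] strictly between [- m]
    and [s]. It is outside the coset too, because [s] is Archimedean, and [f] fixes it, so [- f m]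
    stays beyond it. *)
Lemma arch_aut_pos s f m : C s -> ~ B s -> archimedean B s ->
  doag_aut f -> (forall a, A a -> f a = a) -> ~ cutG B s (s + m) ->
  ~ cutG B s (s + f m) /\ (0 <= s + f m) = (0 <= s + m).
Proof.
move=> Cs nBs arch autf fA nG; have [_ _ Gc] := cutG_convex hB s.
have nGA a : A a -> ~ cutG B s (s - a).
  move=> Aa Ga; apply: arch; split=> //; exists a; split; first exact: hAB.
  by rewrite -opprB; apply: convexN => //; exact: cutG_convex.
have [e [Be nGe le]] : exists e, [/\ B e, ~ cutG B s e & doag_abs e <= doag_abs (s + m)].
  apply: contrapT => h; apply: nG; apply/(cutGP _ nBs) => b Bb nS.
  apply: doag_nle => lt; apply: h; exists b; split=> //.
  by rewrite (cutG_Stab hB nBs Bb).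
have [[a [Aa h1 h2]] [a' [Aa' h3 h4]]] := arch_A Cs nBs arch Be nGe.
have /orP[s0|s0] := doag_total 0 (s + m).
  have : - m < a by move: le h1; case: (absP (s + m)) => -[? ->]; ola.
  rewrite -(aut_lt autf) autN// (fA _ Aa) => h5.
  split; last by apply/idP/idP; ola.
  move=> Gsm; apply: (nGA _ Aa); apply: Gc Gsm _; apply: abs_le; olabs.
have sm0 : s + m <> 0.
  by move=> e0; apply: nG; rewrite e0; case: (cutG_convex hB s).
have {}s0 : s + m < 0 by case: (ltgtP (s + m) 0) sm0 s0.
have : a' < - m by move: le h4; case: (absP (s + m)) => -[? ->]; ola.
rewrite -(aut_lt autf) autN// (fA _ Aa') => h5.
split; last by apply/idP/idP; ola.
move=> Gsm; apply: (nGA _ Aa'); apply: Gc Gsm _; apply: abs_le; olabs.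
Qed.

Lemma arch_aut_cutG s f m : C s -> ~ B s -> archimedean B s ->
  doag_aut f -> (forall a, A a -> f a = a) ->
  cutG B s (s + f m) <-> cutG B s (s + m).
Proof.
move=> Cs nBs arch autf fA; split=> h; apply: contrapT => nG; last first.
  have [t ft [tf autt]] := aut_cancel autf.
  have tA a : A a -> t a = a by move=> Aa; rewrite -[in LHS](fA a Aa) ft.
  by have [] := arch_aut_pos Cs nBs arch autt tA nG; rewrite ft.
by have [] := arch_aut_pos Cs nBs arch autf fA nG.
Qed.

Section Separated.
Context {V : finType} (v : V -> M).
Hypothesis hsep : val3_separated B v.

Lemma val3_le_notin x y : ~ B x -> val3_le B x y -> ~ B y.
Proof.
move=> nBx le By; have [z z0 Gz] := cutG_nontrivial nBx.
have : cutG B y z.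
  by case: le => [[h _]|[h _]]; [exact: h|rewrite -/(Defs.val1 B y) -h].
by rewrite cutG_in// => e; move: z0; rewrite e ltxx.
Qed.

Lemma sep_scale_notin (l : V -> rat) i : l i != 0 -> ~ B (l i *: v i).
Proof. by move=> li; rewrite scale_in//; exact: hsep.1. Qed.

Lemma sep_notin (l : V -> rat) i : l i != 0 -> ~ B (lin l v).
Proof.
by move=> li; apply: val3_le_notin (sep_scale_notin li) _; exact: (hsep.2 l).1.
Qed.

Lemma sep_ge (l : V -> rat) i : l i != 0 -> cutG B (v i) `<=` cutG B (lin l v).
Proof.
move=> li; rewrite -(cutG_scale hB (v i) li); have [/(_ i) h _] := hsep.2 l.
by case: h => [[h _]|[h _]]; [exact: h|rewrite -/(Defs.val1 B (lin l v)) -h].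
Qed.

(** The sum is outside [B], so its value is not the least one and is attained by some term. That
    term shares its group with the sum and, if ramified, its ramification. *)
Lemma sep_max (l : V -> rat) i : l i != 0 -> exists j, [/\ l j != 0,
  cutG B (lin l v) = cutG B (v j) & ramified B (v j) -> ramified B (lin l v)].
Proof.
move=> li; have nBs := sep_notin li; have [ge] := hsep.2 l.
have B0 : B 0 by exact: subsp0.
case=> [/(val3_le_notin nBs)//|[j le]].
have lj : l j != 0.
  by apply/eqP => lj; move: le; rewrite lj scale0r => /(val3_le_notin nBs).
have sj := sep_ge lj; exists j; split=> //.
  apply/seteqP; split=> //; rewrite -(cutG_scale hB (v j) lj).
  by case: le => [[h _]|[h _]]; [exact: h|rewrite -/(Defs.val1 B (l j *: v j)) -h].
rewrite -(ramified_scale hB (v j) lj) => rj; case: le => [[_ nh]|[_ [//|[]//]]].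
by exfalso; apply: nh; rewrite /Defs.val1 (cutG_scale hB _ lj).
Qed.

Lemma sep_arch (l : V -> rat) i : l i != 0 -> archimedean B (v i) ->
  cutG B (v i) = cutG B (lin l v) -> archimedean B (lin l v).
Proof.
move=> li arch E; have [/(_ i) h _] := hsep.2 l.
case: h => [[_ nh]|[_ [//|[ri _ _]]]].
  by exfalso; apply: nh; rewrite /Defs.val1 (cutG_scale hB _ li) E.
by move: ri; rewrite ramified_scale.
Qed.

Lemma sep_delta (l : V -> rat) i : l i != 0 -> ramified B (lin l v) ->
  cutG B (v i) = cutG B (lin l v) -> delta_le B (l i *: v i) (lin l v).
Proof.
move=> li rs E; have [/(_ i) h _] := hsep.2 l.
case: h => [[_ nh]|[_ [//|[//]]]].
by exfalso; apply: nh; rewrite /Defs.val1 (cutG_scale hB _ li) E.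
Qed.

End Separated.

End Setting.

Lemma pos_ext (M : doagType) (V : finType) (p : set (formula M V)) l l' m m' :
  l = l' -> m = m' -> pos p l m -> pos p l' m'.
Proof. by move=> -> ->. Qed.

Lemma lin_muln (M : doagType) (V : finType) (l : V -> rat) (v : V -> M) n :
  lin (l *+ n) v = lin l v *+ n.
Proof. by elim: n => [|n IH]; rewrite ?mulr0n ?lin0// !mulrS linD IH. Qed.

Lemma pos_muln (M : doagType) (V : finType) (p : globaltype M V) l m n :
  pos (sval p) l m -> pos (sval p) (l *+ n) (m *+ n).
Proof.
move=> h; elim: n => [|n IH]; first by rewrite !mulr0n; apply/pos0.
by rewrite !mulrS; exact: posD.
Qed.

(** * Finiteness for ramified families *)

(* The preorder induced by [p] on the forms in [x - v], with [G] collapsed to [0]. *)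
Definition lower (M : doagType) (G : set M) (V : finType) (v : V -> M)
    (p : globaltype M V) (l : V -> rat) : Prop :=
  exists2 g, G g & pos (sval p) l (g - lin l v).

Section Lower.
Context {M : doagType} (G : set M) (V : finType) (v : V -> M) (p : globaltype M V).
Hypothesis hG : convex_group G.
Local Notation R := (lower G v p).

Lemma lowerD l l' : R l -> R l' -> R (l + l').
Proof.
move=> [g Gg h] [g' Gg' h']; exists (g + g'); first by case: hG => _ + _; exact.
by apply: pos_ext (posD h h') => //; rewrite linD; ola.
Qed.

Lemma lower_pos l m : G (lin l v + m) -> pos (sval p) l m -> R l.
Proof.
move=> Gm h; exists (lin l v + m) => //; apply: pos_ext h => //; ola.
Qed.

Lemma lower_total l : R l \/ R (- l).
Proof.
have G0 : G 0 by case: hG.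
case: (pos_total p l (- lin l v)) => h; [left|right]; apply: lower_pos h.
  by rewrite subrr.
by rewrite linN opprK addNr.
Qed.

Lemma lower_cone : total_cone (R : (V -> rat^o) -> Prop).
Proof. by split; [exact: lower_total|exact: lowerD]. Qed.

End Lower.

Lemma rat_neq0_sign (r : rat) : r != 0 -> 0 < r \/ 0 < - r.
Proof. by rewrite oppr_gt0; case: (ltgtP r 0) => // h _; [right|left]. Qed.

Lemma cone_line (E : lmodType rat) (P : E -> Prop) (k : rat) (x : E) :
  total_cone P -> k != 0 -> P x -> P (- x) -> P (k *: x) /\ P (- (k *: x)).
Proof.
move=> coneP /rat_neq0_sign[k0|k0] Px PNx.
  by rewrite -scalerN; split; apply/(cone_scaleE coneP).
have -> : k *: x = (- k) *: (- x) by rewrite scaleNr scalerN opprK.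
by rewrite -scalerN opprK; split; apply/(cone_scaleE coneP).
Qed.

Lemma cone_line_inv (E : lmodType rat) (P : E -> Prop) (k : rat) (x : E) :
  total_cone P -> k != 0 -> P (k *: x) -> P (- (k *: x)) -> P x /\ P (- x).
Proof.
move=> coneP k0 h1 h2; have k0' : k^-1 != 0 by rewrite invr_eq0.
by have := cone_line coneP k0' h1 h2; rewrite scalerA mulVf// scale1r.
Qed.

Definition fdelta (V : finType) (i : V) : V -> rat := fun j => (i == j)%:R.

Lemma fdelta_sum (V : finType) (l : V -> rat) :
  l = \sum_i (l i *: (fdelta i : V -> rat^o)) :> (V -> rat^o).
Proof.
apply/funext => j; rewrite fct_sumE (bigD1 j)//= big1 ?addr0.
  by rewrite /fdelta [RHS](_ : _ = l j * (j == j)%:R)// eqxx mulr1.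
by move=> i /negPf ij; rewrite [LHS](_ : _ = l i * (i == j)%:R)// ij mulr0.
Qed.

Lemma lin_fdelta (M : doagType) (V : finType) (v : V -> M) r i :
  lin (r *: (fdelta i : V -> rat^o)) v = r *: v i.
Proof.
rewrite /lin (bigD1 i)//= big1 ?addr0.
  by rewrite [X in X *: _](_ : _ = r * (i == i)%:R)// eqxx mulr1.
move=> j /negPf ij; rewrite [X in X *: _](_ : _ = r * (i == j)%:R)//.
by rewrite eq_sym ij mulr0 scale0r.
Qed.

Lemma fun_neq0 (V : Type) (l : V -> rat) : l <> 0 -> exists i, l i != 0.
Proof.
move=> l0; apply: contrapT => h; apply: l0; apply/funext => i.
by apply/eqP; apply: contrapT => /negP li; apply: h; exists i.
Qed.

Section Setting.
Context {M : doagType} (A B C : set M).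
Hypotheses (hA : rat_subspace A) (hB : rat_subspace B) (hC : rat_subspace C).
Hypotheses (hAB : A `<=` B) (hAC : A `<=` C).
Hypothesis hsat : succ_saturated (B `|` C).
Hypothesis hhom : succ_strongly_homogeneous (B `|` C).
Hypothesis hitv : forall b1 b2 : M, B b1 -> B b2 ->
  (exists2 x, C x & x \in `[b1, b2]) -> exists2 a, A a & a \in `[b1, b2].

Lemma sep_block (V : finType) (v : V -> M) (G : set M) (l : V -> rat) :
  val3_separated B v -> (forall i, cutG B (v i) = G) -> l <> 0 ->
  [/\ ~ B (lin l v), cutG B (lin l v) = G &
      (forall i, ramified B (v i)) -> ramified B (lin l v)].
Proof.
move=> hsep vG /fun_neq0[i li]; have nBs := sep_notin hB hsat hsep li.
have [j [lj -> rj]] := sep_max hB hsat hsep li.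
by split=> // h; exact: rj.
Qed.

Section Ramified.
Context {V : finType} (d : V -> M) (G : set M).
Hypothesis hsep : val3_separated B d.
Hypothesis dC : forall i, C (d i).
Hypothesis dG : forall i, cutG B (d i) = G.
Hypothesis dram : forall i, ramified B (d i).
Hypothesis hG : convex_group G.

(** Here [b] is a point of [B] to the left of [s] in the coset [s + G]. The left end of the cut lies
    between [b] and [s], hence in the coset. By [cutG_near] no point of [B] in the coset exceeds
    [s], so the right end lies beyond the whole coset. *)
Lemma ram_side (q : globaltype M V) l b : inv_ext A B d q -> l <> 0 ->
  B b -> G (lin l d - b) -> 0 <= lin l d - b ->
  pos (sval q) l (- lin l d) <-> ~ (lower G d q l /\ lower G d q (- l)).
Proof.
move=> qinv l0 Bb Gsb sb; have [nBs sG _] := sep_block hsep dG l0.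
have Cs : C (lin l d) by exact: subsp_lin.
set s := lin l d in nBs sG Cs Gsb sb *; have [_ GD Gc] := hG.
split=> [ps [_ [g Gg pg]]|nW].
  have scut : same_cut B s (s + doag_abs g).
    apply: contrapT => /(not_same_cut nBs)[] [b' [Bb' h1 h2]]; first by olabs.
    have Gb' : G (b' - b).
      rewrite (_ : b' - b = (b' - s) + (s - b)); last by ola.
      by apply: GD => //; apply: Gc Gg _; olabs.
    rewrite -sG in Gb'.
    by have := cutG_near hB nBs (subspB hB Bb' Bb) Gb' Bb; olabs.
  have scut0 : same_cut B s s by [].
  move: ps => /(pos_same_cut hA hAB hhom qinv Cs nBs scut0 scut).
  move=> /(pos_strict hA hB hC hAB hsat hhom qinv Cs nBs scut); apply.
  by apply: pos_mono pg; rewrite linN -/s; olabs.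
apply: contrapT => /pos_not nps; apply: nW; split.
  apply: (@lower_pos _ _ _ _ _ _ (- b)) => //.
  by apply/(pos_B hB qinv); [exact: subspN|].
by apply: lower_pos nps; rewrite linN -/s opprK addNr; case: hG.
Qed.

(** An invariant extension only chooses an end of each cut. By [ram_side] the end is known from
    whether the form stays in the coset, after replacing [l] by [- l] if the point of [B] in the
    coset lies on the right. *)
Lemma ram_type_eq (q q' : globaltype M V) : inv_ext A B d q -> inv_ext A B d q' ->
  (forall l, (lower G d q l /\ lower G d q (- l)) <->
             (lower G d q' l /\ lower G d q' (- l))) -> q = q'.
Proof.
move=> qinv qinv' W; apply: globaltype_ext => l m.
have [->|/eqP l0] := eqVneq l 0; first by rewrite !pos0.
have [nBs sG ram] := sep_block hsep dG l0.
have Cs : C (lin l d) by exact: subsp_lin.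
have [sm|nsm] := pselect (same_cut B (lin l d) (- m)); last first.
  by rewrite !(pos_off_cut hB _ nBs nsm); [|case: qinv'|case: qinv].
have scut0 : same_cut B (lin l d) (lin l d) by [].
have E (p : globaltype M V) : inv_ext A B d p ->
    pos (sval p) l m <-> pos (sval p) l (- lin l d).
  move=> pinv; rewrite -{1}[m]opprK.
  exact: (pos_same_cut hA hAB hhom pinv Cs nBs sm scut0).
rewrite !E//; have [_ [b [Bb Gb]]] := ram dram; rewrite sG in Gb.
have {}Gb : G (lin l d - b) by rewrite -opprB; exact: convexN.
have /orP[sb|sb] := doag_total 0 (lin l d - b).
  by rewrite !(ram_side _ l0 Bb Gb sb)// W.
have l0' : - l <> 0 by move=> e; apply: l0; rewrite -[l]opprK e oppr0.
have Gb' : G (lin (- l) d - (- b)).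
  by rewrite linN -opprD; exact: convexN.
have sb' : 0 <= lin (- l) d - (- b) by rewrite linN; ola.
have Bb' : B (- b) by exact: subspN.
have flip (p : globaltype M V) : inv_ext A B d p ->
    pos (sval p) l (- lin l d) <-> ~ pos (sval p) (- l) (lin l d).
  move=> pinv; split=> [|/pos_not]; last by rewrite opprK.
  exact: (pos_strict hA hB hC hAB hsat hhom pinv Cs nBs scut0).
have E2 : lin l d = - lin (- l) d by rewrite linN opprK.
rewrite !flip// E2 !(ram_side _ l0' Bb' Gb' sb')// !opprK.
by have := W l; tauto.
Qed.

(** Separation bounds each term, up to translation by [B], by [n] times the sum. The inequality has
    constants in [B], so it passes to the extension: if the sum stays within [G], so does each
    term. *)
Lemma lower_fdelta (q : globaltype M V) l i : inv_ext A B d q -> l i != 0 ->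
  lower G d q l -> lower G d q (- l) ->
  lower G d q (fdelta i) /\ lower G d q (- fdelta i).
Proof.
move=> qinv li Wl Wl'; have l0 : l <> 0 by move=> e; rewrite e eqxx in li.
have [nBs sG ram] := sep_block hsep dG l0; have [G0 GD Gc] := hG.
have := sep_delta hB hsep li (ram dram); rewrite dG sG => /(_ erefl).
move=> [b [b' [[Bb Gb] [Bb' Gb'] [n le]]]].
rewrite (cutG_scale hB _ li) dG in Gb; rewrite sG in Gb'.
pose f : V -> rat^o := l i *: (fdelta i : V -> rat^o).
have fE : lin f d = l i *: d i by rewrite lin_fdelta.
suff [Wf Wf'] : lower G d q f /\ lower G d q (- f).
  have coneR := lower_cone d q hG.
  exact: (cone_line_inv coneR li Wf Wf').
have key (k : V -> rat) (c : M) : B c -> G (lin k d - c) -> 0 <= lin k d - c ->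
    doag_abs (l i *: d i - b) <= (lin k d - c) *+ n -> lower G d q (- k) ->
    forall f', f' = f \/ f' = - f -> lower G d q f'.
  move=> Bc Gc' c0 len [g Gg pg] f' f'E.
  have [e [Be Ge lef]] : exists e, [/\ B e, G (lin f' d - e) &
      0 <= (lin k d - c) *+ n + (lin f' d - e)].
    case: f'E => ->; [exists b|exists (- b)]; split.
    - by [].
    - by rewrite fE -opprB; exact: convexN.
    - by rewrite fE; move: len; move: (_ *+ _) => z; olabs.
    - exact: subspN.
    - by rewrite linN fE opprK addrC.
    - by rewrite linN fE; move: len; move: (_ *+ _) => z; olabs.
  (* True at [d] with constants in [B], hence true in [q]. Adding [n] times the bound on [- k]
     removes [k] and leaves a lower bound on [f']. *)
  have h1 : pos (sval q) (k *+ n + f') (- (c *+ n) - e).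
    apply/(pos_B hB qinv).
      by apply: subspB => //; rewrite -mulNrn -scaler_nat; apply: subspZ => //; exact: subspN.
    rewrite linD lin_muln; move: lef; rewrite mulrnBl.
    by move: (lin k d *+ n) (c *+ n) => z z'; ola.
  have := posD h1 (pos_muln n pg); rewrite mulNrn addrAC subrr add0r => h2.
  apply: lower_pos h2; rewrite linN opprK mulrnDl.
  rewrite (_ : _ + _ = (lin k d - c) *+ n + (lin f' d - e) + g *+ n).
    by apply: (GD); [apply: (GD) => //|]; exact: convex_muln.
  rewrite mulrnBl; move: (lin k d *+ n) (c *+ n) (g *+ n) => z z' z''; ola.
have /orP[sb|sb] := doag_total 0 (lin l d - b').
  have Gb2 : G (lin l d - b') by rewrite -opprB; exact: convexN.
  have le' : doag_abs (l i *: d i - b) <= (lin l d - b') *+ n.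
    move: le; case: (absP (lin l d - b')) => -[z ->]//.
    by rewrite (_ : lin l d - b' = 0) ?oppr0//; ola.
  have h := key l b' Bb' Gb2 sb le' Wl'.
  by split; apply: h; [left|right].
have h := key (- l) (- b') (subspN hB Bb').
rewrite opprK linN opprK in h.
have sb' : 0 <= - lin l d + b' by ola.
have Gb2 : G (- lin l d + b') by rewrite addrC.
have le' : doag_abs (l i *: d i - b) <= (- lin l d + b') *+ n.
  move: le; case: (absP (lin l d - b')) => -[z ->]; last by rewrite opprD opprK.
  have -> : lin l d - b' = 0 by ola.
  by have -> : - lin l d + b' = 0 by ola.
by split; apply: h => //; [left|right].
Qed.

Lemma finite_ram_ext : finite_set (inv_ext A B d).
Proof.
(* [F] records the coordinates kept within [G]. By [lower_fdelta] they span all the forms kept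
   within [G], and these determine [q] by [ram_type_eq]. *)
pose F (q : globaltype M V) : {ffun V -> bool} :=
  [ffun i => `[< lower G d q (fdelta i) /\ lower G d q (- fdelta i) >]].
have Finj : {in inv_ext A B d &, injective F}.
  move=> q q' /set_mem qi /set_mem qi' FF; apply: ram_type_eq => // l.
  have key (p p' : globaltype M V) : inv_ext A B d p -> inv_ext A B d p' -> F p = F p' ->
      lower G d p l /\ lower G d p (- l) -> lower G d p' l /\ lower G d p' (- l).
    move=> pinv pinv' FE [h1 h2]; pose W (k : V -> rat^o) := lower G d p' k /\ lower G d p' (- k).
    have coneR := lower_cone d p' hG.
    suff : W l by [].
    rewrite [l]fdelta_sum; apply: (big_ind W) => [|x y [x1 x2] [y1 y2]|i _].
    - by split; rewrite ?oppr0; exact: (cone0 coneR).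
    - by split; rewrite ?opprD; exact: lowerD.
    - have [->|li] := eqVneq (l i) 0.
        by rewrite scale0r; split; rewrite ?oppr0; exact: (cone0 coneR).
      have := lower_fdelta pinv li h1 h2 => h.
      have : F p i by rewrite ffunE; apply/asboolP.
      rewrite FE ffunE => /asboolP[d1 d2].
      exact: (cone_line coneR li d1 d2).
  by split; apply: key.
by rewrite -(eq_finite_set (inj_card_eq Finj)); exact: finite_finset.
Qed.

End Ramified.
End Setting.

(** * Extensions over a type of the ramified part *)

Lemma lpush_val (V : finType) (J : set V) (l : V -> rat) :
  (forall i, l i != 0 -> J i) -> lpush val (fun j : J => l (val j)) = l.
Proof.
move=> lJ; apply/funext => i; rewrite /lpush.
have [li|/lJ Ji] := eqVneq (l i) 0.
  by rewrite li big1// => j /eqP ->.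
by rewrite (big_pred1 (SigSub (mem_set Ji))).
Qed.

Lemma lpushN (V W : finType) (f : W -> V) (l : W -> rat) :
  lpush f (- l) = - lpush f l.
Proof. by apply/funext => i; exact: sumrN. Qed.

Lemma lpush_eq0 (V : finType) (J : set V) (l : J -> rat) i : ~ J i -> lpush val l i = 0.
Proof.
move=> nJi; rewrite /lpush big1// => j /eqP ji; case: nJi; rewrite -ji.
by have := set_valP j.
Qed.

Lemma lpush_valE (V : finType) (J : set V) (l : J -> rat) (j : J) :
  lpush val l (val j) = l j.
Proof.
by rewrite /lpush (big_pred1 j).
Qed.

Lemma near_val (T : topologicalType) (S : set T) (x : S) (Q : T -> Prop) :
  (\forall y \near val x, Q y) -> \forall y \near x, Q (val y).
Proof. by move=> h; exact: (@initial_continuous S T set_val x). Qed.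

Lemma near_all (T : topologicalType) (x : T) (Q : T -> Prop) :
  (forall y, Q y) -> \forall y \near x, Q y.
Proof. by move=> h; exact: nearW. Qed.

Lemma val_continuous_in (T U : topologicalType) (S : set T) (f : U -> S) :
  continuous (fun x => val (f x)) -> continuous f.
Proof.
by move=> fc x; apply/continuous_comp_initial.
Qed.

(** The correspondence is given as a relation because its values are only known to exist. Continuity
    is therefore required of every function that selects such values. *)
Lemma homeomorphic_rel (T U : topologicalType) (S : set T) (Z : set U)
    (Q : T -> U -> Prop) :
  (forall p, S p -> exists2 r, Z r & Q p r) ->
  (forall r, Z r -> exists2 p, S p & Q p r) ->
  (forall p r r', Z r -> Z r' -> Q p r -> Q p r' -> r = r') ->
  (forall p p' r, S p -> S p' -> Q p r -> Q p' r -> p = p') ->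
  (forall f : S -> U, (forall p, Z (f p) /\ Q (val p) (f p)) -> continuous f) ->
  (forall g : Z -> T, (forall r, S (g r) /\ Q (g r) (val r)) -> continuous g) ->
  homeomorphic S Z.
Proof.
move=> hf hg uf ug cf cg.
have SP (p : S) : S (val p) by exact: set_valP.
have ZP (r : Z) : Z (val r) by exact: set_valP.
have hf' (p : S) : exists r, Z r /\ Q (val p) r.
  by have [r Zr Qr] := hf _ (SP p); exists r.
have hg' (r : Z) : exists p, S p /\ Q p (val r).
  by have [p Sp Qp] := hg _ (ZP r); exists p.
have [f fP] := choice hf'; have [g gP] := choice hg'.
pose F (p : S) : Z := SigSub (mem_set (fP p).1).
pose G (r : Z) : S := SigSub (mem_set (gP r).1).
exists F; split; first by apply: val_continuous_in; exact: cf fP.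
exists G; split; first by apply: val_continuous_in; exact: cg gP.
- move=> p; apply: val_inj; apply: (ug _ _ (f p)); [exact: (gP _).1|exact: SP| |exact: (fP p).2].
  exact: (gP (F p)).2.
- move=> r; apply: val_inj; apply: (uf (g r)); [exact: (fP _).1|exact: ZP| |exact: (gP r).2].
  exact: (fP (G r)).2.
Qed.

Section Setting.
Context {M : doagType} (A B C : set M).
Hypotheses (hA : rat_subspace A) (hB : rat_subspace B) (hC : rat_subspace C).
Hypotheses (hAB : A `<=` B) (hAC : A `<=` C).
Hypothesis hsat : succ_saturated (B `|` C).
Hypothesis hhom : succ_strongly_homogeneous (B `|` C).
Hypothesis hitv : forall b1 b2 : M, B b1 -> B b2 ->
  (exists2 x, C x & x \in `[b1, b2]) -> exists2 a, A a & a \in `[b1, b2].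

Section Over.
Context {V : finType} (v : V -> M) (G : set M).
Hypothesis hsep : val3_separated B v.
Hypothesis vC : forall i, C (v i).
Hypothesis vG : forall i, cutG B (v i) = G.
Hypothesis hG : convex_group G.
Variable q : globaltype M (ram B v).
Hypothesis qF : ram_ext A B v q.

Let w : ram B v -> M := ram_tuple B v.
Let supported (l : V -> rat) := forall i, l i != 0 -> ramified B (v i).
Let rst (l : V -> rat) : ram B v -> rat := fun j => l (val j).

Let supportedE l : supported l -> l = lpush val (rst l).
Proof. by move=> h; rewrite [RHS]lpush_val. Qed.

Let rst_push (k : ram B v -> rat) : rst (lpush val k) = k.
Proof. by apply/funext => j; rewrite /rst lpush_valE. Qed.

Let lin_rst (k : ram B v -> rat) : lin (lpush val k) v = lin k w.
Proof. by rewrite lin_push. Qed.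

(** In a block, an Archimedean term has the greatest possible value, so it forces the sum to be
    Archimedean. *)
Let unsupported l : ~ supported l ->
  [/\ ~ B (lin l v), cutG B (lin l v) = G & archimedean B (lin l v)].
Proof.
move=> nsup; have [i li arch] : exists2 i, l i != 0 & archimedean B (v i).
  apply: contrapT => h; apply: nsup => i li; apply: contrapT => nr.
  by apply: h; exists i.
have l0 : l <> 0 by move=> e; rewrite e eqxx in li.
have [nBs sG _] := sep_block hB hsat hsep vG l0.
by split=> //; apply: (sep_arch hB hsep li arch); rewrite vG.
Qed.

Let supportedN l : supported (- l) -> supported l.
Proof. by move=> h i li; apply: h; rewrite oppr_eq0. Qed.

(* The order types of the tuples [x - v], with [G] collapsed to [0], for the
   extensions [x] of [q]. *)
Definition gen_types : set (typespace [set (0 : M)] V) :=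
  [set r | (forall k : ram B v -> rat, pos (sval r) (lpush val k) 0 <-> lower G w q k) /\
    forall l, ~ supported l -> ~ (pos (sval r) l 0 /\ pos (sval r) (- l) 0)].

(** Every condition involves one or two signs, hence is clopen. *)
Lemma gen_types_closed : closed gen_types.
Proof.
have hD := @rat_subspace1 M.
have -> : gen_types =
    (\bigcap_(k : ram B v -> rat) [set r : typespace [set (0 : M)] V |
       pos (sval r) (lpush val k) 0 <-> lower G w q k]) `&`
    (\bigcap_(l in [set l | ~ supported l]) [set r : typespace [set (0 : M)] V |
       ~ (pos (sval r) l 0 /\ pos (sval r) (- l) 0)]).
  apply/seteqP; split=> r [h1 h2]; split=> [k|l].
  - by move=> _; exact: h1.
  - exact: h2.
  - exact: h1.
  - exact: h2.
have clopen (Q : typespace [set (0 : M)] V -> Prop) (L : seq (V -> rat)) :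
    (forall r r' : typespace [set (0 : M)] V, (forall l, List.In l L ->
      pos (sval r) l 0 <-> pos (sval r') l 0) -> Q r -> Q r') -> closed [set r | Q r].
  move=> QP; rewrite -[[set _ | _]]setCK; apply: open_closedC.
  rewrite openE => r nQ; rewrite /interior.
  have := near_In (x := r) (L := L) (Q := fun l r' => pos (sval r') l 0 <-> pos (sval r) l 0)
     (fun l _ => near_pos r l hD erefl).
  by apply: filterS => r' rr' Q'; apply: nQ; exact: QP rr' Q'.
apply: closedI; apply: closed_bigI => l _.
  apply: (clopen _ [:: lpush val l]) => r r' rr' <-.
  by symmetry; apply: rr'; left.
apply: (clopen _ [:: l; - l]) => r r' rr'.
by rewrite (rr' l (or_introl erefl)) (rr' (- l) (or_intror (or_introl erefl))).
Qed.

Section Glue.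
Variable r : typespace [set (0 : M)] V.
Hypothesis rZ : gen_types r.
Local Notation R l := (pos (sval r) l 0).

(* The lexicographic combination of the order of [M] modulo [G], of [r], and of [q]. *)
Definition glue (l : V -> rat) (m : M) : Prop :=
  (~ G (lin l v + m) /\ 0 <= lin l v + m) \/
  [/\ G (lin l v + m), R l & R (- l) -> pos (sval q) (rst l) m].

Let Rtot l : R l \/ R (- l).
Proof.
have [h _ _] := affine_cone_pos r (@rat_subspace1 M).
by have := h l 0 erefl; rewrite oppr0.
Qed.

Let RD l l' : R l -> R l' -> R (l + l').
Proof.
have [_ h _] := affine_cone_pos r (@rat_subspace1 M).
by move=> h1 h2; have := h l 0 l' 0 erefl erefl h1 h2; rewrite addr0.
Qed.

Let R0 : R 0.
Proof. by have [_ _ ->] := affine_cone_pos r (@rat_subspace1 M). Qed.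

Lemma glue_cone : affine_cone [set: M] glue.
Proof.
have [G0 GD Gc] := hG; split=> [l m _|l m l' m' _ _|m _].
- have E : lin (- l) v + - m = - (lin l v + m) by rewrite linN opprD.
  have [Gm|nGm] := pselect (G (lin l v + m)); last first.
    have nGm' : ~ G (lin (- l) v + - m).
      by rewrite E => /(convexN hG); rewrite opprK.
    by have /orP[s0|s0] := doag_total 0 (lin l v + m); [left|right]; left; split=> //; ola.
  have Gm' : G (lin (- l) v + - m) by rewrite E; exact: convexN.
  have rstN : rst (- l) = - rst l by [].
  have [h|h] := pselect (R l /\ (R (- l) -> pos (sval q) (rst l) m)).
    by left; right; split=> //; case: h.
  right; right; split=> //.
    by case: (Rtot l) => // Rl; apply: contrapT => nRl; apply: h.
  rewrite opprK rstN => Rl; apply: pos_not => qm; apply: h.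
  by split.
- have E : lin (l + l') v + (m + m') = (lin l v + m) + (lin l' v + m').
    by rewrite linD addrACA.
  rewrite /glue E; set x := lin l v + m; set y := lin l' v + m'.
  move=> [[nx x0]|[Gx Rx qx]] [[ny y0]|[Gy Ry qy]].
  + left; split; last by ola.
    by move=> /Gc h; apply: nx; apply: h; olabs.
  + left; split.
      by move=> Gxy; apply: nx; rewrite -[x](addrK y); exact: convexB.
    by apply: doag_le_contra => lt; apply: nx; apply: Gc Gy _; olabs.
  + left; split.
      by move=> Gxy; apply: ny; rewrite -[y](addKr x) addrC; exact: convexB.
    by apply: doag_le_contra => lt; apply: ny; apply: Gc Gx _; olabs.
  (* If the sum is a tie for [r], then so are both summands, by subtracting one from the other;
     hence the two conditions on [q] apply and add up. *)
  + right; split; [exact: GD|exact: RD|] => RN.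
    apply: posD; [apply: qx|apply: qy].
      by have := RD RN Ry; rewrite opprD addrNK.
    by have := RD RN Rx; rewrite opprD addrAC addNr add0r.
- rewrite /glue lin0 add0r oppr0; have rst0 : rst 0 = 0 by [].
  rewrite rst0; split=> [[[]//|[_ _ h]]|m0]; first exact/(pos0 q)/h/R0.
  have [Gm|nGm] := pselect (G m); [right|left]; split=> //.
  by move=> _; exact/pos0.
Qed.

Lemma glue_restrict (k : ram B v -> rat) m : glue (lpush val k) m <-> pos (sval q) k m.
Proof.
have [G0 GD Gc] := hG; have [q1 q2] := qF.
rewrite /glue lin_rst rst_push.
have RE : R (lpush val k) <-> lower G w q k by exact: rZ.1.
have REN : R (- lpush val k) <-> lower G w q (- k) by rewrite -lpushN; exact: rZ.1.
have [Gm|nGm] := pselect (G (lin k w + m)).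
  split=> [[[]//|[_ _ h]]|h]; last first.
    by right; split=> //; apply/RE; exact: lower_pos h.
  apply: contrapT => nq; apply: (nq); apply: h; apply/REN.
  apply: (@lower_pos _ _ _ _ _ _ (- m)); last exact: pos_not.
  by rewrite linN -opprD; exact: convexN.
have far : pos (sval q) k m <-> 0 <= lin k w + m.
  have [->|/eqP k0] := eqVneq k 0; first by rewrite lin0 add0r pos0.
  have k0' : lpush val k <> 0.
    by move=> e; apply: k0; rewrite -[k]rst_push e.
  have [nBs sG _] := sep_block hB hsat hsep vG k0'.
  rewrite lin_rst in nBs sG.
  by apply: (pos_far hB q2 nBs); rewrite sG.
by split=> [[[_ /far]|[]]//|/far h]; left.
Qed.

Lemma glue_unsupported l m : ~ supported l ->
  glue l m <-> if `[< G (lin l v + m) >] then R l else 0 <= lin l v + m.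
Proof.
move=> nsup; have h := rZ.2 _ nsup; rewrite /glue.
case: asboolP => Gm; split; [by case=> [[]|[]]| |by case=> [[]|[]]|by left].
by move=> Rl; right; split=> // RNl; case: h.
Qed.

(** Supported forms inherit invariance from [q]. For the others, an automorphism over [A] preserves
    the coset and its two sides, and inside the coset the sign does not depend on [m]. *)
Lemma glue_type : exists2 p : globaltype M V, inv_ext_over A B v q p &
  forall l m, pos (sval p) l m <-> glue l m.
Proof.
have [p pP] := cone_globaltype glue_cone; exists p => //; split; last first.
  apply: globaltype_ext => k m.
  by rewrite pos_restrict// pP glue_restrict.
have [/aut_invariantP qinv qB] := qF.
split.
  apply/aut_invariantP => f autf fA l m; rewrite !pP.
  have [sup|nsup] := pselect (supported l).
    by rewrite (supportedE sup) !glue_restrict; exact: qinv.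
  have [nBs sG arch] := unsupported nsup; have Cs : C (lin l v) by exact: subsp_lin.
  rewrite !glue_unsupported//.
  have h1 := arch_aut_cutG hA hB hAB hitv m Cs nBs arch autf fA.
  rewrite sG in h1; rewrite (asbool_equiv_eq h1); case: asboolP => // nG.
  rewrite -sG in nG.
  by have [_ ->] := arch_aut_pos hA hB hAB hitv Cs nBs arch autf fA nG.
apply/(tp_sub v p hB (@subsetT _ _)) => l b Bb; rewrite pP.
have [sup|nsup] := pselect (supported l).
  rewrite (supportedE sup) glue_restrict lin_rst.
  exact: (tp_sub w q hB (@subsetT _ _)).1.
have [nBs sG arch] := unsupported nsup; rewrite glue_unsupported//.
rewrite asboolF// -sG => Gb; apply: arch; split=> //; exists (- b); split.
  exact: subspN.
rewrite (_ : - b - lin l v = - (lin l v + b)); last by ola.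
by apply: convexN => //; exact: cutG_convex.
Qed.

End Glue.

Let lower_restrict p (k : ram B v -> rat) : inv_ext_over A B v q p ->
  lower G v p (lpush val k) <-> lower G w q k.
Proof.
move=> [_ pq]; split=> -[g Gg h]; exists g => //.
  by rewrite -pq pos_restrict// -lin_rst.
by move: h; rewrite -pq pos_restrict// lin_rst.
Qed.

(** The coset is contained in a single cut, so by [pos_same_cut] the sign is the same at all its
    points. *)
Let lower_unsupported p l m : inv_ext_over A B v q p -> ~ supported l ->
  G (lin l v + m) -> lower G v p l <-> pos (sval p) l m.
Proof.
move=> [pinv _] nsup Gm; have [nBs sG arch] := unsupported nsup.
have Cs : C (lin l v) by exact: subsp_lin.
split=> [[g Gg h]|]; last exact: lower_pos.
have cut x : G x -> same_cut B (lin l v) (- (x - lin l v)).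
  move=> Gx; apply: archimedean_same_cut => //.
  by rewrite sG opprB addrAC subrr add0r; exact: convexN.
have := pos_same_cut hA hAB hhom pinv Cs nBs (cut g Gg) (cut _ Gm).
rewrite !opprK => -[/(_ h) + _]; apply: pos_ext => //; ola.
Qed.

Let lower_strict p l : inv_ext_over A B v q p -> ~ supported l ->
  ~ (lower G v p l /\ lower G v p (- l)).
Proof.
move=> pS nsup; have nsup' : ~ supported (- l) by move/supportedN.
have [nBs sG arch] := unsupported nsup; have [G0 _ _] := hG.
have Cs : C (lin l v) by exact: subsp_lin.
rewrite (@lower_unsupported p l (- lin l v) pS)//; last by rewrite subrr.
rewrite (@lower_unsupported p (- l) (lin l v) pS)//; last by rewrite linN addNr.
move=> [h1]; apply: (pos_strict hA hB hC hAB hsat hhom pS.1 Cs nBs _ h1).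
by [].
Qed.

Lemma inv_ext_over_homeo : homeomorphic (inv_ext_over A B v q) gen_types.
Proof.
have [G0 GD Gc] := hG; have hD := @rat_subspace1 M.
have nsupN l : ~ supported l -> ~ supported (- l) by move=> h /supportedN.
(* The relation says that [r] is the order induced by [p] once [G] is collapsed to [0]. *)
apply: (@homeomorphic_rel (globaltype M V) (typespace [set (0 : M)] V) _ _
  (fun p r => forall l, pos (sval r) l 0 <-> lower G v p l)).
- move=> p pS; have [|r rP] := @cone_type1 M V (fun l _ => lower G v p l).
    split=> [l m _|l m l' m' _ _|m /= ->]; [exact: lower_total|exact: lowerD|].
    by rewrite lexx; split=> // _; exists 0 => //; rewrite lin0 subr0; apply/pos0.
  exists r => //; split=> [k|l nsup]; rewrite !rP; first exact: lower_restrict.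
  exact: lower_strict.
- move=> r rZ; have [p pS pP] := glue_type rZ; exists p => // l.
  have [sup|nsup] := pselect (supported l).
    by rewrite (supportedE sup) rZ.1 lower_restrict.
  rewrite (@lower_unsupported p l (- lin l v) pS)// ?subrr// pP glue_unsupported//.
  by rewrite subrr asboolT.
- move=> p r r' _ _ h h'; apply: type_ext => // l m /= ->.
  by rewrite h h'.
- move=> p p' r pS pS' h h'; apply: globaltype_ext => l m.
  have [sup|nsup] := pselect (supported l).
    have [_ pq] := pS; have [_ pq'] := pS'.
    by rewrite (supportedE sup) -!pos_restrict// pq pq'.
  have [nBs sG arch] := unsupported nsup.
  have [Gm|nGm] := pselect (G (lin l v + m)).
    rewrite -(lower_unsupported pS nsup Gm) -(lower_unsupported pS' nsup Gm).
    by rewrite -h -h'.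
  rewrite (pos_far hB pS.1.2 nBs) ?sG//.
  by rewrite (pos_far hB pS'.1.2 nBs) ?sG.
(* The signs of supported forms are constant, being dictated by [q]. For the other forms, the sign
   in [r] is the sign in [p] at a chosen point of the coset. *)
- move=> f fP; apply: (type_continuous hD) => l m x /= ->.
  have [sup|nsup] := pselect (supported l).
    apply: near_all => y; rewrite !(fP _).2 (supportedE sup).
    by rewrite !lower_restrict//; exact: set_valP.
  have E (y : inv_ext_over A B v q) :
      lower G v (val y) l <-> pos (sval (val y)) l (- lin l v).
    by apply: lower_unsupported; [exact: set_valP|by []|rewrite subrr].
  have := near_val (near_pos (val x) l (m := - lin l v) rat_subspaceT I).
  by apply: filterS => y yx; rewrite !(fP _).2 !E.
- move=> g gP; apply: (type_continuous rat_subspaceT) => l m x _.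
  have [sup|nsup] := pselect (supported l).
    apply: near_all => y; rewrite (supportedE sup) -!pos_restrict//.
    by have [_ ->] := (gP x).1; have [_ ->] := (gP y).1.
  have [nBs sG arch] := unsupported nsup.
  have [Gm|nGm] := pselect (G (lin l v + m)).
    have := near_val (near_pos (val x) l hD erefl).
    apply: filterS => y yx.
    rewrite -(lower_unsupported (gP x).1 nsup Gm) -(lower_unsupported (gP y).1 nsup Gm).
    by rewrite -(gP x).2 -(gP y).2.
  apply: near_all => y; rewrite (pos_far hB (gP y).1.1.2 nBs) ?sG//.
  by rewrite (pos_far hB (gP x).1.1.2 nBs) ?sG.
Qed.

End Over.
End Setting.

(** * Coproducts and products *)

Lemma prod_proj_continuous (I : Type) (K : I -> topologicalType) (i : I) :
  continuous (fun f : prod_topology K => f i).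
Proof.
move=> f; have /cvg_sup/(_ i) h : f --> f by exact: cvg_id.
move=> U nU; apply: h.
exact: (@initial_continuous _ _ (fun f : (forall i, K i) => f i) f U nU).
Qed.

Lemma prod_continuous (I : Type) (K : I -> topologicalType) (T : topologicalType)
    (f : T -> prod_topology K) :
  (forall i, continuous (fun x => f x i)) -> continuous f.
Proof.
move=> fc x; apply/cvg_sup => i.
exact: (@continuous_comp_initial _ T (K i) (fun f : (forall i, K i) => f i) f (fc i) x).
Qed.

Lemma homeomorphic_sym (T U : topologicalType) : homeomorphic T U -> homeomorphic U T.
Proof. by move=> [f [fc [g [gc fg gf]]]]; exists g; split=> //; exists f. Qed.

Lemma homeomorphic_trans (T U W : topologicalType) :
  homeomorphic T U -> homeomorphic U W -> homeomorphic T W.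
Proof.
move=> [f [fc [f' [fc' ff' f'f]]]] [g [gc [g' [gc' gg' g'g]]]].
exists (g \o f); split; first by move=> x; apply: continuous_comp; [exact: fc|exact: gc].
exists (f' \o g'); split; first by move=> x; apply: continuous_comp; [exact: gc'|exact: fc'].
- by move=> x /=; rewrite gg' ff'.
- by move=> x /=; rewrite f'f g'g.
Qed.

Lemma homeomorphic_prod (I : Type) (X Y : I -> topologicalType) :
  (forall i, homeomorphic (X i) (Y i)) ->
  homeomorphic (prod_topology X) (prod_topology Y).
Proof.
move=> XY; have h i : {fg : (X i -> Y i) * (Y i -> X i) |
    [/\ continuous fg.1, continuous fg.2, cancel fg.1 fg.2 & cancel fg.2 fg.1]}.
  by apply: cid; have [f [fc [g [gc fg gf]]]] := XY i; exists (f, g).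
exists (fun x i => (sval (h i)).1 (x i)); split.
  apply: prod_continuous => i x.
  apply: (@continuous_comp (prod_topology X) (X i) (Y i) (fun x => x i)).
    exact: prod_proj_continuous.
  by have [+ _ _ _] := svalP (h i); apply.
exists (fun y i => (sval (h i)).2 (y i)); split.
- apply: prod_continuous => i x.
  apply: (@continuous_comp (prod_topology Y) (Y i) (X i) (fun x => x i)).
    exact: prod_proj_continuous.
  by have [_ + _ _] := svalP (h i); apply.
- by move=> x; apply: functional_extensionality_dep => i; have [_ _ ->] := svalP (h i).
- by move=> x; apply: functional_extensionality_dep => i; have [_ _ _ ->] := svalP (h i).
Qed.

Lemma homeomorphic_sigT (I : choiceType) (X Y : I -> topologicalType) :
  (forall i, homeomorphic (X i) (Y i)) -> homeomorphic {i & X i} {i & Y i}.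
Proof.
move=> XY; have h i : {fg : (X i -> Y i) * (Y i -> X i) |
    [/\ continuous fg.1, continuous fg.2, cancel fg.1 fg.2 & cancel fg.2 fg.1]}.
  by apply: cid; have [f [fc [g [gc fg gf]]]] := XY i; exists (f, g).
exists (fun x => existT Y (projT1 x) ((sval (h (projT1 x))).1 (projT2 x))); split.
  move=> [i x] U /= nU; have [+ _ _ _] := svalP (h i).
  by move=> /(_ x _ nU).
exists (fun y => existT X (projT1 y) ((sval (h (projT1 y))).2 (projT2 y))); split.
- move=> [i x] U /= nU; have [_ + _ _] := svalP (h i).
  by move=> /(_ x _ nU).
- by move=> [i x] /=; have [_ _ -> _] := svalP (h i).
- by move=> [i x] /=; have [_ _ _ ->] := svalP (h i).
Qed.

Lemma lpush_comp (U V W : finType) (f : V -> U) (g : W -> V) (l : W -> rat) :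
  lpush f (lpush g l) = lpush (f \o g) l.
Proof.
apply/funext => i; rewrite /lpush.
rewrite [RHS](partition_big g (fun j => f j == i))//=.
apply: eq_bigr => j /eqP fj; apply: eq_bigl => k.
by apply/eqP/andP => [->|[_ /eqP]//]; rewrite fj eqxx.
Qed.

Lemma lpush_id (V : finType) (f : V -> V) (l : V -> rat) : f =1 id -> lpush f l = l.
Proof.
move=> fid; apply/funext => i; rewrite /lpush (big_pred1 i)// => j.
by rewrite fid.
Qed.

Section Types.
Context {M : doagType}.

Lemma tp_restrict_continuous (D : set M) (V W : finType) (f : W -> V) :
  rat_subspace D -> continuous (tp_restrict f : typespace D V -> typespace D W).
Proof.
move=> hD; apply: (type_continuous hD) => l m p Dm.
apply: filterS (near_pos p (lpush f l) hD Dm) => q.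
by rewrite !pos_restrict.
Qed.

Lemma tp_restrict_cancel (D : set M) (V W : finType) (f : W -> V) (g : V -> W)
    (p : typespace D V) : rat_subspace D -> cancel g f ->
  tp_restrict g (tp_restrict f p) = p.
Proof.
move=> hD gf; apply: type_ext => // l m Dm.
by rewrite !pos_restrict// lpush_comp lpush_id.
Qed.

Lemma closed_types_ord (V : finType) (Z : set (typespace [set (0 : M)] V)) : closed Z ->
  exists Z' : set (typespace [set (0 : M)] 'I_#|V|), closed Z' /\ homeomorphic Z Z'.
Proof.
move=> cZ; have hD := @rat_subspace1 M.
pose e : 'I_#|V| -> V := enum_val; pose e' : V -> 'I_#|V| := enum_rank.
have ee' : cancel e e' by exact: enum_valK.
have e'e : cancel e' e by exact: enum_rankK.
exists (tp_restrict e' @^-1` Z); split.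
  apply: (@closed_comp _ _ (tp_restrict e' : typespace [set (0 : M)] 'I_#|V| -> _)) => //.
  by move=> x _; exact: tp_restrict_continuous.
apply: (@homeomorphic_rel (typespace [set (0 : M)] V) (typespace [set (0 : M)] 'I_#|V|)
  _ _ (fun p r => tp_restrict e' r = p)).
- by move=> p Zp; exists (tp_restrict e p); rewrite /= tp_restrict_cancel.
- by move=> r Zr; exists (tp_restrict e' r).
- move=> p r r' _ _ h h'; rewrite -[r](@tp_restrict_cancel _ _ _ e' e)//.
  by rewrite h -h' tp_restrict_cancel.
- by move=> p p' r _ _ -> ->.
- move=> f fP; rewrite (_ : f = tp_restrict e \o val); last first.
    by apply/funext => p /=; rewrite -(fP p).2 tp_restrict_cancel.
  move=> x; apply: continuous_comp; first exact: initial_continuous.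
  exact: tp_restrict_continuous.
- move=> g gP; rewrite (_ : g = tp_restrict e' \o val); last first.
    by apply/funext => r /=; rewrite (gP r).2.
  move=> x; apply: continuous_comp; first exact: initial_continuous.
  exact: tp_restrict_continuous.
Qed.

Lemma near_neq (D : set M) (V : finType) (p q : typespace D V) : rat_subspace D ->
  q <> p -> \forall p' \near p, p' <> q.
Proof.
move=> hD qp; have [l [m [Dm h]]] : exists l m, D m /\
    ~ (pos (sval q) l m <-> pos (sval p) l m).
  apply: contrapT => h; apply: qp; apply: type_ext => // l m Dm.
  by apply: contrapT => h'; apply: h; exists l, m.
by apply: filterS (near_pos p l hD Dm) => p' + p'q; rewrite p'q.
Qed.

(** Finite sets of types are discrete, since some sign separates two distinct types on a
    neighbourhood. *)
Lemma near_finite (D : set M) (V : finType) (F : set (typespace D V))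
    (p : typespace D V) : rat_subspace D -> finite_set F ->
  \forall p' \near p, F p' -> p' = p.
Proof.
move=> hD /finite_set_list[t tF].
have h0 q : List.In q t -> \forall p' \near p, q <> p -> p' <> q.
  move=> _; have [->|qp] := pselect (q = p); first exact: near_all.
  by apply: filterS (near_neq hD qp) => p' p'q _.
apply: filterS (near_In h0) => p' h Fp'; apply: contrapT => p'p.
exact: (h _ (tF _ Fp') p'p).
Qed.

Variables (A B : set M).
Hypothesis hB : rat_subspace B.

Lemma inv_ext_restrict (V W : finType) (v : V -> M) (f : W -> V) (p : globaltype M V) :
  inv_ext A B v p -> inv_ext A B (v \o f) (tp_restrict f p : globaltype M W).
Proof.
move=> [/aut_invariantP pA /(tp_sub v p hB (@subsetT _ _)) pB]; split.
  by apply/aut_invariantP => s auts sA l m; rewrite !pos_restrict//; exact: pA.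
apply/(tp_sub _ _ hB (@subsetT _ _)) => l b Bb.
by rewrite pos_restrict// pB// lin_push.
Qed.

Section Coproduct.
Context {V : finType} (v : V -> M).
Let F := ram_ext A B v.
Let S := inv_ext A B v.
Let Sq q := inv_ext_over A B v q.
Hypothesis finF : finite_set F.

Lemma inv_ext_over_trivIset : trivIset F Sq.
Proof. by move=> q q' _ _ [p [[_ <-] [_ <-]]]. Qed.

Lemma inv_ext_ram p : S p -> F (tp_restrict val p).
Proof. exact: inv_ext_restrict. Qed.

Lemma inv_ext_bigcup : S = \bigcup_(q in F) Sq q.
Proof.
apply/seteqP; split=> [p Sp|p [q _ []]//].
by exists (tp_restrict val p) => //; exact: inv_ext_ram.
Qed.

Let Sq_sub (x : {q : F & Sq (val q)}) : S (val (projT2 x)).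
Proof. by have [] := set_valP (projT2 x). Qed.

Let existT_val (x y : {q : F & Sq (val q)}) :
  val (projT2 x) = val (projT2 y) -> x = y.
Proof.
case: x y => [q x] [q' y] /= xy.
have [_ xq] := set_valP x; have [_ yq] := set_valP y.
have qq' : q = q' by apply: val_inj; move: xq yq => /= <- <-; congr (tp_restrict _ _).
by case: _ / qq' y xy yq => y xy _; congr existT; exact: val_inj.
Qed.

Lemma inv_ext_coproduct : exists2 h : {q : F & Sq (val q)} -> S,
  homeomorphism h & forall x, val (h x) = val (projT2 x).
Proof.
pose h (x : {q : F & Sq (val q)}) : S := SigSub (mem_set (Sq_sub x)).
exists h => //; split.
  move=> [q x]; apply: val_continuous_in => {q x} -[q x] U nU.
  exact: (@initial_continuous _ _ set_val x U nU).
have SP (p : S) : S (val p) by exact: set_valP.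
pose q0 (p : S) : F := SigSub (mem_set (inv_ext_ram (SP p))).
have Sq0 (p : S) : Sq (val (q0 p)) (val p) by split => //; exact: SP.
pose g (p : S) : {q : F & Sq (val q)} := existT _ (q0 p) (SigSub (mem_set (Sq0 p))).
exists g; split; last 2 first.
- by move=> x; exact: existT_val.
- by move=> p; exact: val_inj.
move=> p U /= nU; have hT := @rat_subspaceT M.
pose rv : ram B v -> V := val.
(* Restriction to the ramified variables is continuous with finitely many values, hence locally
   constant: near [p], the map [g] stays in one summand. *)
have h1 : \forall p' \near p, tp_restrict rv (val p') = tp_restrict rv (val p).
  have h0 : \forall p' \near val p, F (tp_restrict rv p') ->
      tp_restrict rv p' = tp_restrict rv (val p).
    have nF := near_finite (tp_restrict rv (val p)) hT finF.
    have c := @tp_restrict_continuous [set: M] V _ rv hT (val p).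
    exact: (c _ nF).
  apply: filterS (near_val h0) => p'; apply; apply: inv_ext_ram; exact: SP.
have : nbhs (SigSub (mem_set (Sq0 p)) : Sq (val (q0 p)))
    [set x | U (existT _ (q0 p) x)] by exact: nU.
rewrite nbhsE => -[W [oW Wp] WU].
have [W' oW' WE] := oW.
have h2 : \forall p' \near p, W' (val p').
  apply: near_val; apply: open_nbhs_nbhs; split=> //.
  by move: Wp; rewrite -WE.
suff : \forall p' \near p, U (g p') by [].
apply: filterS2 h1 h2 => p' E Wp'.
have Sqp' : Sq (val (q0 p)) (val p') by split; [exact: SP|].
have -> : g p' = existT _ (q0 p) (SigSub (mem_set Sqp')) by exact: existT_val.
by apply: WU; rewrite -WE.
Qed.

End Coproduct.
End Types.

(** * Gluing invariant extensions of the blocks *)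

(** The elements of [g] bounded by elements of [B] in [g]. By [same_cut_shift] they preserve the
    cuts of points with group [g], whereas an arbitrary element of [g] can move a ramified point
    across [B]. *)
Definition hull (M : doagType) (B g : set M) : set M :=
  [set h | exists b, [/\ B b, g b & doag_abs h <= doag_abs b]].

Lemma abs_double (M : doagType) (b : M) : doag_abs (b + b) = doag_abs b + doag_abs b.
Proof. by rewrite -mulr2n abs_mulrn mulr2n. Qed.

Lemma subtuple_sep (M : doagType) (B : set M) (V : finType) (v : V -> M) (J : set V) :
  val3_separated B v -> val3_separated B (subtuple v (J := J)).
Proof.
move=> hsep; split=> [j|l]; first exact: hsep.1.
have sE : \sum_i l i *: subtuple v (J := J) i = \sum_i lpush val l i *: v i.
  by have := lin_push (val : J -> V) l v; rewrite /lin => ->.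
rewrite sE; have [h1 h2] := hsep.2 (lpush val l); split.
  by move=> i; have := h1 (val i); rewrite lpush_valE.
case: h2 => [|[i h]]; first by left.
have [Ji|nJi] := pselect (J i); last first.
  by left; move: h; rewrite lpush_eq0// scale0r.
right; exists (SigSub (mem_set Ji)); move: h.
by rewrite -[i in lpush _ _ i]/(val (SigSub (mem_set Ji))) lpush_valE.
Qed.

Section Setting.
Context {M : doagType} (A B C : set M).
Hypotheses (hA : rat_subspace A) (hB : rat_subspace B) (hC : rat_subspace C).
Hypotheses (hAB : A `<=` B) (hAC : A `<=` C).
Hypothesis hsat : succ_saturated (B `|` C).
Hypothesis hhom : succ_strongly_homogeneous (B `|` C).
Hypothesis hitv : forall b1 b2 : M, B b1 -> B b2 ->
  (exists2 x, C x & x \in `[b1, b2]) -> exists2 a, A a & a \in `[b1, b2].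

Lemma subsp_abs x : B x -> B (doag_abs x).
Proof. by case: (absP x) => -[_ ->] //; exact: subspN. Qed.

Section Hull.
Variable g : set M.
Hypothesis hg : convex_group g.

Lemma hull_in b : B b -> g b -> hull B g b.
Proof. by move=> Bb gb; exists b. Qed.

Lemma hull_convex : convex_group (hull B g).
Proof.
have [g0 gD gc] := hg; split.
- by apply: hull_in => //; exact: subsp0.
- move=> x y [b [Bb gb xb]] [b' [Bb' gb' yb']].
  have gabs z : g z -> g (doag_abs z) by move=> gz; apply: gc gz _; olabs.
  exists (doag_abs b + doag_abs b'); split.
  + by apply: subspD => //; exact: subsp_abs.
  + by apply: gD; exact: gabs.
  + by move: xb yb'; set z := doag_abs b; set z' := doag_abs b'; move=> xb yb'; olabs.
- by move=> x y [b [Bb gb yb]] xy; exists b; split=> //; exact: le_trans xy yb.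
Qed.

End Hull.

Lemma pos_strict_all (V : finType) (v : V -> M) (p : globaltype M V) l m :
  inv_ext A B v p -> C (lin l v) -> ~ B (lin l v) ->
  pos (sval p) l m -> ~ pos (sval p) (- l) (- m).
Proof.
move=> pinv Cs nBs; have [sm|nsm] := pselect (same_cut B (lin l v) (- m)).
  rewrite -{1}[m]opprK.
  exact: (pos_strict hA hB hC hAB hsat hhom pinv Cs nBs sm).
have nBs' : ~ B (lin (- l) v) by rewrite linN => /(subspN hB); rewrite opprK.
have nsm' : ~ same_cut B (lin (- l) v) (- - m).
  rewrite linN => /(same_cut_opp hB); rewrite !opprK.
  exact: nsm.
have [_ pB] := pinv.
rewrite (pos_off_cut hB pB nBs nsm) (pos_off_cut hB pB nBs' nsm') linN => h1 h2.
by apply: nsm; rewrite (_ : - m = lin l v)//; ola.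
Qed.

(** If [- m] is in the cut of the form, so is its shift, and the two are conjugate. Otherwise a
    point of [B] separates them, and by [cutG_near] it is more than [|b|] away from the value of the
    form, which leaves room for the shift. *)
Lemma pos_hull (V : finType) (v : V -> M) (p : globaltype M V) l m h :
  inv_ext A B v p -> C (lin l v) -> ~ B (lin l v) ->
  hull B (cutG B (lin l v)) h -> pos (sval p) l m -> pos (sval p) l (m + h).
Proof.
move=> pinv Cs nBs [b [Bb Gb hb]] plm.
have [sm|nsm] := pselect (same_cut B (lin l v) (- m)).
  have sm' : same_cut B (lin l v) (- (m + h)).
    by apply: (same_cut_shift hB nBs sm Bb Gb); move: hb; olabs.
  rewrite -[_ + _]opprK; apply: (pos_same_cut hA hAB hhom pinv Cs nBs sm sm').1.
  by rewrite opprK.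
have [_ pB] := pinv.
have sm0 : 0 <= lin l v + m by apply/(pos_off_cut hB pB nBs nsm).
case: (not_same_cut nBs nsm) => -[b' [Bb' h1 h2]]; last by exfalso; ola.
have h3 := cutG_near hB nBs Bb Gb Bb'.
have bs : b' <= lin l v by ola.
have : pos (sval p) l (- (b' + doag_abs b)).
  apply/(pos_B hB pinv); last by move: h3; olabs.
  exact: (subspN hB (subspD hB Bb' (subsp_abs Bb))).
by apply: pos_mono; move: h1 hb; olabs.
Qed.

Section Blocks.
Context {I : finType} (c : I -> M).
Hypothesis hsep : val3_separated B c.
Hypothesis cC : forall i, C (c i).

Definition rst (g : set M) (l : I -> rat) : block B c g -> rat := fun j => l (val j).

Definition tail (g : set M) (l : I -> rat) : M :=
  lin l c - lin (rst (g := g) l) (block_tuple B c g).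

Definition below (g : set M) (l : I -> rat) : Prop :=
  forall i, l i != 0 -> cutG B (c i) `<=` g.

Lemma blocks_convex g : blocks B c g -> convex_group g.
Proof. by move=> [i _ <-]; exact: cutG_convex. Qed.

Lemma blocks_notin g : blocks B c g -> exists2 s, ~ B s & cutG B s = g.
Proof. by move=> [i _ <-]; exists (c i) => //; exact: hsep.1. Qed.

Lemma tailD g l l' : tail g (l + l') = tail g l + tail g l'.
Proof.
rewrite /tail (_ : rst (l + l') = rst (g := g) l + rst l')// !linD opprD.
by rewrite addrACA.
Qed.

Lemma tailN g l : tail g (- l) = - tail g l.
Proof. by rewrite /tail (_ : rst (- l) = - rst (g := g) l)// !linN opprB opprK addrC. Qed.

Lemma block_sep g : val3_separated B (block_tuple B c g).
Proof. exact: subtuple_sep. Qed.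

Lemma sep_cutG (V : finType) (v : V -> M) l : val3_separated B v -> l <> 0 ->
  ~ B (lin l v) /\ exists2 j, l j != 0 & cutG B (lin l v) = cutG B (v j).
Proof.
move=> vsep /fun_neq0[i li]; split; first exact: (sep_notin hB hsat vsep li).
by have [j [lj -> _]] := sep_max hB hsat vsep li; exists j.
Qed.

Lemma block_cutG g k : k <> 0 ->
  ~ B (lin k (block_tuple B c g)) /\ cutG B (lin k (block_tuple B c g)) = g.
Proof.
move=> k0; have [nB [j _ ->]] := sep_cutG (block_sep g) k0; split=> //.
exact: (set_valP j).
Qed.

Lemma block_C g k : C (lin k (block_tuple B c g)).
Proof. by apply: subsp_lin => // j; exact: cC. Qed.

Lemma rst_neq0 g l i : block B c g i -> l i != 0 -> rst (g := g) l <> 0.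
Proof.
move=> gi li e; have := congr1 (fun f => f (SigSub (mem_set gi))) e.
by rewrite /rst /= => li0; move: li; rewrite li0 eqxx.
Qed.

Lemma rst_eq0 g l : rst (g := g) l <> 0 -> exists2 i, block B c g i & l i != 0.
Proof.
by move=> /fun_neq0[j lj]; exists (val j) => //; exact: (set_valP j).
Qed.

Lemma below_cutG l g : cutG B (lin l c) `<=` g -> below g l.
Proof. by move=> sg i li; apply: subset_trans sg; exact: (sep_ge hB hsep). Qed.

Lemma top_block l : l <> 0 ->
  blocks B c (cutG B (lin l c)) /\ rst (g := cutG B (lin l c)) l <> 0.
Proof.
move=> l0; have [_ [j lj E]] := sep_cutG hsep l0; split; first by exists j.
by apply: (rst_neq0 (i := j)).
Qed.

Lemma cutG_top l g : below g l -> rst (g := g) l <> 0 -> cutG B (lin l c) = g.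
Proof.
move=> bl r0; have [i gi li] := rst_eq0 r0.
have l0 : l <> 0 by move=> e; rewrite e eqxx in li.
have [_ [j lj E]] := sep_cutG hsep l0.
apply/seteqP; split; first by rewrite E; exact: bl.
by rewrite -gi; exact: (sep_ge hB hsep li).
Qed.

(* The tail has a smaller value of [val1] than [g], so a closed interval with bounds in
   [B] and radius in [B `&` g] contains it, and hence a point of [A]. *)
Lemma tail_near g l : blocks B c g -> below g l ->
  exists2 a, A a & hull B g (tail g l - a).
Proof.
move=> gB bl; have [s nBs sg] := blocks_notin gB.
pose l' : I -> rat := fun i => if `[< block B c g i >] then 0 else l i.
have tE : tail g l = lin l' c.
  have -> : tail g l = lin (l - lpush val (rst (g := g) l)) c.
    by rewrite /tail linD linN lin_push.
  congr lin; apply/funext => i; rewrite /l' [LHS]/(l i - lpush val (rst (g := g) l) i).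
  case: asboolP => gi; last by rewrite lpush_eq0//; exact: subr0.
  rewrite -[i in lpush _ _ i]/(val (SigSub (mem_set gi))) lpush_valE.
  exact: subrr.
have [l0|/eqP l0] := eqVneq l' 0.
  exists 0; first exact: subsp0.
  rewrite tE l0 lin0 subr0.
  by case: (hull_convex (blocks_convex gB)).
have [_ [j lj E]] := sep_cutG hsep l0.
have [ngj lj'] : ~ block B c g j /\ l j != 0.
  by move: lj; rewrite /l'; case: asboolP => //; rewrite eqxx.
have Ct : C (lin l' c) by exact: subsp_lin.
have [|a [b [Aa Bb Gb h]]] := near_A hB hitv Ct nBs.
  rewrite E sg; split; first exact: bl.
  by move=> h; apply: ngj; apply/seteqP; split=> //; exact: bl.
by exists a => //; exists b; rewrite tE -sg.
Qed.

Section Glue.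
Variable q : forall g : blocks B c, inv_ext A B (block_tuple B c (val g)).

Let qinv (g : blocks B c) : inv_ext A B (block_tuple B c (val g)) (val (q g)).
Proof. exact: (set_valP (q g)). Qed.

(* The proof [gB] only serves to apply [q] to the set [g]. *)
Definition block_pos (g : set M) (k : block B c g -> rat) (m : M) : Prop :=
  exists gB : blocks B c g, pos (sval (val (q (SigSub (mem_set gB))))) k m.

Let block_posE (g : blocks B c) (k : block B c (val g) -> rat) m :
  block_pos k m <-> pos (sval (val (q g))) k m.
Proof.
case: g k => x px k /=.
have key (px' : x \in blocks B c) :
    pos (sval (val (q (exist _ x px')))) k m <-> pos (sval (val (q (exist _ x px)))) k m.
  by rewrite (bool_irrelevance px' px).
split=> [[gB h]|h]; first exact: (key _).1 h.
by exists (set_mem px); exact: (key _).2 h.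
Qed.

(* The sign of a form is decided by its top block, whose value of [val1] is
   [cutG B (lin l c)]. *)
Definition glue_blocks (l : I -> rat) (m : M) : Prop :=
  (l = 0 /\ 0 <= m) \/ (l <> 0 /\
    block_pos (rst (g := cutG B (lin l c)) l) (m + tail (cutG B (lin l c)) l)).

Lemma glue_blocks_top (g : blocks B c) l m : below (val g) l ->
  rst (g := val g) l <> 0 ->
  glue_blocks l m <-> pos (sval (val (q g))) (rst (g := val g) l) (m + tail (val g) l).
Proof.
move=> bl r0; have gE := cutG_top bl r0.
have l0 : l <> 0 by move=> e; apply: r0; rewrite e.
rewrite -block_posE /glue_blocks gE; split=> [[[//]|[_]]//|h]; by right.
Qed.

Let hullg (g : blocks B c) := hull_convex (blocks_convex (set_valP g)).

Let q_hull (g : blocks B c) k m h : k <> 0 -> hull B (val g) h ->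
  pos (sval (val (q g))) k m -> pos (sval (val (q g))) k (m + h).
Proof.
move=> /block_cutG[nB E] hh; apply: (pos_hull (qinv g)) => //; first exact: block_C.
by rewrite E.
Qed.

Let q_strict (g : blocks B c) k m : k <> 0 ->
  pos (sval (val (q g))) k m -> ~ pos (sval (val (q g))) (- k) (- m).
Proof.
move=> /block_cutG[nB E]; apply: (pos_strict_all (qinv g)) => //; exact: block_C.
Qed.

Lemma glue_blocks0 m : glue_blocks 0 m <-> 0 <= m.
Proof. by split=> [[[]|[]]//|m0]; left. Qed.

(** Forms with different top blocks can only be added in a common block. Viewed in a block above its
    own, a form keeps its sign up to an error in the [hull]. *)
Lemma glue_blocks_coarse (g : blocks B c) l m : below (val g) l -> glue_blocks l m ->
  exists2 h, hull B (val g) h &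
    pos (sval (val (q g))) (rst (g := val g) l) (m + tail (val g) l + h).
Proof.
move=> bl glm; have [h0 hD hc] := hullg g.
have [r0|r0] := pselect (rst (g := val g) l = 0); last first.
  by exists 0 => //; rewrite addr0; apply/glue_blocks_top.
have [l0|l0] := pselect (l = 0).
  exists 0 => //; rewrite r0 addr0 /tail r0 l0 !lin0 subrr addr0.
  by apply/pos0; move: glm; rewrite l0 => /glue_blocks0.
have [kB rk0] := top_block l0.
set k := cutG B (lin l c) in kB rk0.
pose k' : blocks B c := SigSub (mem_set kB).
have blk : below k l by exact: below_cutG.
have := (glue_blocks_top (g := k') m blk rk0).1 glm; rewrite -/k => posk.
have kg : k `<` val g.
  have [_ [j lj E]] := sep_cutG hsep l0; split; first by rewrite /k E; exact: bl.
  move=> gk; apply: (rst_neq0 (g := val g) (l := l) (i := j) _ lj r0).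
  rewrite /block /= /Defs.val1 -E -/k; apply/seteqP; split=> //.
  by rewrite /k E; exact: bl.
have [nBk kE] := block_cutG rk0.
have [s nBs sg] := blocks_notin (set_valP g).
(* The part of the form in its own top block is at most [a + |b|] by its type over [B].
   Nonnegativity then bounds [m] plus the tail below by minus this constant. *)
have [|a [b [Aa Bb Gb ab]]] := near_A hB hitv (block_C (rst (g := k) l)) nBs.
  by rewrite kE sg.
have h1 : pos (sval (val (q k'))) (- rst (g := k) l) (a + doag_abs b).
  apply/(pos_B hB (qinv k')).
    by apply: subspD => //; [exact: hAB|exact: subsp_abs].
  by rewrite linN; move: ab; olabs.
have := pos_pair posk h1 => h2.
exists (a + doag_abs b - lin (rst (g := k) l) (block_tuple B c k)).
  exists (b + b); split; first exact: subspD.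
    rewrite -sg; case: (cutG_convex hB s) => _ + _; exact.
  by rewrite abs_double; move: ab; set z := doag_abs b; olabs.
rewrite r0; apply/pos0; move: h2; rewrite /tail r0 lin0 subr0; ola.
Qed.

Lemma glue_blocks_total l m : glue_blocks l m \/ glue_blocks (- l) (- m).
Proof.
have [->|l0] := pselect (l = 0).
  rewrite oppr0 !glue_blocks0; have /orP[|h] := doag_total 0 m; first by left.
  by right; ola.
have [gB r0] := top_block l0.
pose g : blocks B c := SigSub (mem_set gB).
have bl : below (val g) l by exact: below_cutG.
have bl' : below (val g) (- l) by move=> i li; apply: bl; rewrite -oppr_eq0.
have rN : rst (- l) = - rst (g := val g) l by [].
have r0' : rst (g := val g) (- l) <> 0.
  by rewrite rN => e; apply: r0; rewrite -[LHS]opprK -[X in - X]/(- rst (g := val g) l) e oppr0.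
rewrite (glue_blocks_top m bl r0) (glue_blocks_top (- m) bl' r0') rN tailN -opprD.
exact: pos_total.
Qed.

Lemma glue_blocks_mono l m m' : m <= m' -> glue_blocks l m -> glue_blocks l m'.
Proof.
move=> mm' [[l0 m0]|[l0 [gB h]]]; first by left; split=> //; exact: le_trans mm'.
by right; split=> //; exists gB; apply: pos_mono h; ola.
Qed.

Lemma glue_blocksD l m l' m' :
  glue_blocks l m -> glue_blocks l' m' -> glue_blocks (l + l') (m + m').
Proof.
move=> h h'; have [l0|l0] := pselect (l = 0).
  rewrite l0 add0r; apply: glue_blocks_mono h'; move: h; rewrite l0 glue_blocks0; ola.
have [l0'|l0'] := pselect (l' = 0).
  rewrite l0' addr0; apply: glue_blocks_mono h; move: h'; rewrite l0' glue_blocks0; ola.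
have [gB r0] := top_block l0; have [gB' r0'] := top_block l0'.
suff key (g : blocks B c) : below (val g) l -> below (val g) l' ->
    rst (g := val g) l <> 0 \/ rst (g := val g) l' <> 0 ->
    glue_blocks (l + l') (m + m').
  have [s|s] := convex_total (cutG_convex hB (lin l c)) (cutG_convex hB (lin l' c)).
    by apply: (key (SigSub (mem_set gB'))); [exact: below_cutG|exact: below_cutG|right].
  by apply: (key (SigSub (mem_set gB))); [exact: below_cutG|exact: below_cutG|left].
move=> bl bl' rr.
have blD : below (val g) (l + l').
  move=> i; have [li|li] := eqVneq (l i) 0; last by move=> _; exact: bl.
  have [li'|li'] := eqVneq (l' i) 0; last by move=> _; exact: bl'.
  rewrite (_ : (l + l') i = 0) ?eqxx//.
  by rewrite [LHS](_ : _ = l i + l' i)// li li'; exact: addr0.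
have [hh Hh ph] := glue_blocks_coarse bl h.
have [hh' Hh' ph'] := glue_blocks_coarse bl' h'.
have [H0 HD Hc] := hullg g.
have rD : rst (l + l') = rst (g := val g) l + rst l' by [].
have [rD0|rD0] := pselect (rst (g := val g) (l + l') = 0); last first.
  apply/(glue_blocks_top _ blD rD0).
  have /(q_hull rD0 (convexN (hullg g) (HD _ _ Hh Hh'))) := posD ph ph'.
  by apply: pos_ext => //; rewrite tailD; ola.
(* The parts in the block [g] cancel, so the sum is decided in a lower block, about which [ph] and
   [ph'] say nothing directly. If the sum were negative, [ph] and [ph'] would bound the [g]-part of
   [l] on both sides up to the [hull], and shifting one bound would contradict [q_strict]. *)
have rE' : rst (g := val g) l' = - rst (g := val g) l.
  by apply/eqP; rewrite -addr_eq0 addrC -rD rD0.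
have rl0 : rst (g := val g) l <> 0.
  by case: rr => // + e; rewrite rE' e oppr0.
apply: contrapT => nglue.
have [//|gN] := glue_blocks_total (l + l') (m + m').
have blN : below (val g) (- (l + l')) by move=> i li; apply: blD; rewrite -oppr_eq0.
have [x Hx] := glue_blocks_coarse blN gN.
have -> : rst (g := val g) (- (l + l')) = 0.
  have rDN : rst (- (l + l')) = - rst (g := val g) (l + l') by [].
  by rewrite rDN rD0 oppr0.
rewrite pos0 tailN tailD => px.
have rN0 : - rst (g := val g) l <> 0.
  by move=> e; apply: rl0; rewrite -[LHS]opprK e oppr0.
apply: (q_strict rl0 ph); rewrite rE' in ph'.
have Hz : hull B (val g) (- hh - hh' - x) by exact: (convexB (hullg g) (convexB (hullg g) (convexN (hullg g) Hh) Hh') Hx).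
have /(q_hull rN0 Hz) := ph'.
apply: pos_mono; move: px; ola.
Qed.

Lemma glue_blocks_cone : affine_cone [set: M] glue_blocks.
Proof.
split=> [l m _|l m l' m' _ _|m _]; [exact: glue_blocks_total|exact: glue_blocksD|].
exact: glue_blocks0.
Qed.

Lemma glue_blocks_restrict (g : blocks B c) (k : block B c (val g) -> rat) m :
  glue_blocks (lpush val k) m <-> pos (sval (val (q g))) k m.
Proof.
have [->|k0] := pselect (k = 0).
  rewrite (_ : lpush val _ = 0); last by apply/funext => i; rewrite /lpush big1.
  by rewrite glue_blocks0 pos0.
have rE : rst (g := val g) (lpush val k) = k.
  by apply/funext => j; rewrite /rst lpush_valE.
have bl : below (val g) (lpush val k).
  move=> i li; have [<-//|ngi] := pselect (block B c (val g) i).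
  by move: li; rewrite lpush_eq0// eqxx.
have r0 : rst (g := val g) (lpush val k) <> 0 by rewrite rE.
by rewrite (glue_blocks_top m bl r0) /tail rE lin_push subrr addr0.
Qed.

(** Replaces the tail, a constant of [C], by a nearby point of [A], which automorphisms over [A]
    fix; invariance of [q] then transfers to the glued type. *)
Lemma glue_blocks_near (g : blocks B c) l m a : below (val g) l ->
  rst (g := val g) l <> 0 -> hull B (val g) (tail (val g) l - a) ->
  glue_blocks l m <-> pos (sval (val (q g))) (rst (g := val g) l) (m + a).
Proof.
move=> bl r0 ha; rewrite (glue_blocks_top m bl r0); split=> h.
  have := q_hull r0 (convexN (hullg g) ha) h; apply: pos_ext => //; ola.
have := q_hull r0 ha h; apply: pos_ext => //; ola.
Qed.

Lemma glue_blocks_type : exists2 p : globaltype M I, inv_ext A B c p &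
  forall l m, pos (sval p) l m <-> glue_blocks l m.
Proof.
have [p pP] := cone_globaltype glue_blocks_cone; exists p => //.
split.
  apply/aut_invariantP => f autf fA l m; rewrite !pP.
  have [->|l0] := pselect (l = 0).
    by rewrite !glue_blocks0 -{2}(aut0 autf) (aut_le autf).
  have [gB r0] := top_block l0; pose g : blocks B c := SigSub (mem_set gB).
  have bl : below (val g) l by exact: below_cutG.
  have [a Aa ha] := tail_near gB bl.
  rewrite !(glue_blocks_near (g := g) _ bl r0 ha).
  have [/aut_invariantP qA _] := qinv g.
  by have := qA f autf fA (rst (g := val g) l) (m + a); rewrite autD// (fA _ Aa).
apply/(tp_sub c p hB (@subsetT _ _)) => l b Bb; rewrite pP.
have [->|l0] := pselect (l = 0); first by rewrite glue_blocks0 lin0 add0r.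
have [gB r0] := top_block l0; pose g : blocks B c := SigSub (mem_set gB).
have bl : below (val g) l by exact: below_cutG.
have [a Aa ha] := tail_near gB bl.
rewrite (glue_blocks_near (g := g) _ bl r0 ha).
have Bba : B (b + a) by apply: subspD => //; exact: hAB.
rewrite (pos_B hB (qinv g))//.
have [x [Bx gx xa]] := ha; have [nBk kE] := block_cutG r0.
rewrite -kE in gx.
(* The block part is farther than [|x|] from [- (b + a)], while the tail is within [|x|] of [a]: the
   exchange does not change the sign. *)
have := cutG_near hB nBk Bx gx (subspN hB Bba).
move: xa; rewrite /tail /=; set s := lin _ (block_tuple _ _ _).
by move=> xa h; split=> h1; apply: doag_nlt => h2; move: xa h; olabs.
Qed.

(** By totality and [pos_strict_all], one implication suffices: both cones decide every form, and
    [p] never gives a nonzero form an exact value. *)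
Lemma glue_blocks_unique (p : globaltype M I) : inv_ext A B c p ->
  (forall g, val (q g) = tp_restrict val p) ->
  forall l m, pos (sval p) l m <-> glue_blocks l m.
Proof.
move=> pinv pq; suff key l m : glue_blocks l m -> pos (sval p) l m.
  move=> l m; split; last exact: key.
  have [->|l0] := pselect (l = 0); first by rewrite pos0 glue_blocks0.
  move=> plm; have [//|/key] := glue_blocks_total l m.
  have [nBs _] := sep_cutG hsep l0.
  by move=> h; exfalso; apply: (pos_strict_all pinv _ nBs plm h); exact: subsp_lin.
have [->|l0] := pselect (l = 0); first by rewrite pos0 glue_blocks0.
have [gB r0] := top_block l0; pose g : blocks B c := SigSub (mem_set gB).
have bl : below (val g) l by exact: below_cutG.
have [a Aa [b [Bb gb ab]]] := tail_near gB bl.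
move=> /(glue_blocks_top (g := g) _ bl r0) h1.
have lE : l = lpush val (rst (g := val g) l) + (l - lpush val (rst (g := val g) l)).
  by rewrite addrC subrK.
have tE : tail (val g) l = lin (l - lpush val (rst (g := val g) l)) c.
  by rewrite /tail linD linN lin_push.
(* The terms outside the block [g] are at least [a - |b|] by the type over [B]. Using this bound
   instead of the tail costs an error in the [hull], which the [g]-part absorbs by [q_hull]. *)
have h2 : pos (sval p) (l - lpush val (rst (g := val g) l)) (- a + doag_abs b).
  apply/(pos_B hB pinv).
    exact: (subspD hB (subspN hB (hAB Aa)) (subsp_abs Bb)).
  by rewrite -tE; move: ab => /=; olabs.
have Hh : hull B (val g) (- (tail (val g) l - a + doag_abs b)).
  exists (b + b); split; first exact: subspD.
    by case: (blocks_convex gB) => _ + _; apply.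
  by rewrite abs_double; move: ab => /=; set z := doag_abs b; olabs.
have := @q_hull g _ _ _ r0 Hh h1; rewrite (pq g) pos_restrict// => h3.
have := posD h3 h2; rewrite -lE; apply: pos_ext => //; ola.
Qed.

End Glue.

Lemma inv_ext_product :
  exists2 h : inv_ext A B c ->
      prod_topology (fun g : blocks B c => inv_ext A B (block_tuple B c (val g)) : Type),
    homeomorphism h & forall p g, val (h p g) = tp_restrict val (val p).
Proof.
have hT := @rat_subspaceT M.
have PS (p : inv_ext A B c) (g : blocks B c) :
    inv_ext A B (block_tuple B c (val g)) (tp_restrict val (val p)).
  by apply: (inv_ext_restrict hB (v := c)); exact: (set_valP p).
pose h (p : inv_ext A B c) : prod_topology
    (fun g : blocks B c => inv_ext A B (block_tuple B c (val g)) : Type) :=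
  fun g => SigSub (mem_set (PS p g)).
exists h => //; split.
  apply: prod_continuous => g; apply: val_continuous_in => p.
  apply: (@continuous_comp _ _ _ (val : inv_ext A B c -> globaltype M I)
     (tp_restrict val : globaltype M I -> globaltype M (block B c (val g)))).
    exact: initial_continuous.
  exact: tp_restrict_continuous.
have ex (q : forall g : blocks B c, inv_ext A B (block_tuple B c (val g))) :
    exists p : inv_ext A B c, forall l m, pos (sval (val p)) l m <-> glue_blocks q l m.
  have [p pS pP] := glue_blocks_type q.
  by exists (SigSub (mem_set pS)).
have [f fP] := choice ex.
exists f; split.
- apply: val_continuous_in; apply: (type_continuous hT) => l m q _.
  have [l0|l0] := pselect (l = 0).
    by apply: near_all => q'; rewrite l0 !pos0.
  have [gB r0] := top_block l0; pose g : blocks B c := SigSub (mem_set gB).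
  have bl : below (val g) l by exact: below_cutG.
  have h1 := near_val (near_pos (val (q g)) (rst (g := val g) l)
    (m := m + tail (val g) l) hT Logic.I).
  have h2 : \forall q' \near q,
      pos (sval (val (q' g))) (rst (g := val g) l) (m + tail (val g) l) <->
      pos (sval (val (q g))) (rst (g := val g) l) (m + tail (val g) l).
    exact: (@prod_proj_continuous _ (fun g : blocks B c =>
      inv_ext A B (block_tuple B c (val g)) : topologicalType) g q _ h1).
  apply: filterS h2 => q' h2.
  by rewrite !fP !(glue_blocks_top (g := g) _ _ bl r0).
- move=> p; apply: val_inj; apply: globaltype_ext => l m; rewrite fP.
  by rewrite -(glue_blocks_unique (q := h p) (p := val p))//; exact: (set_valP p).
- move=> q; apply: functional_extensionality_dep => g; apply: val_inj.
  apply: globaltype_ext => k m; rewrite pos_restrict// fP.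
  exact: glue_blocks_restrict.
Qed.

End Blocks.
End Setting.

(** * Each block as a finite coproduct of closed sets of types *)

Lemma finite_sigT_homeo (T : choiceType) (D : set T) (X : D -> topologicalType) :
  finite_set D -> exists (J : finType) (e : J -> D),
    homeomorphic {q : D & X q} {j : J & X (e j)}.
Proof.
move=> /finite_seqP[s Ds].
have Dins (q : D) : val q \in s by have := set_valP q; rewrite {1}Ds.
have sinD (x : seq_sub s) : D (val x) by rewrite Ds /=; exact: valP.
pose f (q : D) : seq_sub s := SeqSub (Dins q).
pose g (x : seq_sub s) : D := SigSub (mem_set (sinD x)).
have fK : cancel f g by move=> q; exact: val_inj.
(* [J] is the subtype [D] itself with a transported finite structure, so both maps of the
   homeomorphism are identities. *)
pose J : finType := can_type fK.
exists J, (fun j : J => j : D).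
exists (fun x => x); split; first by move=> x U.
by exists (fun x => x); split=> // x U.
Qed.

Section Setting.
Context {M : doagType} (A B C : set M).
Hypotheses (hA : rat_subspace A) (hB : rat_subspace B) (hC : rat_subspace C).
Hypotheses (hAB : A `<=` B) (hAC : A `<=` C).
Hypothesis hsat : succ_saturated (B `|` C).
Hypothesis hhom : succ_strongly_homogeneous (B `|` C).
Hypothesis hitv : forall b1 b2 : M, B b1 -> B b2 ->
  (exists2 x, C x & x \in `[b1, b2]) -> exists2 a, A a & a \in `[b1, b2].
Context {V : finType} (v : V -> M) (G : set M).
Hypothesis hsep : val3_separated B v.
Hypothesis vC : forall i, C (v i).
Hypothesis vG : forall i, cutG B (v i) = G.
Hypothesis hG : convex_group G.

Lemma ram_ext_finite : finite_set (ram_ext A B v).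
Proof.
apply: (finite_ram_ext hA hB hC hAB hsat hhom (G := G)) => //.
- exact: subtuple_sep.
- by move=> j; exact: vC.
- by move=> j; exact: vG.
- by move=> j; exact: (set_valP j).
Qed.

Lemma inv_ext_over_closed (q : ram_ext A B v) :
  exists (n : nat) (Z : set (typespace [set (0 : M)] 'I_n)),
    closed Z /\ homeomorphic (inv_ext_over A B v (val q)) Z.
Proof.
have [Z [cZ hZ]] := closed_types_ord (@gen_types_closed _ B V v G (val q)).
exists _, Z; split=> //; apply: homeomorphic_trans hZ.
exact: (inv_ext_over_homeo hA hB hC hAB hsat hhom hitv hsep vC vG hG (set_valP q)).
Qed.

Lemma inv_ext_closed_coproduct :
  exists (J : finType) (n : J -> nat)
    (Z : forall j : J, set (typespace [set (0 : M)] 'I_(n j))),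
    (forall j, closed (Z j)) /\ homeomorphic (inv_ext A B v) {j : J & Z j}.
Proof.
have [J [e he]] := finite_sigT_homeo
  (fun q : ram_ext A B v => inv_ext_over A B v (val q) : topologicalType) ram_ext_finite.
have dec j : {nZ : {n : nat & set (typespace [set (0 : M)] 'I_n)} |
    closed (projT2 nZ) /\ homeomorphic (inv_ext_over A B v (val (e j))) (projT2 nZ)}.
  apply: cid; have [n [Z hZ]] := inv_ext_over_closed (e j).
  by exists (existT _ n Z).
exists J, (fun j => projT1 (sval (dec j))), (fun j => projT2 (sval (dec j))); split.
  by move=> j; case: (svalP (dec j)).
have [h hh _] := inv_ext_coproduct hB ram_ext_finite.
apply: (@homeomorphic_trans _ {q : ram_ext A B v & inv_ext_over A B v (val q)}).
  by apply: homeomorphic_sym; exists h.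
apply: homeomorphic_trans he _.
apply: (@homeomorphic_sigT J
  (fun j => inv_ext_over A B v (val (e j)) : topologicalType)
  (fun j => projT2 (sval (dec j)) : topologicalType)) => j.
by case: (svalP (dec j)).
Qed.

End Setting.

Theorem mainTheorem3 (M : doagType) (A B C : set M) (I : finType) (c : I -> M)
  (hA : rat_subspace A) (hB : rat_subspace B) (hC : rat_subspace C)
  (hAB : A `<=` B) (hAC : A `<=` C)
  (hsat : succ_saturated (B `|` C))
  (hhom : succ_strongly_homogeneous (B `|` C))
  (hitv : forall b1 b2 : M, B b1 -> B b2 ->
     (exists2 x, C x & x \in `[b1, b2]) -> exists2 a, A a & a \in `[b1, b2])
  (hcC : forall i, C (c i)) (hsep : val3_separated B c) :
  let c_ (g : blocks B c) := block_tuple B c (val g) in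
  let F g := ram_ext A B (c_ g) in
  let S g := inv_ext A B (c_ g) in
  let Sq g q := inv_ext_over A B (c_ g) q in
  [/\ forall g, finite_set (F g),
      forall g (q : F g), exists (n : nat) (Z : set (typespace [set (0 : M)] 'I_n)),
        closed Z /\ homeomorphic (Sq g (val q)) Z,
      forall g,
        [/\ trivIset (F g) (Sq g),
            S g = \bigcup_(q in F g) Sq g q
          & exists2 h : {q : F g & Sq g (val q)} -> S g,
              homeomorphism h & forall x, val (h x) = val (projT2 x)],
      exists2 h : inv_ext A B c -> prod_topology (fun g => S g : Type),
        homeomorphism h &
        forall p g, val (h p g) = tp_restrict val (val p)
    & exists (J : blocks B c -> finType) (n : forall g, J g -> nat)
        (Z : forall g (j : J g), set (typespace [set (0 : M)] 'I_(n g j))),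
        (forall g j, closed (Z g j)) /\
        homeomorphic (inv_ext A B c) (prod_topology (fun g => {j : J g & Z g j}))].
Proof.
move=> c_ F S Sq.
have sepg (g : blocks B c) : val3_separated B (c_ g) by exact: block_sep.
have Cg (g : blocks B c) j : C (c_ g j) by exact: hcC.
have Gg (g : blocks B c) j : cutG B (c_ g j) = val g by exact: (set_valP j).
have cvx (g : blocks B c) : convex_group (val g).
  exact: (blocks_convex hB (set_valP g)).
have finF (g : blocks B c) : finite_set (F g).
  exact: (ram_ext_finite hA hB hC hAB hsat hhom (sepg g) (Cg g) (Gg g) (cvx g)).
have [h hh hE] := inv_ext_product hA hB hC hAB hsat hhom hitv hsep hcC.
have decomp (g : blocks B c) := inv_ext_closed_coproduct hA hB hC hAB hsat hhom hitv
  (sepg g) (Cg g) (Gg g) (cvx g).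
split.
- exact: finF.
- move=> g q.
  exact: (inv_ext_over_closed hA hB hC hAB hsat hhom hitv (sepg g) (Cg g) (Gg g) (cvx g)).
- move=> g; split; [exact: inv_ext_over_trivIset|exact: inv_ext_bigcup|].
  exact: (inv_ext_coproduct hB (finF g)).
- by exists h.
(* The decompositions exist block by block; choosing their data in order of dependency turns them
   into functions of the block. *)
pose dJ g := cid (decomp g); pose dn g := cid (svalP (dJ g)).
pose dZ g := cid (svalP (dn g)).
exists (fun g => sval (dJ g)), (fun g => sval (dn g)), (fun g => sval (dZ g)); split.
  by move=> g; case: (svalP (dZ g)).
apply: (@homeomorphic_trans _
  (prod_topology (fun g : blocks B c => S g : topologicalType))).
  by exists h.
apply: (@homeomorphic_prod _ (fun g : blocks B c => S g : topologicalType)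
  (fun g => {j : sval (dJ g) & sval (dZ g) j} : topologicalType)) => g.
by case: (svalP (dZ g)).
Qed.
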